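(* Let $T=\sum_{i=1}^k \lambda_i\Gamma_{u_i}\in C$ (with $\lambda_i>0$, $u_i\in SBV(I)$) be such that the set $S_T=\bigcup_{i=1}^k S_{u_i}$ is finite. Then there exist $k'\in\mathbb{N}$, numbers $\mu_1,\dots,\mu_{k'}\ge 0$ and functions $w_1,\dots,w_{k'}\in SBV(I)$ such that $T=\sum_{i=1}^{k'}\mu_i\Gamma_{w_i}$ and $$G(T)=\sum_{i=1}^{k'}\mu_i\,G(\Gamma_{w_i}).$$
   Context: $I\subset\mathbb{R}$ is an open bounded interval, $\alpha>0$, $\beta\ge 0$, $g\in L^\infty(I)$ (a representative is fixed). For $u\in SBV(I)$, $S_u$ is its singular (jump) set, $u^l(x),u^r(x)$ are its left and right traces, and $u^-(x)\le u^+(x)$ its lower and upper traces. The extended graph is $\Gamma_u=\{(x,t)\in I\times\mathbb{R}: u^-(x)\le t\le u^+(x)\}$; the same symbol denotes the multiplicity-one rectifiable $1$-current in $I\times\mathbb{R}$ carried by it, oriented by the direction $(1,u')$ on the non-vertical part and from $u^l(x)$ to $u^r(x)$ on each vertical jump segment $\{x\}\times[u^-(x),u^+(x)]$. A rectifiable $1$-current $T=(\mathcal{M},\theta,\tau)$ in $I\times\mathbb{R}$ consists of a $1$-rectifiable set $\mathcal{M}$, a multiplicity $\theta:\mathcal{M}\to\mathbb{R}_+$ and a unit tangent orientation $\tau$, acting by $T(\omega)=\int_{\mathcal{M}}\langle\omega,\tau\rangle\theta\,d\mathcal{H}^1$. Its normal is $\nu_T=-\star\tau=(\tau^t,-\tau^x)$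 where $\tau=(\tau^x,\tau^t)$. $C=\{T=\sum_{i=1}^k\lambda_i\Gamma_{u_i}: k\in\mathbb{N},\ \lambda_i\in\mathbb{R}_+=(0,\infty),\ u_i\in SBV(I)\}$. $K$ is the set of Borel maps $\phi=(\phi^x,\phi^t):I\times\mathbb{R}\to\mathbb{R}^2$ such that $\phi^t(x,t)\ge\frac{|\phi^x(x,t)|^2}{4}-\beta(t-g(x))^2$ for all $x\in I,t\in\mathbb{R}$, and $\left|\int_{t_1}^{t_2}\phi^x(x,t)\,dt\right|\le\alpha$ for all $x\in I$ and all $t_1,t_2\in\mathbb{R}$. For $T=(\mathcal{M},\theta,\tau)$, $G(T)=\sup_{\phi\in K}\int_{\mathcal{M}}\theta\langle\phi,\nu_T\rangle\,d\mathcal{H}^1$. *)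

(* Defs.v *)
From HB Require Import structures.
From mathcomp Require Import all_boot all_order all_algebra.
From mathcomp Require Import all_classical all_reals all_analysis.

Set Implicit Arguments.
Unset Strict Implicit.
Unset Printing Implicit Defensive.

Import Order.TTheory GRing.Theory Num.Theory.
Import numFieldNormedType.Exports.

Local Open Scope classical_set_scope.
Local Open Scope ring_scope.

(* H^1 on the Euclidean plane.  The library norm on R * R is the max norm, so
   the Euclidean distance is written out. *)

Section hausdorff.
Context {R : realType}.
Local Notation plane := (R * R)%type.
Local Open Scope ereal_scope.

Definition dist2 (p q : plane) : R :=
  Num.sqrt ((p.1 - q.1) ^+ 2 + (p.2 - q.2) ^+ 2)%R.

(* the added 0 makes the diameter of the empty set 0 *)
Definition diam2 (A : set plane) : \bar R :=
  ereal_sup ([set (dist2 z.1 z.2)%:E | z in A `*` A] `|` [set 0]).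

Definition hausdorff1_pre (delta : R) (A : set plane) : \bar R :=
  ereal_inf [set \sum_(n <oo) diam2 (C n) | C in
    [set C : (set plane)^nat | A `<=` \bigcup_n C n /\
                               forall n, diam2 (C n) <= delta%:E]].

(* the normalising constant of the one-dimensional Hausdorff measure is 1 *)
Definition hausdorff1 (A : set plane) : \bar R :=
  ereal_sup [set hausdorff1_pre delta A | delta in [set d : R | (0 < d)%R]].

Lemma diam2_ge0 A : 0 <= diam2 A.
Proof. by apply: ereal_sup_ubound; right. Qed.

Lemma diam2_set0 : diam2 set0 = 0.
Proof.
rewrite /diam2 (_ : [set _ | _ in _] = set0) ?set0U ?ereal_sup1//.
by rewrite setX0 image_set0.
Qed.

(* all subsets measurable: lets mu_ext range over covers by arbitrary sets *)
Definition discrete_plane : Type := plane.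
HB.instance Definition _ := Pointed.on discrete_plane.
HB.instance Definition _ := @isMeasurable.Build default_measure_display
  discrete_plane discrete_measurable discrete_measurable0
  (@discrete_measurableC _) (@discrete_measurableU _).

Let gauge (delta : R) (A : set discrete_plane) : \bar R :=
  if diam2 A <= delta%:E then diam2 A else +oo.

Let gauge_ge0 delta A : 0 <= gauge delta A.
Proof. by rewrite /gauge; case: ifPn => // _; exact: diam2_ge0. Qed.

Let hausdorff1_preE delta : hausdorff1_pre delta = mu_ext (gauge delta).
Proof.
apply/funext => A; apply/eqP; rewrite eq_le; apply/andP; split.
- apply: le_ereal_inf_tmp => _ [C [_ AC] <-].
  have [Cd|/existsNP[n /negP nCd]] := pselect (forall n, diam2 (C n) <= delta%:E).
    apply: ereal_inf_lbound; exists C => //.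
    by apply: eq_eseriesr => n _; rewrite /gauge Cd.
  rewrite (eseries_pinfty _ _ (_ : gauge delta (C n) = +oo)) ?leey//.
    by move=> m _; rewrite -ltNye (lt_le_trans _ (gauge_ge0 _ _)).
  by rewrite /gauge (negbTE nCd).
- apply: le_ereal_inf_tmp => _ [C [AC Cd] <-].
  apply: ereal_inf_lbound; exists C => //.
  by apply: eq_eseriesr => n _; rewrite /gauge Cd.
Qed.

Let hausdorff1_pre0 delta : (0 < delta)%R -> hausdorff1_pre delta set0 = 0.
Proof.
move=> d0; have g0 : gauge delta set0 = 0.
  by rewrite /gauge diam2_set0 lee_fin (ltW d0).
by rewrite hausdorff1_preE; exact: (mu_ext0 g0 (gauge_ge0 delta)).
Qed.

Let hausdorff1_0 : hausdorff1 set0 = 0.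
Proof.
rewrite /hausdorff1 (_ : [set _ | _ in _] = [set 0]) ?ereal_sup1//.
apply/seteqP; split => [_ [d /= d0 <-]|_ ->]; first exact: hausdorff1_pre0.
by exists 1%R => //=; exact: hausdorff1_pre0.
Qed.

Let hausdorff1_pre_ge0 d A : 0 <= hausdorff1_pre d A.
Proof. by rewrite hausdorff1_preE; apply: mu_ext_ge0; exact: gauge_ge0. Qed.

Let hausdorff1_ge0 A : 0 <= hausdorff1 A.
Proof.
apply: le_ereal_sup_tmp; exists (hausdorff1_pre 1 A) => //.
by exists 1%R => //=.
Qed.

Let le_hausdorff1 : {homo hausdorff1 : A B / A `<=` B >-> A <= B}.
Proof.
move=> A B AB; apply: ge_ereal_sup => _ [d d0 <-].
apply: le_ereal_sup_tmp; exists (hausdorff1_pre d B); first by exists d.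
by rewrite hausdorff1_preE; exact: le_mu_ext.
Qed.

Let hausdorff1_sigma_subadditive : sigma_subadditive hausdorff1.
Proof.
move=> F; apply: ge_ereal_sup => _ [d d0 <-].
rewrite hausdorff1_preE.
apply: (le_trans (mu_ext_sigma_subadditive _ _)); first exact: gauge_ge0.
apply: lee_nneseries => [n _ _|n _]; first exact/mu_ext_ge0/gauge_ge0.
by rewrite -hausdorff1_preE; apply: ereal_sup_ubound; exists d.
Qed.

HB.instance Definition _ := isOuterMeasure.Build R plane hausdorff1
  hausdorff1_0 hausdorff1_ge0 le_hausdorff1 hausdorff1_sigma_subadditive.

End hausdorff.

Definition hausdorff1_outer (R : realType) :
  {outer_measure set (R * R)%type -> \bar R} := @hausdorff1 R.

(* the plane with the sigma-algebra of H^1-measurable (Caratheodory) sets *)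
Notation H1plane R := (caratheodory_type (@hausdorff1_outer R)).

Definition H1 (R : realType) : {measure set (H1plane R) -> \bar R} :=
  (@hausdorff1_outer R : set (H1plane R) -> \bar R).

Section sbv.
Context {R : realType}.
Local Notation leb := (@lebesgue_measure R).
Implicit Types (u f phi : R -> R) (a b x l r : R).

Definition scaled_dev u l r (D : set R) : \bar R :=
  ((r^-1)%:E * \int[leb]_(y in D) `|u y - l|%R%:E)%E.

Definition ltrace_spec u x l :=
  scaled_dev u l r `]x - r, x[ @[r --> 0^'+] --> 0%E.

Definition rtrace_spec u x l :=
  scaled_dev u l r `]x, x + r[ @[r --> 0^'+] --> 0%E.

(* one-sided traces; junk value 0 where they do not exist, which never
   happens in I for u in BV(I) *)
Definition ltrace u x : R := xget 0 [set l | ltrace_spec u x l].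
Definition rtrace u x : R := xget 0 [set l | rtrace_spec u x l].

Definition lower_trace u x : R := Num.min (ltrace u x) (rtrace u x).
Definition upper_trace u x : R := Num.max (ltrace u x) (rtrace u x).

Definition approx_limit_spec u x l :=
  scaled_dev u l r `]x - r, x + r[ @[r --> 0^'+] --> 0%E.

(* S_u: the points of I = ]a, b[ where u has no approximate limit *)
Definition jump_set a b u : set R :=
  [set x | (x \in `]a, b[) /\ ~ (exists l, approx_limit_spec u x l)].

(* C^1 functions with compact support in ]a, b[ *)
Definition C1c a b phi :=
  [/\ forall x, derivable phi x 1, continuous (derive1 phi)
    & exists K : set R, [/\ compact K, K `<=` `]a, b[
                          & forall x, ~ K x -> phi x = 0]].

(* Du = f dx + (u^r - u^l) H^0 restricted to S_u, a finite measure on ]a, b[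
   (no Cantor part); f is the approximate derivative u' *)
Definition sbv_derivative a b u f :=
  [/\ leb.-integrable `]a, b[ (EFin \o f),
      (@counting R R).-integrable (jump_set a b u)
        (fun x => (rtrace u x - ltrace u x)%:E)
    & forall phi, C1c a b phi ->
        \int[leb]_(x in `]a, b[) (u x * derive1 phi x) =
        - (\int[leb]_(x in `]a, b[) (f x * phi x) +
           \int[@counting R R]_(x in jump_set a b u)
              ((rtrace u x - ltrace u x) * phi x))].

Definition SBV a b u :=
  leb.-integrable `]a, b[ (EFin \o u) /\ exists f, sbv_derivative a b u f.

(* u', unique up to Lebesgue-null sets for u in SBV(I) *)
Definition sbv_deriv a b u : R -> R :=
  xget (fun=> 0) [set f | sbv_derivative a b u f].

(* L^oo(]a, b[), for a function g defined pointwise (so g may be any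
   Lebesgue-measurable representative, the library sigma-algebra being Borel) *)
Definition in_Loo a b (g : R -> R) :=
  exists2 h : R -> R, h \_ `]a, b[ \in Lfun leb +oo%E
    & g = h %[ae leb in `]a, b[%classic].

End sbv.

Section currents.
Context {R : realType}.
Local Notation plane := (R * R)%type.

Definition strip (a b : R) : set plane := `]a, b[ `*` setT.

Record rcurrent := RCurrent {
  carrier : set plane ;
  mult : plane -> R ;
  orient : plane -> plane }.

(* countably H^1-rectifiable *)
Definition rectifiable1 (M : set plane) :=
  exists gamma : nat -> R -> plane,
    (forall n, lipschitz (gamma n)) /\
    hausdorff1 (M `\` \bigcup_n range (gamma n)) = 0%E.

(* tau spans the approximate tangent line of M: at H^1-almost every point of M
   it is parallel to the velocity of any given Lipschitz curve through it *)
Definition tangent_field (M : set plane) (tau : plane -> plane) :=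
  forall gamma : R -> plane, lipschitz gamma ->
    hausdorff1 [set z | M z /\ exists s,
      [/\ gamma s = z, derivable gamma s 1
        & (tau z).1 * (derive1 gamma s).2 - (tau z).2 * (derive1 gamma s).1 != 0]]
    = 0%E.

Definition rectifiable_current (a b : R) (T : rcurrent) :=
  [/\ carrier T `<=` strip a b,
      measurable (carrier T : set (H1plane R)) /\ rectifiable1 (carrier T),
      [/\ forall z, carrier T z -> 0 < mult T z,
          measurable_fun (carrier T : set (H1plane R)) (mult T)
        & forall K : set plane, compact K -> K `<=` strip a b ->
            (\int[H1 R]_(z in carrier T `&` K) (mult T z)%:E < +oo)%E]
    & [/\ forall z, carrier T z ->
            (orient T z).1 ^+ 2 + (orient T z).2 ^+ 2 = 1,
          measurable_fun (carrier T : set (H1plane R))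
            (orient T : H1plane R -> plane)
        & tangent_field (carrier T) (orient T)]].

(* 1-forms omega.1 dx + omega.2 dt *)
Definition oneform : Type := (plane -> R) * (plane -> R).

Definition rc_act (T : rcurrent) (omega : oneform) : R :=
  \int[H1 R]_(z in carrier T)
    ((omega.1 z * (orient T z).1 + omega.2 z * (orient T z).2) * mult T z).

(* C^oo: all iterated directional derivatives are differentiable *)
Definition smooth (f : plane -> R) :=
  forall (s : seq plane) (z : plane),
    differentiable (foldr (fun (v : plane) (h : plane -> R) => 'D_v h) f s) z.

Definition test_form (a b : R) (omega : oneform) :=
  [/\ smooth omega.1, smooth omega.2
    & exists K : set plane, [/\ compact K, K `<=` strip a b
        & forall z, ~ K z -> omega.1 z = 0 /\ omega.2 z = 0]].

Definition graph_set (a b : R) (u : R -> R) : set plane :=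
  [set z | (z.1 \in `]a, b[) /\ lower_trace u z.1 <= z.2 <= upper_trace u z.1].

Definition graph_orient (a b : R) (u : R -> R) (z : plane) : plane :=
  if `[< jump_set a b u z.1 >]
  then (0, Num.sg (rtrace u z.1 - ltrace u z.1))
  else let d := sbv_deriv a b u z.1 in
       let n := Num.sqrt (1 + d ^+ 2) in (n^-1, d / n).

(* the current Gamma_u in I x R, I = ]a, b[ *)
Definition Gamma (a b : R) (u : R -> R) : rcurrent :=
  RCurrent (graph_set a b u) (fun=> 1) (graph_orient a b u).

(* T = sum_i c_i Gamma_(u_i) as currents in I x R *)
Definition is_graph_sum (a b : R) (T : rcurrent) (k : nat)
    (c : 'I_k -> R) (u : 'I_k -> R -> R) :=
  forall omega, test_form a b omega ->
    rc_act T omega = \sum_(i < k) c i * rc_act (Gamma a b (u i)) omega.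

Definition normal (T : rcurrent) (z : plane) : plane :=
  ((orient T z).2, - (orient T z).1).

(* The integrability clause says that the integral of phi^x makes sense. *)
Definition Kset (a b alpha beta : R) (g : R -> R) : set (plane -> plane) :=
  [set phi : plane -> plane | [/\ measurable_fun (strip a b) phi,
    forall x t, x \in `]a, b[ ->
      (phi (x, t)).1 ^+ 2 / 4 - beta * (t - g x) ^+ 2 <= (phi (x, t)).2
    & forall x t1 t2, x \in `]a, b[ ->
      (@lebesgue_measure R).-integrable `[t1, t2]
        (fun t => (phi (x, t)).1%:E) /\
      `| \int[@lebesgue_measure R]_(t in `[t1, t2]) (phi (x, t)).1 |
        <= alpha]].

(* A phi whose integral is undefined (infinite positive and negative parts)
   does not contribute: the library convention is then +oo - +oo = -oo. *)
Definition G (a b alpha beta : R) (g : R -> R) (T : rcurrent) : \bar R :=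
  ereal_sup [set \int[H1 R]_(z in carrier T)
      (mult T z * ((phi z).1 * (normal T z).1 +
                   (phi z).2 * (normal T z).2))%:E
    | phi in Kset a b alpha beta g]%E.

End currents.

Arguments rcurrent : clear implicits.

(* Main.v *)
(** Let (mu_j, w_j) be curves whose graphs sum to T and such that, at every jump
    point s, no height is both the left trace of a jumping curve and the right
    trace of a jumping curve. Then G(T) = sum_j mu_j E(w_j), where E(u) is the
    integral of (u'^2 + beta (t - g)^2) / sqrt (1 + u'^2) over the graph of u, plus
    alpha times the number of jumps. The bound <= is the pointwise inequality
    phi^x u' - phi^t <= u'^2 + beta (t - g)^2 on the graphs and the bound on the
    integrals of phi^x on vertical lines. For >= take phi^x = 2 w_j' on the graphs,
    which is consistent because derivatives coincide a.e. where traces do, and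
    which does not affect integrals over vertical lines because those meet the
    graphs in finitely many points. Over a jump point s let phi^x be the derivative
    of a potential with values in [0, alpha] that vanishes at the left traces of
    the jumping curves and equals alpha at their right traces. For a single curve
    this gives G(Gamma_u) = E(u).

    Such a family arises from (lambda_i, u_i) by cutting all curves at each jump
    point in turn and gluing left halves to right halves along a coupling of the
    weights with itself: this changes neither the halves nor the total signed
    vertical part, and the coupling can be chosen so that no height is the start
    of one jump and the end of another. *)

Require Import Defs.
From HB Require Import structures.
From mathcomp Require Import all_boot all_order all_algebra.
From mathcomp Require Import all_classical all_reals all_analysis.
From mathcomp Require Import measurable_realfun ess_sup_inf.
From mathcomp Require Import ring lra.

Set Implicit Arguments.
Unset Strict Implicit.
Unset Printing Implicit Defensive.

Import Order.TTheory GRing.Theory Num.Theory.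
Import numFieldNormedType.Exports.

Local Open Scope classical_set_scope.
Local Open Scope ring_scope.

(** * Borel sets and vertical lines for the Hausdorff measure *)

Section hausdorff_facts.
Context {R : realType}.
Local Notation plane := (R * R)%type.

Lemma dist2_ge_fst (p q : plane) : `|p.1 - q.1| <= dist2 p q.
Proof. by rewrite /dist2 -sqrtr_sqr ler_sqrt ?addr_ge0 ?sqr_ge0// lerDl sqr_ge0. Qed.

Lemma dist2_ge_snd (p q : plane) : `|p.2 - q.2| <= dist2 p q.
Proof. by rewrite /dist2 -sqrtr_sqr ler_sqrt ?addr_ge0 ?sqr_ge0// lerDr sqr_ge0. Qed.

Lemma dist2_le_add (p q : plane) : dist2 p q <= `|p.1 - q.1| + `|p.2 - q.2|.
Proof.
rewrite /dist2 -[leRHS]ger0_norm ?addr_ge0// -sqrtr_sqr ler_sqrt ?sqr_ge0//.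
rewrite [leRHS]sqrrD !real_normK ?num_real//.
by rewrite lerD2r lerDl mulrn_wge0// mulr_ge0.
Qed.

Local Open Scope ereal_scope.

Lemma dist2_le_diam2 (A : set plane) p q : A p -> A q -> (dist2 p q)%:E <= diam2 A.
Proof. by move=> Ap Aq; apply: ereal_sup_ubound; left; exists (p, q). Qed.

Lemma diam2_le (A : set plane) (d : R) : (0 <= d)%R ->
  (forall p q, A p -> A q -> (dist2 p q <= d)%R) -> diam2 A <= d%:E.
Proof.
move=> d0 Ad; apply: ge_ereal_sup => _ [[[p q] [/= Ap Aq] <-]|->]; last by rewrite lee_fin.
by rewrite lee_fin Ad.
Qed.

Lemma le_diam2 (A B : set plane) : A `<=` B -> diam2 A <= diam2 B.
Proof.
move=> AB; apply: ereal_sup_le => _ [[[p q] [/= Ap Aq] <-]|->]; last by right.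
by left; exists (p, q) => //; split; apply: AB.
Qed.

Lemma hausdorff1_pre_le (delta : R) (A : set plane) (C : (set plane)^nat) :
  A `<=` \bigcup_n C n -> (forall n, diam2 (C n) <= delta%:E) ->
  hausdorff1_pre delta A <= \sum_(n <oo) diam2 (C n).
Proof. by move=> AC Cd; apply: ereal_inf_lbound; exists C. Qed.

Lemma hausdorff1_pre_sep (delta : R) (A B : set plane) :
  (forall p q, A p -> B q -> (delta < dist2 p q)%R) ->
  hausdorff1_pre delta A + hausdorff1_pre delta B <= hausdorff1_pre delta (A `|` B).
Proof.
move=> sepAB; apply: le_ereal_inf_tmp => _ [C [ABC Cd] <-].
have AC : A `<=` \bigcup_n (C n `&` A).
  by move=> p Ap; have [n _ Cnp] := ABC p (or_introl Ap); exists n.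
have BC : B `<=` \bigcup_n (C n `&` B).
  by move=> p Bp; have [n _ Cnp] := ABC p (or_intror Bp); exists n.
apply: (@le_trans _ _ (\sum_(n <oo) (diam2 (C n `&` A) + diam2 (C n `&` B)))).
  rewrite nneseriesD//; last 2 first.
  - by move=> n _ _; exact: diam2_ge0.
  - by move=> n _ _; exact: diam2_ge0.
  by apply: leeD; apply: hausdorff1_pre_le => // n;
    apply: (le_trans _ (Cd n)); apply: le_diam2 => p [].
apply: lee_nneseries => [n _ _|n _]; first by rewrite adde_ge0// diam2_ge0.
have [[p [Cp Ap]]|/set0P/negP/negPn/eqP ->] := pselect (exists p, (C n `&` A) p); last first.
  by rewrite diam2_set0 add0e; apply: le_diam2 => p [].
have [[q [Cq Bq]]|/set0P/negP/negPn/eqP ->] := pselect (exists q, (C n `&` B) q); last first.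
  by rewrite diam2_set0 adde0; apply: le_diam2 => ? [].
have := le_trans (dist2_le_diam2 Cp Cq) (Cd n).
by rewrite lee_fin leNgt sepAB.
Qed.

Lemma le_hausdorff1_pre (d1 d2 : R) (A : set plane) : (d1 <= d2)%R ->
  hausdorff1_pre d2 A <= hausdorff1_pre d1 A.
Proof.
move=> d12; apply: le_ereal_inf_tmp => _ [C [AC Cd] <-].
by apply: hausdorff1_pre_le => // n; rewrite (le_trans (Cd n))// lee_fin.
Qed.

Lemma hausdorff1_pre_ge0 (d : R) (A : set plane) : 0 <= hausdorff1_pre d A.
Proof.
apply: le_ereal_inf_tmp => _ [C _ <-].
by apply: nneseries_ge0 => n _ _; exact: diam2_ge0.
Qed.

Lemma hausdorff1_ge (d : R) (A : set plane) : (0 < d)%R ->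
  hausdorff1_pre d A <= hausdorff1 A.
Proof. by move=> d0; apply: ereal_sup_ubound; exists d. Qed.

Lemma hausdorff1_sep (eps : R) (A B : set plane) : (0 < eps)%R ->
  (forall p q, A p -> B q -> (eps <= dist2 p q)%R) ->
  hausdorff1 A + hausdorff1 B <= hausdorff1 (A `|` B).
Proof.
move=> e0 sepAB.
have key (d1 d2 : R) : (0 < d1)%R -> (0 < d2)%R ->
    hausdorff1_pre d1 A + hausdorff1_pre d2 B <= hausdorff1 (A `|` B).
  move=> d10 d20; pose d := Num.min (Num.min d1 d2) (eps / 2)%R.
  have d0 : (0 < d)%R by rewrite !lt_min d10 d20/= divr_gt0.
  apply: (le_trans _ (hausdorff1_ge _ d0)).
  apply: (le_trans _ (hausdorff1_pre_sep _)); last first.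
    move=> p q Ap Bq; apply: (lt_le_trans _ (sepAB _ _ Ap Bq)).
    by rewrite gt_min; apply/orP; right; rewrite ltr_pdivrMr// ltr_pMr// ltr1n.
  apply: leeD; apply: le_hausdorff1_pre; rewrite !ge_min lexx//= ?orbT//.
have [->|] := eqVneq (hausdorff1 (A `|` B)) +oo; first exact: leey.
rewrite -ltey => ABoo.
have B0 : 0 <= hausdorff1 B := outer_measure_ge0 (hausdorff1_outer R) B.
have Bfin : hausdorff1 B \is a fin_num.
  rewrite ge0_fin_numE//; apply: le_lt_trans ABoo.
  exact: (le_outer_measure (hausdorff1_outer R)).
rewrite -leeBrDr//; apply: ge_ereal_sup => _ [d1 /= d10 <-].
have Afin : hausdorff1_pre d1 A \is a fin_num.
  rewrite ge0_fin_numE ?hausdorff1_pre_ge0//; apply: le_lt_trans ABoo.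
  apply: (le_trans (hausdorff1_ge _ d10)).
  exact: (le_outer_measure (hausdorff1_outer R)).
rewrite leeBrDr// addeC -leeBrDr//; apply: ge_ereal_sup => _ [d2 /= d20 <-].
by rewrite leeBrDr// addeC key.
Qed.

Lemma caratheodory_superlevel (f : plane -> R) (c : R) :
  (forall p q, `|f p - f q| <= dist2 p q)%R ->
  (hausdorff1_outer R).-caratheodory [set p | (c < f p)%R].
Proof.
move=> flip; apply: le_caratheodory_measurable => X.
set P := [set p | _]; set mu := hausdorff1_outer R.
have [->|] := eqVneq (mu X) +oo; first exact: leey.
rewrite -ltey => Xoo.
pose a n := (c + n.+1%:R^-1)%R.
have acS n : (a n.+1 < a n)%R by rewrite ltrD2l ltf_pV2 ?posrE// ltr_nat.
have a_gt n : (c < a n)%R by rewrite ltrDl.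
pose A n := X `&` [set p | (a n < f p)%R].
have AS n : A n `<=` A n.+1 by move=> p [Xp /= ?]; split => //=; rewrite (lt_trans (acS n)).
pose D n := A n.+1 `\` A n.
have AX n : mu (A n) <= mu X by apply: le_outer_measure => p [].
have sepA (E1 E2 : set plane) (e1 e2 : R) : (e1 < e2)%R ->
    (forall p, E2 p -> (e2 <= f p)%R) -> (forall p, E1 p -> (f p <= e1)%R) ->
    mu E2 + mu E1 <= mu (E2 `|` E1).
  move=> e12 E2e E1e; apply: (@hausdorff1_sep (e2 - e1)); first by rewrite subr_gt0.
  move=> p q E2p E1q; apply: le_trans (flip p q); apply: le_trans (ler_norm _).
  by rewrite lerB ?E2e ?E1e.
have AD n : mu (A n) + mu (D n.+1) <= mu (A n.+2).
  apply: (@le_trans _ _ (mu (A n `|` D n.+1))).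
    apply: (sepA _ _ (a n.+1) (a n)) => // [p [_ /= /ltW]//|p [[Xp _] /not_andP[//|/= /negP]]].
    by rewrite -leNgt.
  apply: le_outer_measure => p [/AS /AS//|[]//].
have D0 n : 0 <= mu (D n) by exact: outer_measure_ge0.
have Dsum m : \sum_(0 <= k < m) mu (D k.+1) <= mu (A m) + mu (A m.+1).
  elim: m => [|m ih]; first by rewrite big_nil adde_ge0// outer_measure_ge0.
  rewrite big_nat_recr//=; apply: (@le_trans _ _ (mu (A m) + mu (A m.+1) + mu (D m.+1))).
    by rewrite leeD2r.
  by rewrite addeAC [leRHS]addeC leeD2r.
have Dfin : \sum_(0 <= k <oo) mu (D k.+1) < +oo.
  apply: (@le_lt_trans _ _ (mu X + mu X)); last by rewrite lte_add_pinfty.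
  apply: lime_le; first exact: is_cvg_nneseries.
  by apply: nearW => m; rewrite (le_trans (Dsum m))// leeD.
have tail : \sum_(N <= k <oo) mu (D k.+1) @[N --> \oo] --> 0.
  exact: nneseries_tail_cvg.
have bnd N : mu (X `&` P) + mu (X `&` ~` P) <= mu X + \sum_(N <= k <oo) mu (D k.+1).
  have XP : mu (X `&` P) <= mu (A N.+1) + \sum_(N <= k <oo) mu (D k.+1).
    apply: (@le_trans _ _ (mu (A N.+1 `|` \bigcup_(n in ~` `I_N) D n.+1))).
      apply: le_outer_measure => p [Xp Pp].
      have [n nf] : exists n, (a n < f p)%R.
        have : (0 < f p - c)%R by rewrite subr_gt0.
        move=> /[dup] fc0 /ltr_add_invr[k]; rewrite add0r => kf.
        by exists k; rewrite /a addrC -ltrBrDr.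
      have [m [Amp Am]] : exists m, A m p /\ (forall k, (k < m)%N -> ~ A k p).
        have ex : exists n, `[< A n p >] by exists n; apply/asboolP; split.
        exists (ex_minn ex); case: ex_minnP => m /asboolP Am mmin; split => // k km /asboolP Ak.
        by have := mmin k Ak; rewrite leqNgt km.
      have Amono i j : (i <= j)%N -> A i `<=` A j.
        move=> ij; rewrite -(subnKC ij); elim: (j - i)%N => [|k ih]; first by rewrite addn0.
        by rewrite addnS; apply: subset_trans (AS _).
      have [mN|Nm] := leqP m N.+1; first by left; apply: Amono mN _ _.
      right; case: m => [//|[//|m]] in Amp Am Nm *; exists m => /=.
        by apply/negP; rewrite -leqNgt; rewrite !ltnS in Nm.
      by split => //; exact: Am.
    apply: (le_trans (outer_measureU2 _ _ _)); rewrite leeD2l//.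
    exact: (outer_measure_sigma_subadditive_tail mu N (fun n => D n.+1)).
  apply: (@le_trans _ _ (mu (A N.+1) + \sum_(N <= k <oo) mu (D k.+1) + mu (X `&` ~` P))).
    by rewrite leeD2r.
  rewrite addeAC leeD2r//; apply: (@le_trans _ _ (mu (A N.+1 `|` (X `&` ~` P)))).
    apply: (sepA _ _ c (a N.+1)) => // [p [_ /= /ltW]//|p [_ /= /negP]].
    by rewrite -leNgt.
  by apply: le_outer_measure => p [[]|[]].
have -> : mu X = mu X + 0 by rewrite adde0.
have lim : mu X + \sum_(N <= k <oo) mu (D k.+1) @[N --> \oo] --> mu X + 0.
  apply: cvgeD; [|exact: cvg_cst|exact: tail].
  by apply: fin_num_adde_defl.
rewrite -(cvg_lim _ lim)//; apply: lime_ge; first by apply/cvg_ex; eexists; exact: lim.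
exact: nearW.
Qed.

Lemma measurable_fst_H1 : measurable_fun [set: H1plane R] (fst : H1plane R -> R).
Proof.
apply: (measurability _ (RGenOInfty.measurableE R)) => //.
move=> _ [_ [c ->] <-]; rewrite setTI.
have -> : fst @^-1` `]c, +oo[%classic = [set p : plane | (c < p.1)%R].
  by apply/seteqP; split => p /=; rewrite in_itv/= andbT.
by apply: caratheodory_superlevel; exact: dist2_ge_fst.
Qed.

Lemma measurable_snd_H1 : measurable_fun [set: H1plane R] (snd : H1plane R -> R).
Proof.
apply: (measurability _ (RGenOInfty.measurableE R)) => //.
move=> _ [_ [c ->] <-]; rewrite setTI.
have -> : snd @^-1` `]c, +oo[%classic = [set p : plane | (c < p.2)%R].
  by apply/seteqP; split => p /=; rewrite in_itv/= andbT.
by apply: caratheodory_superlevel; exact: dist2_ge_snd.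
Qed.

Lemma measurable_id_H1 : measurable_fun [set: H1plane R] (id : H1plane R -> plane).
Proof.
apply/(measurable_fun_pairP (id : H1plane R -> plane)).
by split; [exact: measurable_fst_H1|exact: measurable_snd_H1].
Qed.

Lemma measurable_H1 (A : set plane) : measurable A -> measurable (A : set (H1plane R)).
Proof. by move=> mA; rewrite -[A]setTI; exact: measurable_id_H1. Qed.

Lemma measurable_fun_H1 d (T : measurableType d) (A : set plane) (f : plane -> T) :
  measurable A -> measurable_fun A f ->
  measurable_fun (A : set (H1plane R)) (f : H1plane R -> T).
Proof.
by move=> mA mf _ B mB; have := mf mA B mB; exact: measurable_H1.
Qed.

Lemma measurable_funTS_H1 d (T : measurableType d) (D : set plane) (f : plane -> T) :
  measurable_fun setT f -> measurable_fun (D : set (H1plane R)) (f : H1plane R -> T).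
Proof.
move=> mf; apply: (@measurable_funTS _ _ (H1plane R)).
exact: (measurable_fun_H1 measurableT mf).
Qed.

End hausdorff_facts.

Section vertical_line.
Context {R : realType}.
Local Notation plane := (R * R)%type.
Local Notation leb := (@lebesgue_measure R).
Local Open Scope ereal_scope.

Definition vline (c : R) (A : set R) : set plane := [set z | z.1 = c /\ A z.2].

Lemma measurable_vline c (A : set R) : measurable A -> measurable (vline c A).
Proof.
move=> mA; have -> : vline c A = (fst @^-1` [set c]) `&` (snd @^-1` A).
  by apply/seteqP; split => z [].
apply: measurableI; rewrite -[X in measurable X]setTI.
  exact: measurable_fst.
exact: measurable_snd.
Qed.

Let mu (c : R) (A : set (measurableTypeR R)) : \bar R := H1 R (vline c A).

Let mu0 c : mu c set0 = 0.
Proof. by rewrite /mu (_ : vline c set0 = set0) ?measure0//; apply/seteqP; split => z []. Qed.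

Let mu_ge0 c A : 0 <= mu c A.
Proof. exact: (outer_measure_ge0 (hausdorff1_outer R)). Qed.

Let mu_sigma_additive c : semi_sigma_additive (mu c).
Proof.
move=> F mF tF mUF; rewrite /mu.
have -> : vline c (\bigcup_n F n) = \bigcup_n vline c (F n).
  apply/seteqP; split=> [z [zc [n _ Fn]]|z [n _ [zc Fn]]]; first by exists n.
  by split => //; exists n.
apply: measure_semi_sigma_additive.
- by move=> n; apply: measurable_H1; exact: (measurable_vline c (mF n)).
- apply/trivIsetP => i j _ _ ij; apply/seteqP; split => // z [[_ Fi] [_ Fj]].
  by move/trivIsetP : tF => /(_ i j Logic.I Logic.I ij)/seteqP[/(_ z.2)+ _]; apply; split.
- apply: measurable_H1; apply: bigcup_measurable => n _; exact: (measurable_vline c (mF n)).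
Qed.

HB.instance Definition _ c := isMeasure.Build _ _ _ (mu c)
  (mu0 c) (@mu_ge0 c) (@mu_sigma_additive c).

Lemma leb_hull (D : set R) (d : R) (x : R) : D x ->
  (forall s t, D s -> D t -> (`|s - t| <= d)%R) ->
  exists I : interval R, D `<=` [set` I] /\ leb [set` I] <= d%:E.
Proof.
move=> Dx Dd; exists `[inf D, sup D]%R.
have ubD : has_ubound D.
  by exists (x + d)%R => t Dt; rewrite -lerBlDl (le_trans (ler_norm _))// Dd.
have lbD : has_lbound D.
  by exists (x - d)%R => t Dt; rewrite lerBlDl -lerBlDr (le_trans (ler_norm _))// Dd.
have d0 : (0 <= d)%R by rewrite -(normr0 R) -(subrr x) Dd.
split=> [t Dt /=|]; first by rewrite in_itv/= ge_inf//= ub_le_sup.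
rewrite lebesgue_measure_itv/=; case: ifPn => _; last by rewrite lee_fin.
rewrite -EFinB lee_fin lerBlDl; apply: ge_sup; first by exists x.
move=> t Dt; rewrite -lerBlDr; apply: lb_le_inf; first by exists x.
by move=> s Ds; rewrite lerBlDr -lerBlDl (le_trans (ler_norm _))// Dd.
Qed.

Let mu_ge c (p q : R) : (p < q)%R -> (q - p)%:E <= mu c `]p, q]%classic.
Proof.
move=> pq; apply: le_trans (hausdorff1_ge _ ltr01).
apply: le_ereal_inf_tmp => _ [C [AC Cd] <-].
pose D n := [set t | C n (c, t)].
have /choice[I DI] : forall n, exists I : set R,
    [/\ measurable I, D n `<=` I & leb I <= diam2 (C n)].
  move=> n; have [[t Dt]|/set0P/negP/negPn/eqP ->] := pselect (exists t, D n t); last first.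
    by exists set0; split => //; rewrite measure0 diam2_ge0.
  have Cfin : diam2 (C n) \is a fin_num.
    by rewrite ge0_fin_numE ?diam2_ge0// (le_lt_trans (Cd n))// ltry.
  have [s r Ds Dr|J [DJ Jd]] := @leb_hull (D n) (fine (diam2 (C n))) t Dt.
    rewrite -lee_fin fineK//; apply: le_trans (dist2_le_diam2 Ds Dr).
    by rewrite lee_fin (le_trans _ (dist2_ge_snd _ _)).
  by exists [set` J]; split => //; move: Jd; rewrite fineK.
have -> : (q - p)%:E = leb `]p, q]%classic.
  by rewrite lebesgue_measure_itv/= lte_fin pq EFinB.
apply: (@le_trans _ _ (\sum_(n <oo) leb (I n))); last first.
  by apply: lee_nneseries => [n _ _|n _]; [|have [] := DI n].
apply: measure_sigma_subadditive => //= [n|]; first by have [] := DI n.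
move=> t pqt; have [|n _ Cn] := AC (c, t); first by split.
by exists n => //; have [_ + _] := DI n; apply.
Qed.

Let mu_le c (p q : R) : (p < q)%R -> mu c `]p, q]%classic <= (q - p)%:E.
Proof.
move=> pq.
have key (h : R) : (0 < h)%R -> hausdorff1_pre h (vline c `]p, q]%classic) <= (q - p + h)%:E.
  move=> h0; pose n := (Num.truncn ((q - p) / h)).+1.
  pose C k := if (k < n)%N then vline c `[(p + k%:R * h)%R, (p + k.+1%:R * h)%R]%classic else set0.
  have Ch k : diam2 (C k) <= h%:E.
    rewrite /C; case: ifPn => _; last by rewrite diam2_set0 lee_fin ltW.
    apply: diam2_le; first exact: ltW.
    move=> y z [y1 /=]; rewrite in_itv/= => /andP[ya yb] [z1 /=]; rewrite in_itv/= => /andP[za zb].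
    apply: (le_trans (dist2_le_add _ _)); rewrite y1 z1 subrr normr0 add0r ler_norml.
    by move: ya yb za zb; rewrite -natr1 mulrDl mul1r => *; apply/andP; split; lra.
  apply: (@le_trans _ _ (\sum_(k <oo) diam2 (C k))).
    apply: hausdorff1_pre_le => // z [z1 /=]; rewrite in_itv/= => /andP[z2 z2'].
    have zp0 : (0 <= (z.2 - p) / h)%R by rewrite divr_ge0// ?ltW// subr_gt0.
    have /andP[kl kr] := truncn_itv zp0.
    exists (Num.truncn ((z.2 - p) / h)) => //; rewrite /C ifT.
      split => //=; rewrite in_itv/=; apply/andP; split.
        by rewrite -lerBrDl -ler_pdivlMr.
      by rewrite -lerBlDl -ler_pdivrMr// ltW.
    by rewrite ltnS le_truncn// ler_pM2r ?invr_gt0// lerD2r.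
  rewrite (@nneseries_split _ _ 0 n); last by move=> k _; exact: diam2_ge0.
  rewrite [X in _ + X]eseries0 ?adde0; last first.
    by move=> i; rewrite add0n /C ltnNge => ->/=; rewrite diam2_set0.
  apply: (@le_trans _ _ (\sum_(0 <= k < n) h%:E)); first by apply: lee_sum.
  rewrite sumEFin big_const_nat subn0 iter_addr_0 lee_fin.
  have /andP[kl _] : ((Num.truncn ((q - p) / h))%:R <= (q - p) / h < (Num.truncn ((q - p) / h)).+1%:R)%R.
    by apply: truncn_itv; rewrite divr_ge0// ?ltW// subr_gt0.
  by rewrite -mulr_natl /n -natr1 mulrDl mul1r lerD2r -ler_pdivlMr.
apply/lee_addgt0Pr => e e0; apply: ge_ereal_sup => _ [d /= d0 <-].
have m0 : (0 < Num.min d e)%R by rewrite lt_min d0.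
apply: (@le_trans _ _ (hausdorff1_pre (Num.min d e) (vline c `]p, q]%classic))).
  by apply: le_hausdorff1_pre; rewrite ge_min lexx.
by apply: (le_trans (key _ m0)); rewrite -EFinD lee_fin lerD2l ge_min lexx orbT.
Qed.

Lemma H1_vline c (A : set R) : measurable A -> H1 R (vline c A) = leb A.
Proof.
move=> mA; apply/esym; apply: (@lebesgue_measure_unique R (mu c)) => // _ [[p q] _ <-] /=.
have [pq|qp] := ltP p q; last by rewrite set_itv_ge ?measure0// bnd_simp -leNgt.
rewrite lebesgue_measure_itv/= lte_fin pq -EFinB.
by apply/eqP; rewrite eq_le mu_ge//= mu_le.
Qed.

End vertical_line.

Section transfer.
Local Open Scope ereal_scope.

Lemma integral_pushforward_mf d1 d2 (X : measurableType d1) (Y : measurableType d2)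
    (R : realType) (phi : X -> Y) (mphi : measurable_fun setT phi)
    (mu : {measure set X -> \bar R}) (D : set Y) (f : Y -> \bar R) :
  measurable D -> measurable_fun D f ->
  \int[pushforward mu phi]_(y in D) f y = \int[mu]_(x in phi @^-1` D) f (phi x).
Proof.
move=> mD mf; rewrite [LHS]integralE [RHS]integralE; congr (_ - _).
  rewrite (ge0_integral_pushforward mphi)//; last exact: measurable_funepos.
  by apply: eq_integral => x _; rewrite -funepos_comp.
rewrite (ge0_integral_pushforward mphi)//; last exact: measurable_funeneg.
by apply: eq_integral => x _; rewrite -funeneg_comp.
Qed.

Lemma integral_vline (R : realType) (c : R) (A : set R) (f : R * R -> \bar R) :
  measurable A -> measurable_fun (vline c A) f ->
  \int[H1 R]_(z in vline c A) f z = \int[@lebesgue_measure R]_(t in A) f (c, t).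
Proof.
move=> mA mf; have mV := measurable_vline c mA.
transitivity (\int[pushforward (H1 R) (id : H1plane R -> (R * R)%type)]_(z in vline c A) f z).
  by apply/esym; exact: (integral_pushforward_mf (@measurable_id_H1 R) (H1 R) mV mf).
have mc : @measurable_fun _ _ (measurableTypeR R) (R * R)%type setT (fun t => (c, t)).
  exact: measurable_pair1.
pose push d1 d2 T1 T2 :=
  @measure_function_pushforward__canonical__measure_function_Measure d1 d2 T1 T2 R.
rewrite (@eq_measure_integral _ _ _ (vline c A) (push _ _ _ _ (@lebesgue_measure R) _ mc)
  (push _ _ _ _ (H1 R) _ (@measurable_id_H1 R))); last first.
  move=> B mB BV.
  have mB' : measurable ((fun t => (c, t)) @^-1` B).
    by rewrite -[X in measurable X]setTI; exact: mc.
  change (H1 R B = @lebesgue_measure R ((fun t => (c, t)) @^-1` B)).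
  rewrite -(H1_vline c mB'); congr (H1 R _).
  apply/seteqP; split => [[x t] Bz|[x t] [/= -> //]].
  by have [/= xc _] := BV _ Bz; split => //=; rewrite -xc.
transitivity (\int[@lebesgue_measure R]_(t in (fun t => (c, t)) @^-1` vline c A) f (c, t)).
  exact: (integral_pushforward_mf mc (@lebesgue_measure R) mV mf).
by congr integral; apply/seteqP; split => t //= [].
Qed.

End transfer.

(** * From smooth forms to bounded Borel forms *)

Section flat_functions.
Context {R : realType}.
Local Notation plane := (R * R)%type.

Definition flat (P : {poly R}) (x : R) : R :=
  if 0 < x then P.[x^-1] * expR (- x^-1) else 0.

Lemma poly_le_expR (P : {poly R}) :
  exists2 C : R, 0 <= C & forall y, 0 <= y -> `|P.[y]| <= C * expR y.
Proof.
have X i (y : R) : 0 <= y -> y ^+ i <= i`!%:R * expR y.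
  move=> y0; rewrite -ler_pdivrMl ?ltr0n ?fact_gt0// mulrC.
  case: i => [|i]; first by rewrite expr0 fact0 invr1 mulr1 -expR0 ler_expR.
  by apply: le_trans (expR_ge1Dxn i y0); rewrite lerDr.
exists (\sum_(i < size P) `|P`_i| * i`!%:R).
  by apply: sumr_ge0 => i _; rewrite mulr_ge0.
move=> y y0; rewrite horner_coef (le_trans (ler_norm_sum _ _ _))// mulr_suml.
apply: ler_sum => i _; rewrite normrM -mulrA ler_wpM2l//.
by rewrite ger0_norm ?exprn_ge0// X.
Qed.

Lemma flat_le_sqr (P : {poly R}) :
  exists2 C : R, 0 <= C & forall h, `|flat P h| <= C * h ^+ 2.
Proof.
have [C C0 PC] := poly_le_expR (P * 'X^2).
exists C => // h; rewrite /flat; case: ifPn => [h0|_]; last first.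
  by rewrite normr0 mulr_ge0// sqr_ge0.
have hV : 0 <= h^-1 by rewrite invr_ge0 ltW.
have := PC _ hV; rewrite hornerM hornerXn => PCh.
rewrite normrM (ger0_norm (expR_ge0 _)) expRN ler_pdivrMr ?expR_gt0//.
rewrite mulrAC -ler_pdivrMr ?exprn_gt0// -exprVn.
by rewrite (le_trans _ PCh)// normrM (ger0_norm (exprn_ge0 _ hV)).
Qed.

Lemma is_derive_flat (P : {poly R}) (x : R) :
  is_derive x 1 (flat P) (flat ('X^2 * (P - P^`())) x).
Proof.
have [x0|x0|x0] := ltgtP x 0.
- have -> : flat ('X^2 * (P - P^`())) x = 0 by rewrite /flat ltNge (ltW x0).
  apply: (@near_eq_is_derive _ _ _ (cst 0)).
    near=> y; rewrite /flat/= ltNge ifF//; apply/negbF/ltW.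
    by near: y; exact: lt_nbhsl.
- have xn0 : x != 0 by rewrite gt_eqF.
  apply: (@near_eq_is_derive R R R (fun y : R => P.[y^-1] * expR (- y^-1))).
  + near=> y; rewrite /flat ifT//.
    by near: y; exact: lt_nbhsr.
  + have dV : is_derive x 1 (fun y : R => y^-1) (- x ^- 2).
      by apply: is_derive_eq; [exact: is_deriveV|rewrite /= scaler1].
    have dP := is_derive1_comp (is_derive_poly P x^-1) dV.
    have dN : is_derive x 1 (fun y : R => - y^-1) (x ^- 2).
      by have := is_deriveN dV; rewrite opprK.
    have dE := @is_derive1_comp R expR (fun y : R => - y^-1) x _ _ (is_derive_expR (- x^-1)) dN.
    have := is_deriveM dP dE.
    move=> h; apply: (is_derive_eq h).
    rewrite /flat x0 /= !hornerE/=.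
    rewrite /GRing.scale/=; set e := expR _; set p := P.[_]; set p' := (P^`()).[_].
    by rewrite exprVn; ring.
- rewrite x0; have -> : flat ('X^2 * (P - P^`())) 0 = 0 by rewrite /flat ltxx.
  have [C C0 PC] := flat_le_sqr P.
  have cv : h^-1 *: (flat P (h *: 1 + 0) - flat P 0) @[h --> 0^'] --> (0 : R).
    have f0 : flat P 0 = 0 by rewrite /flat ltxx.
    apply: norm_cvg0; apply: (@squeeze_cvgr _ _ _ _ (cst 0) (fun h => C * `|h|)).
    + near=> h; rewrite normr_ge0/= f0 subr0 addr0 /GRing.scale/= mulr1 normrM normfV.
      have h0 : h != 0 by near: h; exact: nbhs_dnbhs_neq.
      rewrite ler_pdivrMl ?normr_gt0// mulrCA -expr2 real_normK ?num_real//.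
    + exact: cvg_cst.
    + apply: cvg_within_filter; have H : C * `|h| @[h --> (0 : R)] --> C * `|0 : R|.
        by apply: cvgM; [exact: cvg_cst|exact: (@norm_continuous R R^o 0)].
      by rewrite normr0 mulr0 in H.
  apply: DeriveDef; first by apply/cvg_ex; exists 0.
  exact: cvg_lim.
Unshelve. all: by end_near. Qed.

Inductive flat_gen : (plane -> R) -> Prop :=
| flat_gen_fst P c d : flat_gen (fun z => flat P (c * z.1 + d))
| flat_gen_snd P c d : flat_gen (fun z => flat P (c * z.2 + d))
| flat_gen_cst r : flat_gen (fun=> r)
| flat_gen_add f g : flat_gen f -> flat_gen g -> flat_gen (f + g)
| flat_gen_mul f g : flat_gen f -> flat_gen g -> flat_gen (f * g).

Lemma is_diff_flat_affine (l : {linear plane -> R}) (P : {poly R}) (c d : R) (z : plane) :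
  continuous l ->
  is_diff z (fun z => flat P (c * l z + d))
    (fun v => c * l v * flat ('X^2 * (P - P^`())) (c * l z + d)).
Proof.
move=> cl.
have dl : is_diff z (l : plane -> R) (l : plane -> R).
  by apply: DiffDef; [exact: linear_differentiable|rewrite diff_lin].
have da : is_diff z (fun z => c * l z + d) (fun v => c * l v).
  have := is_diffD (is_diffZ c dl) (is_diff_cst d z).
  by rewrite addr0.
have df : is_diff (c * l z + d) (flat P) ( *:%R^~ (flat ('X^2 * (P - P^`())) (c * l z + d))).
  have Df := is_derive_flat P (c * l z + d).
  apply: DiffDef; first by apply/derivable1_diffP; exact: ex_derive.
  by rewrite deriv1E ?derive1E ?derive_val//; exact: ex_derive.
exact: (is_diff_comp da df).
Qed.

Lemma flat_gen_diff f : flat_gen f ->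
  exists df : plane -> plane -> R,
    (forall z, is_diff z f (df z)) /\ (forall v, flat_gen (fun z => df z v)).
Proof.
elim=> {f} [P c d|P c d|r|f g _ [df [hf gf]] _ [dg [hg gg]]|f g Hf [df [hf gf]] Hg [dg [hg gg]]].
- eexists; split => [z|v].
    by apply: (@is_diff_flat_affine fst) => y; exact: cvg_fst.
  exact: (flat_gen_mul (flat_gen_cst _) (flat_gen_fst _ _ _)).
- eexists; split => [z|v].
    by apply: (@is_diff_flat_affine snd) => y; exact: cvg_snd.
  exact: (flat_gen_mul (flat_gen_cst _) (flat_gen_snd _ _ _)).
- exists (fun _ _ => 0); split => [z|v]; first exact: is_diff_cst.
  exact: flat_gen_cst.
- exists (fun z => df z + dg z); split=> [z|v]; first exact: is_diffD.
  exact: (flat_gen_add (gf v) (gg v)).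
- exists (fun z => f z *: dg z + g z *: df z); split=> [z|v]; first exact: is_diffM.
  exact: (flat_gen_add (flat_gen_mul Hf (gg v)) (flat_gen_mul Hg (gf v))).
Qed.

Lemma smooth_flat_gen f : flat_gen f -> smooth f.
Proof.
move=> Sf s z.
suff H : flat_gen (foldr (fun (v : plane) (h : plane -> R) => 'D_v h) f s).
  by have [df [hf _]] := flat_gen_diff H; have [] := hf z.
elim: s => //= v s; set h := foldr _ _ _ => /flat_gen_diff[dh [hh gh]].
suff -> : 'D_v h = (fun z => dh z v) by exact: gh.
apply/funext => y; rewrite deriveE; last by have [] := hh y.
by have [_ ->] := hh y.
Qed.

End flat_functions.

Section bounded_monotone_class.
Context {R : realType}.
Local Notation plane := (R * R)%type.

Definition obox (x y s t : R) : set plane := `]x, y[ `*` `]s, t[.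

Lemma measurable_obox x y s t : measurable (obox x y s t).
Proof. by apply: measurableX. Qed.

Lemma oboxI x y s t x' y' s' t' : obox x y s t `&` obox x' y' s' t' =
  obox (Num.max x x') (Num.min y y') (Num.max s s') (Num.min t t').
Proof.
apply/seteqP; split => z; rewrite /obox/= !in_itv/= !gt_max !lt_min.
  by move=> [[/andP[-> ->] /andP[-> ->]] [/andP[-> ->] /andP[-> ->]]].
by move=> [/andP[/andP[-> ->] /andP[-> ->]] /andP[/andP[-> ->] /andP[-> ->]]].
Qed.

Definition oboxes : set (set plane) :=
  [set A | exists x y s t, A = obox x y s t].

Lemma measurable_oboxes (A : set plane) : measurable A -> <<s oboxes >> A.
Proof.
move=> mA; suff mid : measurable_fun [set: g_sigma_algebraType oboxes]
    (id : g_sigma_algebraType oboxes -> plane).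
  by have := mid measurableT A mA; rewrite setTI.
apply/(measurable_fun_pairP (id : g_sigma_algebraType oboxes -> plane)); split.
- apply: (measurability _ (RGenOpens.measurableE R)) => //.
  move=> _ [_ [x [y ->]] <-]; rewrite setTI.
  have -> : (fst \o id) @^-1` `]x, y[ = \bigcup_n obox x y (- n%:R) n%:R.
    apply/seteqP; split => [[z1 z2] /= zxy|[z1 z2] [n _ []]//].
    exists (Num.truncn `|z2|).+1 => //; split => //=.
    rewrite in_itv/= -ltr_norml.
    by have /andP[] := truncn_itv (normr_ge0 z2).
  apply: bigcup_measurable => n _; apply: sub_sigma_algebra.
  by exists x, y, (- n%:R), n%:R.
- apply: (measurability _ (RGenOpens.measurableE R)) => //.
  move=> _ [_ [x [y ->]] <-]; rewrite setTI.
  have -> : (snd \o id) @^-1` `]x, y[ = \bigcup_n obox (- n%:R) n%:R x y.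
    apply/seteqP; split => [[z1 z2] /= zxy|[z1 z2] [n _ []]//].
    exists (Num.truncn `|z1|).+1 => //; split => //=.
    rewrite in_itv/= -ltr_norml.
    by have /andP[] := truncn_itv (normr_ge0 z1).
  apply: bigcup_measurable => n _; apply: sub_sigma_algebra.
  by exists (- n%:R), n%:R, x, y.
Qed.

Definition bounded_on (Q : set plane) (p : plane -> R) :=
  [/\ measurable_fun setT p, exists C : R, forall z, `|p z| <= C
    & forall z, ~ Q z -> p z = 0].

Lemma bounded_on_lin Q c p q : bounded_on Q p -> bounded_on Q q ->
  bounded_on Q (fun z => c * p z + q z).
Proof.
move=> [mp [C pC] pQ] [mq [D qD] qQ]; split.
- by apply: measurable_funD => //; apply: measurable_funM.
- exists (`|c| * C + D) => z; rewrite (le_trans (ler_normD _ _))// lerD//.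
  by rewrite normrM ler_wpM2l.
- by move=> z Qz; rewrite pQ// qQ// mulr0 addr0.
Qed.

Lemma bounded_on_indic (Q A : set plane) : measurable A -> A `<=` Q -> bounded_on Q \1_A.
Proof.
move=> mA AQ; split => //.
- by exists 1 => z; rewrite ger0_norm// indicE lern1 leq_b1.
- by move=> z Qz; rewrite indicE memNset// => /AQ.
Qed.

Lemma bounded_on_0 Q : bounded_on Q (fun=> 0).
Proof. by split => //; exists 0 => z; rewrite normr0. Qed.

Variables (a1 b1 a2 b2 : R) (L : (plane -> R) -> R).
Let Q := obox a1 b1 a2 b2.
Hypothesis L_lin : forall c p q, bounded_on Q p -> bounded_on Q q ->
  L (fun z => c * p z + q z) = c * L p + L q.
Hypothesis L_cvg : forall (p_ : nat -> plane -> R) p (C : R),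
  (forall n, bounded_on Q (p_ n)) -> bounded_on Q p ->
  (forall n z, `|p_ n z| <= C) -> (forall z, p_ n z @[n --> \oo] --> p z) ->
  L (p_ n) @[n --> \oo] --> L p.
Hypothesis L_box : forall x y s t, obox x y s t `<=` Q -> L \1_(obox x y s t) = 0.

Let L0 : L (fun=> 0) = 0.
Proof.
have := L_lin 1 (bounded_on_0 Q) (bounded_on_0 Q).
under [in X in X -> _]eq_fun do rewrite mulr0 addr0.
by rewrite mul1r -[X in X = _]addr0 => /addrI.
Qed.

Let L_set (A : set plane) : measurable A -> L \1_(A `&` Q) = 0.
Proof.
move=> mA; pose H := [set B : set plane | measurable B /\ L \1_(B `&` Q) = 0].
suff : <<s oboxes >> `<=` H by move=> /(_ A (measurable_oboxes mA))[].
apply: lambda_system_subset.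
- move=> _ _ [x [y [s [t ->]]]] [x' [y' [s' [t' ->]]]]; rewrite oboxI.
  by eexists; eexists; eexists; eexists.
- split => //.
  + split; first exact: measurableT.
    by rewrite setTI L_box.
  + move=> B C CB [mB B0] [mC C0]; split; first exact: measurableD.
    have -> : \1_((B `\` C) `&` Q) = (fun z => -1 * \1_(C `&` Q) z + \1_(B `&` Q) z) :> (plane -> R).
      apply/funext => z; rewrite !indicE setDE !in_setI in_setC.
      have [Cz|Cz] := boolP (z \in C); last by rewrite /= mulr0 add0r andbT.
      rewrite andbF/= (_ : z \in B)//=; last by rewrite inE; apply: CB; rewrite -inE.
      by rewrite mulN1r addNr.
    rewrite L_lin ?B0 ?C0 ?mulr0 ?addr0//.
      by apply: bounded_on_indic; [exact: measurableI (measurable_obox _ _ _ _)|move=> ? []].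
    by apply: bounded_on_indic; [exact: measurableI (measurable_obox _ _ _ _)|move=> ? []].
  + move=> F ndF HF; split; first by apply: bigcup_measurable => n _; have [] := HF n.
    have mFQ n : measurable (F n `&` Q).
      by apply: measurableI; [have [] := HF n|exact: measurable_obox].
    have : L \1_(F n `&` Q) @[n --> \oo] --> L \1_(\bigcup_n F n `&` Q).
      apply: (@L_cvg _ _ 1).
      * by move=> n; apply: bounded_on_indic => // ? [].
      * apply: bounded_on_indic; last by move=> ? [].
        by rewrite setI_bigcupl; apply: bigcup_measurable.
      * by move=> n z; rewrite ger0_norm// indicE lern1 leq_b1.
      * move=> z; have [[[n _ Fnz] Qz]|nFz] := pselect ((\bigcup_n F n `&` Q) z).
          rewrite [X in _ --> X]indicE mem_set//; last by split => //; exists n.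
          apply: cvg_near_cst; exists n => // m /= nm.
          rewrite indicE mem_set//; split => //.
          by move/subsetPset: (ndF _ _ nm); apply.
        rewrite [X in _ --> X]indicE memNset//; apply: cvg_near_cst.
        apply: nearW => m; rewrite indicE memNset// => -[Fmz Qz]; apply: nFz; split => //.
        by exists m.
    have -> : (fun n => L \1_(F n `&` Q)) = cst 0 by apply/funext => n; have [] := HF n.
    move=> /cvg_lim <-//; exact: lim_cst.
- move=> _ [x [y [s [t ->]]]]; split; first exact: measurable_obox.
  by rewrite oboxI L_box// -oboxI => ? [].
- by [].
Qed.

Let L_sum (I : finType) (c : I -> R) (p : I -> plane -> R) :
  (forall i, bounded_on Q (p i)) -> (forall i, L (p i) = 0) ->
  forall r : seq I, bounded_on Q (fun z => \sum_(i <- r) c i * p i z) /\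
  L (fun z => \sum_(i <- r) c i * p i z) = 0.
Proof.
move=> pQ p0; elim => [|i r [ihQ ih]].
  under eq_fun do rewrite big_nil.
  split; [exact: bounded_on_0|exact: L0].
under eq_fun do rewrite big_cons.
by split; [exact: bounded_on_lin|rewrite L_lin// p0 ih mulr0 addr0].
Qed.

Import HBNNSimple.

Let L_ge0 p : bounded_on Q p -> (forall z, 0 <= p z) -> L p = 0.
Proof.
move=> bp p0; have [mp [C pC] pQ] := bp.
have mp' : measurable_fun setT (EFin \o p) by exact/measurable_EFinP.
pose g := nnsfun_approx measurableT mp'.
have gp n z : g n z <= p z.
  rewrite -lee_fin nnsfun_approxE.
  by apply: le_approx => // y _; rewrite lee_fin.
have gQ n z : ~ Q z -> g n z = 0.
  by move=> Qz; apply/eqP; rewrite eq_le fun_ge0 -(pQ z Qz) gp.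
have bg n : bounded_on Q (g n).
  split; [exact: measurable_funP|exists C => z|exact: gQ].
  by rewrite ger0_norm ?fun_ge0// (le_trans (gp n z))// (le_trans _ (pC z))// ler_norm.
have g0 n : L (g n) = 0.
  pose s : seq R := finmap.enum_fset (fset_set (range (g n))).
  have gE z : g n z = \sum_(i < size s) (s`_i * \1_((g n) @^-1` [set s`_i]) z).
    exact: (fimfunEord (g n)).
  have -> : (g n : plane -> R) = (fun z => \sum_(i < size s) (s`_i * \1_((g n) @^-1` [set s`_i] `&` Q) z)).
    apply/funext => z; have [Qz|Qz] := pselect (Q z).
      rewrite gE; apply: eq_bigr => i _; congr (_ * _).
      by rewrite !indicE in_setI (mem_set Qz) andbT.
    rewrite gQ// big1// => i _; rewrite indicE memNset ?mulr0//.
    by case.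
  have mg i : measurable ((g n) @^-1` [set s`_i]).
    by rewrite -[X in measurable X]setTI; exact: (measurable_funP (g n)).
  apply: (proj2 (L_sum (fun i : 'I_(size s) => s`_i) _ _ _)) => i.
    by apply: bounded_on_indic => [|? []//]; apply: measurableI => //; exact: measurable_obox.
  exact: L_set.
have : L (g n) @[n --> \oo] --> L p.
  apply: (@L_cvg _ _ C) => // [n z|z].
    by rewrite ger0_norm ?fun_ge0// (le_trans (gp n z))// (le_trans _ (pC z))// ler_norm.
  have := @cvg_nnsfun_approx _ _ _ _ measurableT _ mp' (fun z _ => p0 z) z Logic.I.
  by move/fine_cvgP => [].
have -> : (fun n => L (g n)) = cst 0 by apply/funext => n.
by move=> /cvg_lim <-//; exact: lim_cst.
Qed.

Lemma bounded_monotone_class p : bounded_on Q p -> L p = 0.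
Proof.
move=> bp; have [mp [C pC] pQ] := bp.
pose pp z := Num.max (p z) 0; pose pn z := Num.max (- p z) 0.
have b1' : bounded_on Q pp.
  split; first exact: measurable_maxr.
    exists C => z; rewrite /pp; case: (leP (p z) 0) => // _.
    by rewrite normr0 (le_trans _ (pC z)).
  by move=> z Qz; rewrite /pp pQ// maxxx.
have b2' : bounded_on Q pn.
  split; first by apply: measurable_maxr => //; exact: measurableT_comp.
    exists C => z; rewrite /pn; case: (leP (- p z) 0) => // _; last by rewrite normrN.
    by rewrite normr0 (le_trans _ (pC z)).
  by move=> z Qz; rewrite /pn pQ// oppr0 maxxx.
have -> : p = (fun z => -1 * pn z + pp z).
  apply/funext => z; rewrite /pn /pp mulN1r.
  by case: (leP (p z) 0) => p0; case: (leP (- p z) 0) => //; lra.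
rewrite L_lin// !L_ge0 ?mulr0 ?addr0// => z; rewrite /pp /pn le_max lexx orbT//.
Qed.

End bounded_monotone_class.

Lemma cvg_sum_R (R : realType) (I : Type) (r : seq I) (f : I -> nat -> R) (l : I -> R) :
  (forall i, f i n @[n --> \oo] --> l i) ->
  \sum_(i <- r) f i n @[n --> \oo] --> \sum_(i <- r) l i.
Proof.
move=> fl; elim: r => [|i r ih].
  by under eq_fun do rewrite big_nil; rewrite big_nil; exact: cvg_cst.
by under eq_fun do rewrite big_cons; rewrite big_cons; apply: cvgD.
Qed.

Section almost_everywhere_logic.
Context d (T : measurableType d) (R : realType) (mu : {measure set T -> \bar R}).

Lemma ae_imply (P Q : T -> Prop) : (forall x, P x -> Q x) ->
  {ae mu, forall x, P x} -> {ae mu, forall x, Q x}.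
Proof.
move=> PQ [N [mN N0 PN]]; exists N; split => // x nQ.
by apply: PN => Px; apply: nQ; exact: PQ.
Qed.

Lemma ae_and (P Q : T -> Prop) : {ae mu, forall x, P x} ->
  {ae mu, forall x, Q x} -> {ae mu, forall x, P x /\ Q x}.
Proof.
move=> [N [mN N0 PN]] [M [mM M0 QM]]; exists (N `|` M); split.
- exact: measurableU.
- by rewrite null_set_setU.
- move=> x /not_andP[nP|nQ]; [left; exact: PN|right; exact: QM].
Qed.

End almost_everywhere_logic.

Section Rintegral_extra.
Context d (T : measurableType d) (R : realType) (mu : {measure set T -> \bar R}).
Variables (D : set T) (mD : measurable D).

Lemma dominated_Rcvg (f_ : nat -> T -> R) (f g : T -> R) :
  (forall n, measurable_fun D (f_ n)) -> measurable_fun D f ->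
  (forall x, D x -> f_ n x @[n --> \oo] --> f x) ->
  mu.-integrable D (EFin \o g) -> (forall n x, D x -> `|f_ n x| <= g x) ->
  mu.-integrable D (EFin \o f) /\
  \int[mu]_(x in D) f_ n x @[n --> \oo] --> \int[mu]_(x in D) f x.
Proof.
move=> mf_ mf f_f ig f_g.
have [|||||if_ _] := @dominated_convergence _ _ _ mu D mD
  (fun n => EFin \o f_ n) (EFin \o f) (EFin \o g).
- by move=> n; exact/measurable_EFinP.
- exact/measurable_EFinP.
- by apply: aeW => x Dx; apply: cvg_EFin; [exact: nearW|exact: f_f].
- exact: ig.
- by apply: aeW => x n Dx; rewrite /= lee_fin f_g.
move=> cf; split => //.
have fin : (\int[mu]_(x in D) (EFin \o f) x)%E \is a fin_num by exact: integrable_fin_num.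
by apply: fine_cvg; rewrite fineK.
Qed.

Lemma bounded_fun_integrable (f : T -> R) (C : R) : (mu D < +oo)%E ->
  measurable_fun D f -> (forall x, D x -> `|f x| <= C) ->
  mu.-integrable D (EFin \o f).
Proof.
move=> Doo mf fC; apply: measurable_bounded_integrable => //.
exists C; split; first exact: num_real.
by move=> M CM x Dx /=; rewrite (le_trans (fC x Dx))// ltW.
Qed.

Lemma integrable_mul_bounded (f g : T -> R) (C : R) :
  mu.-integrable D (EFin \o f) -> measurable_fun D g ->
  (forall x, D x -> `|g x| <= C) ->
  mu.-integrable D (EFin \o (fun x => f x * g x)).
Proof.
move=> fi mg gC.
have bg : [bounded g x | x in D].
  exists C; split; first exact: num_real.
  by move=> M CM x Dx /=; rewrite (le_trans (gC x Dx))// ltW.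
by apply: eq_integrable (integrableMl mD fi mg bg).
Qed.

Lemma integrable_scale (c : R) (f : T -> R) :
  mu.-integrable D (EFin \o f) -> mu.-integrable D (EFin \o (fun x => c * f x)).
Proof. by move=> fi; exact: (integrableZl mD c fi). Qed.

Lemma integrable_sub (f g : T -> R) : mu.-integrable D (EFin \o f) ->
  mu.-integrable D (EFin \o g) -> mu.-integrable D (EFin \o (fun x => f x - g x)).
Proof. by move=> fi gi; exact: (integrableB mD fi gi). Qed.

Lemma integrable_add (f g : T -> R) : mu.-integrable D (EFin \o f) ->
  mu.-integrable D (EFin \o g) -> mu.-integrable D (EFin \o (fun x => f x + g x)).
Proof. by move=> fi gi; exact: (integrableD mD fi gi). Qed.

End Rintegral_extra.
Arguments dominated_Rcvg {d T R} mu {D} mD {f_ f g}.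
Arguments bounded_fun_integrable {d T R} mu {D} mD {f C}.
Arguments integrable_mul_bounded {d T R} mu {D} mD {f g C}.
Arguments integrable_scale {d T R} mu {D} mD c {f}.
Arguments integrable_sub {d T R} mu {D} mD {f g}.
Arguments integrable_add {d T R} mu {D} mD {f g}.

Section nice_currents.
Context {R : realType}.
Local Notation plane := (R * R)%type.
Variables (a b : R).

(* The part of the definition of a rectifiable current that G sees. *)
Record nice_current (T : rcurrent R) : Prop := NiceCurrent {
  nice_strip : carrier T `<=` strip a b ;
  nice_measurable : measurable (carrier T : set (H1plane R)) ;
  nice_mult_ge0 : forall z, carrier T z -> 0 <= mult T z ;
  nice_mult : measurable_fun (carrier T : set (H1plane R)) (mult T) ;
  nice_orient1 : measurable_fun (carrier T : set (H1plane R)) (fst \o orient T) ;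
  nice_orient2 : measurable_fun (carrier T : set (H1plane R)) (snd \o orient T) ;
  nice_orient1_le1 : forall z, carrier T z -> `|(orient T z).1| <= 1 ;
  nice_orient2_le1 : forall z, carrier T z -> `|(orient T z).2| <= 1 ;
  nice_loc : forall K : set plane, compact K -> K `<=` strip a b ->
    measurable (K : set (H1plane R)) ->
    (H1 R).-integrable (carrier T `&` K) (EFin \o mult T) }.

Lemma rectifiable_nice (T : rcurrent R) : rectifiable_current a b T -> nice_current T.
Proof.
move=> [Tab [mT _] [m0 mm mfin] [ o1 mo _]]; split => //.
- by move=> z /m0/ltW.
- exact: measurableT_comp measurable_fst mo.
- exact: measurableT_comp measurable_snd mo.
- move=> z /o1 oz; rewrite -(ler_pXn2r (n := 2))// ?nnegrE// expr1n real_normK ?num_real//.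
  by rewrite -oz lerDl sqr_ge0.
- move=> z /o1 oz; rewrite -(ler_pXn2r (n := 2))// ?nnegrE// expr1n real_normK ?num_real//.
  by rewrite -oz lerDr sqr_ge0.
- move=> K cK Kab mK; apply/integrableP; split.
    apply/measurable_EFinP; apply: (measurable_funS mT) mm.
    by move=> z [].
  apply: le_lt_trans (mfin K cK Kab); rewrite le_eqVlt; apply/orP; left; apply/eqP.
  by apply: eq_integral => z; rewrite inE => -[/m0/ltW Tz _] /=; rewrite ger0_norm.
Qed.

Lemma closed_box_compact (a1 b1 a2 b2 : R) : a < a1 -> b1 < b ->
  let K := `[a1, b1] `*` `[a2, b2] : set plane in
  [/\ compact K, K `<=` strip a b & measurable (K : set (H1plane R))].
Proof.
move=> aa1 b1b K; split.
- by apply: compact_setX; exact: segment_compact.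
- move=> z [/=]; rewrite !in_itv/= => /andP[az zb] _; split => //=.
  by rewrite in_itv/= (lt_le_trans aa1 az) (le_lt_trans zb b1b).
- by apply: measurable_H1; apply: measurableX.
Qed.

Definition act (T : rcurrent R) (o : plane -> R) (p : plane -> R) : R :=
  \int[H1 R]_(z in carrier T) (p z * o z * mult T z).

Section act_props.
Variables (T : rcurrent R) (NT : nice_current T) (o : plane -> R).
Hypothesis mo : measurable_fun (carrier T : set (H1plane R)) o.
Hypothesis o1 : forall z, carrier T z -> `|o z| <= 1.
Variables (a1 b1 a2 b2 : R) (aa1 : a < a1) (b1b : b1 < b).
Let Q := obox a1 b1 a2 b2.
Let K : set plane := `[a1, b1] `*` `[a2, b2].

Let dom_int (C : R) : (H1 R).-integrable (carrier T)
  (EFin \o (fun z => C * (\1_K z * mult T z))).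
Proof.
have [cK Kab mK] := closed_box_compact a2 b2 aa1 b1b.
have mT := nice_measurable NT.
have I1 : (H1 R).-integrable (carrier T) ((EFin \o mult T) \_ K).
  by apply/integrable_restrict => //; exact: (nice_loc NT).
have := integrableZl mT C I1; apply: eq_integrable => // z _.
rewrite /= /patch indicE; case: ifPn => _; rewrite ?mul1r ?mul0r ?mulr0 ?mule0//.
Qed.

Let QK z : ~ K z -> ~ Q z.
Proof.
move=> nK [/= z1 z2]; apply: nK; split => /=.
  by move: z1; rewrite !in_itv/= => /andP[/ltW-> /ltW->].
by move: z2; rewrite !in_itv/= => /andP[/ltW-> /ltW->].
Qed.

Let act_dom (p : plane -> R) (C : R) : (forall z, `|p z| <= C) -> (forall z, ~ Q z -> p z = 0) ->
  forall z, carrier T z -> `|p z * o z * mult T z| <= C * (\1_K z * mult T z).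
Proof.
move=> pC pQ z Tz; have C0 : 0 <= C := le_trans (normr_ge0 _) (pC z).
have [Kz|Kz] := pselect (K z); last first.
  by rewrite pQ ?mul0r ?normr0 ?mulr_ge0//; [exact: nice_mult_ge0 NT _ Tz|exact: QK].
rewrite indicE mem_set// mul1r !normrM (ger0_norm (nice_mult_ge0 NT Tz)).
rewrite ler_wpM2r ?(nice_mult_ge0 NT Tz)// -[leRHS]mulr1 ler_pM//.
exact: o1.
Qed.

Let act_meas (p : plane -> R) : measurable_fun setT p ->
  measurable_fun (carrier T : set (H1plane R)) (fun z => p z * o z * mult T z).
Proof.
move=> mp; apply: measurable_funM; last exact: nice_mult NT.
apply: measurable_funM => //.
exact: measurable_funTS_H1.
Qed.

Lemma act_integrable p : bounded_on Q p ->
  (H1 R).-integrable (carrier T) (EFin \o (fun z => p z * o z * mult T z)).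
Proof.
move=> [mp [C pC] pQ]; apply: le_integrable (dom_int C).
- exact: nice_measurable NT.
- by apply/measurable_EFinP; exact: act_meas.
- move=> z Tz /=; rewrite lee_fin; apply: le_trans (ler_norm _).
  exact: act_dom.
Qed.

Lemma act_lin c p q : bounded_on Q p -> bounded_on Q q ->
  act T o (fun z => c * p z + q z) = c * act T o p + act T o q.
Proof.
move=> bp bq; rewrite /act -RintegralZl//; [|exact: nice_measurable NT|exact: act_integrable].
have mT := nice_measurable NT.
rewrite -RintegralD//; last exact: act_integrable.
  by apply: eq_Rintegral => z _; ring.
exact: (integrableZl mT c (act_integrable bp)).
Qed.

Lemma act_cvg (p_ : nat -> plane -> R) p (C : R) :
  (forall n, bounded_on Q (p_ n)) -> bounded_on Q p ->
  (forall n z, `|p_ n z| <= C) -> (forall z, p_ n z @[n --> \oo] --> p z) ->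
  act T o (p_ n) @[n --> \oo] --> act T o p.
Proof.
move=> bp_ [mp _ _] p_C p_p.
have [|||||_ //] := @dominated_Rcvg _ _ _ (H1 R) (carrier T) (nice_measurable NT)
  (fun n z => p_ n z * o z * mult T z) (fun z => p z * o z * mult T z)
  (fun z => C * (\1_K z * mult T z)).
- by move=> n; apply: act_meas; have [] := bp_ n.
- exact: act_meas.
- move=> z _; apply: cvgM; last exact: cvg_cst.
  by apply: cvgM; [exact: p_p|exact: cvg_cst].
- exact: dom_int.
- by move=> n z Tz; apply: act_dom => // y; have [_ _] := bp_ n; apply.
Qed.

End act_props.

Lemma rc_actE (T : rcurrent R) (NT : nice_current T) (a1 b1 a2 b2 : R) (p q : plane -> R) :
  a < a1 -> b1 < b -> bounded_on (obox a1 b1 a2 b2) p -> bounded_on (obox a1 b1 a2 b2) q ->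
  rc_act T (p, q) = act T (fst \o orient T) p + act T (snd \o orient T) q.
Proof.
move=> aa1 b1b bp bq; have mT := nice_measurable NT.
rewrite /rc_act /act -RintegralD//.
- by apply: eq_Rintegral => z _ /=; rewrite mulrDl.
- exact: (act_integrable NT (nice_orient1 NT) (nice_orient1_le1 NT) aa1 b1b bp).
- exact: (act_integrable NT (nice_orient2 NT) (nice_orient2_le1 NT) aa1 b1b bq).
Qed.

Definition bump (x y s t : R) (n : nat) (z : plane) : R :=
  flat 1 (n.+1%:R * z.1 + - (n.+1%:R * x)) * flat 1 (- n.+1%:R * z.1 + n.+1%:R * y) *
  (flat 1 (n.+1%:R * z.2 + - (n.+1%:R * s)) * flat 1 (- n.+1%:R * z.2 + n.+1%:R * t)).

Lemma flat1_bnd (x : R) : 0 <= flat 1 x <= 1.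
Proof.
rewrite /flat; case: ifPn => x0; last by rewrite lexx ler01.
by rewrite hornerC mul1r expR_ge0/= -expR0 ler_expR lerNl oppr0 invr_ge0 ltW.
Qed.

Lemma bump_bnd x y s t n z : 0 <= bump x y s t n z <= 1.
Proof.
rewrite /bump; set u1 := flat 1 _; set u2 := flat 1 _; set u3 := flat 1 _; set u4 := flat 1 _.
have /andP[? ?] : 0 <= u1 <= 1 by exact: flat1_bnd.
have /andP[? ?] : 0 <= u2 <= 1 by exact: flat1_bnd.
have /andP[? ?] : 0 <= u3 <= 1 by exact: flat1_bnd.
have /andP[? ?] : 0 <= u4 <= 1 by exact: flat1_bnd.
rewrite !mulr_ge0//=; apply: mulr_ile1; rewrite ?mulr_ge0//; exact: mulr_ile1.
Qed.

Lemma smooth_bump x y s t n : smooth (bump x y s t n).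
Proof.
apply: smooth_flat_gen.
exact: (flat_gen_mul (flat_gen_mul (flat_gen_fst _ _ _) (flat_gen_fst _ _ _))
  (flat_gen_mul (flat_gen_snd _ _ _) (flat_gen_snd _ _ _))).
Qed.

Lemma flat1_affine0 (c x y : R) : 0 <= c -> y <= x -> flat 1 (c * y + - (c * x)) = 0.
Proof.
by move=> c0 yx; rewrite /flat ltNge -mulrBr mulr_ge0_le0 ?subr_le0.
Qed.

Lemma bump_eq0 x y s t n z : ~ obox x y s t z -> bump x y s t n z = 0.
Proof.
move=> nz; have E (c u v : R) : - c * u + c * v = c * v + - (c * u).
  by rewrite mulNr addrC.
rewrite /bump !E; have [zx|xz] := leP z.1 x; first by rewrite flat1_affine0// !mul0r.
have [yz|zy] := leP y z.1.
  by rewrite [flat 1 (_ * y + _)]flat1_affine0// mulr0 !mul0r.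
have [zs|sz] := leP z.2 s; first by rewrite [flat 1 (_ * z.2 + - _)]flat1_affine0// mul0r mulr0.
have [tz|zt] := leP t z.2.
  by rewrite [flat 1 (_ * t + _)]flat1_affine0// !mulr0.
by exfalso; apply: nz; split; rewrite /= in_itv/= ?xz ?sz.
Qed.

Lemma flat1_cvg (x y : R) : x < y ->
  flat 1 (n.+1%:R * y + - (n.+1%:R * x)) @[n --> \oo] --> (1 : R).
Proof.
move=> xy.
have -> : (fun n => flat 1 (n.+1%:R * y + - (n.+1%:R * x))) =
    (fun n => expR (- (n.+1%:R^-1 * (y - x)^-1))).
  apply/funext => n; rewrite -mulrBr /flat ifT; last by rewrite mulr_gt0// subr_gt0.
  by rewrite hornerC mul1r invfM.
rewrite -[X in _ --> X]expR0; apply: continuous_cvg; first exact: continuous_expR.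
rewrite -oppr0; apply: cvgN; rewrite -(mul0r (y - x)^-1); apply: cvgMl.
exact: cvg_harmonic.
Qed.

Lemma bump_cvg x y s t z : bump x y s t n z @[n --> \oo] --> (\1_(obox x y s t) z : R).
Proof.
have [zb|nzb] := pselect (obox x y s t z); last first.
  rewrite indicE memNset//; apply: cvg_near_cst; apply: nearW => n.
  exact: bump_eq0.
rewrite indicE mem_set//=; case: zb => /=; rewrite !in_itv/= => /andP[xz zy] /andP[sz zt].
rewrite (_ : 1%:R = 1 * 1 * (1 * 1)); last by rewrite !mulr1.
apply: cvgM; apply: cvgM; first exact: flat1_cvg.
- under eq_fun do rewrite addrC mulNr; exact: flat1_cvg.
- exact: flat1_cvg.
- under eq_fun do rewrite addrC mulNr; exact: flat1_cvg.
Qed.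

Lemma measurable_flat1_affine (l : plane -> R) (c d : R) : measurable_fun setT l ->
  measurable_fun setT (fun z => flat 1 (c * l z + d)).
Proof.
move=> ml; have cf : continuous (flat (1 : {poly R})).
  move=> x; apply: differentiable_continuous; apply/derivable1_diffP.
  by have [] := is_derive_flat 1 x.
apply: measurableT_comp; first exact: continuous_measurable_fun.
by apply: measurable_funD => //; exact: measurable_funM.
Qed.

Lemma bounded_on_bump x y s t n (Q : set plane) : obox x y s t `<=` Q ->
  bounded_on Q (bump x y s t n).
Proof.
move=> bQ; split.
- by apply: measurable_funM; apply: measurable_funM; exact: measurable_flat1_affine.
- by exists 1 => z; have /andP[b0 b1] := bump_bnd x y s t n z; rewrite ger0_norm.
- by move=> z Qz; apply: bump_eq0 => /bQ.
Qed.

Lemma act0 (T : rcurrent R) (o : plane -> R) : act T o (fun=> 0) = 0.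
Proof.
rewrite /act; under eq_Rintegral do rewrite !mul0r.
by rewrite /Rintegral integral0.
Qed.

Section act_extension.
Variables (T : rcurrent R) (NT : nice_current T).
Variables (I : finType) (c : I -> R) (S : I -> rcurrent R) (NS : forall i, nice_current (S i)).

Lemma act_extension_proj (o : rcurrent R -> plane -> R) (a1 b1 a2 b2 : R) (p : plane -> R) :
  (forall T, nice_current T -> measurable_fun (carrier T : set (H1plane R)) (o T)) ->
  (forall T z, nice_current T -> carrier T z -> `|o T z| <= 1) ->
  a < a1 -> b1 < b ->
  (forall x y s t n, obox x y s t `<=` obox a1 b1 a2 b2 ->
    act T (o T) (bump x y s t n) = \sum_i c i * act (S i) (o (S i)) (bump x y s t n)) ->
  bounded_on (obox a1 b1 a2 b2) p ->
  act T (o T) p = \sum_i c i * act (S i) (o (S i)) p.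
Proof.
move=> mo o1 aa1 b1b TS bp; set Q := obox a1 b1 a2 b2 in TS bp *.
pose L p := act T (o T) p - \sum_i c i * act (S i) (o (S i)) p.
apply/eqP; rewrite -subr_eq0; apply/eqP.
have L_cvg (p_ : nat -> plane -> R) (p' : plane -> R) (C : R) :
    (forall n, bounded_on Q (p_ n)) -> bounded_on Q p' ->
    (forall n z, `|p_ n z| <= C) -> (forall z, p_ n z @[n --> \oo] --> p' z) ->
    L (p_ n) @[n --> \oo] --> L p'.
  move=> bp_ bp' pC pp; apply: cvgB.
    exact: (act_cvg NT (mo _ NT) (fun z => o1 _ z NT) aa1 b1b bp_ bp' pC pp).
  apply: cvg_sum_R => i; apply: cvgM; first exact: cvg_cst.
  exact: (act_cvg (NS i) (mo _ (NS i)) (fun z => o1 _ z (NS i)) aa1 b1b bp_ bp' pC pp).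
apply: (@bounded_monotone_class _ a1 b1 a2 b2 L) => //.
- move=> e p1 p2 bp1 bp2; rewrite /L.
  rewrite (act_lin (a2 := a2) (b2 := b2) NT (mo _ NT) (fun z => o1 _ z NT) aa1 b1b)//.
  under eq_bigr => i _ do rewrite (act_lin (a2 := a2) (b2 := b2) (NS i) (mo _ (NS i))
      (fun z => o1 _ z (NS i)) aa1 b1b)// mulrDr mulrCA.
  by rewrite big_split/= -mulr_sumr; ring.
- move=> x y s t bQ.
  have <- : lim (L (bump x y s t n) @[n --> \oo]) = L \1_(obox x y s t).
    apply/cvg_lim => //; apply: (@L_cvg _ _ 1).
    + by move=> n; exact: bounded_on_bump.
    + by apply: bounded_on_indic => //; exact: measurable_obox.
    + by move=> n z; have /andP[? ?] := bump_bnd x y s t n z; rewrite ger0_norm.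
    + exact: bump_cvg.
  have -> : (fun n => L (bump x y s t n)) = cst 0.
    by apply/funext => n /=; apply/eqP; rewrite subr_eq0 TS.
  exact: lim_cst.
Qed.

Hypothesis TS : forall omega, test_form a b omega ->
  rc_act T omega = \sum_i c i * rc_act (S i) omega.

Lemma act_extension (a1 b1 a2 b2 : R) (p : plane -> R) : a < a1 -> b1 < b ->
  bounded_on (obox a1 b1 a2 b2) p ->
  act T (fst \o orient T) p = \sum_i c i * act (S i) (fst \o orient (S i)) p /\
  act T (snd \o orient T) p = \sum_i c i * act (S i) (snd \o orient (S i)) p.
Proof.
move=> aa1 b1b bp; set Q := obox a1 b1 a2 b2.
pose K : set plane := `[a1, b1] `*` `[a2, b2].
have [cK Kab _] := closed_box_compact a2 b2 aa1 b1b.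
have tf x y s t n : obox x y s t `<=` Q ->
    test_form a b (bump x y s t n, fun=> 0) /\ test_form a b (fun=> 0, bump x y s t n).
  move=> bQ.
  have b0 z : ~ K z -> bump x y s t n z = 0.
    move=> Kz; apply: bump_eq0 => /bQ[]; rewrite /= !in_itv/= => /andP[z1 z1'] /andP[z2 z2'].
    by apply: Kz; split; rewrite /= in_itv/= !ltW.
  split; split => /=; try exact: smooth_bump; try exact: smooth_flat_gen (flat_gen_cst 0).
    by exists K; split => // z Kz; rewrite b0.
  by exists K; split => // z Kz; rewrite b0.
have bb0 := bounded_on_0 Q.
split.
- apply: (act_extension_proj (o := fun T => fst \o orient T) _ _ aa1 b1b _ bp).
  + by move=> T' NT'; exact: nice_orient1.
  + by move=> T' z NT'; exact: nice_orient1_le1.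
  + move=> x y s t n bQ; have [/TS+ _] := tf x y s t n bQ.
    rewrite (rc_actE NT aa1 b1b (bounded_on_bump n bQ) bb0) act0 addr0 => ->.
    apply: eq_bigr => i _; congr (_ * _).
    by rewrite (rc_actE (NS i) aa1 b1b (bounded_on_bump n bQ) bb0) act0 addr0.
- apply: (act_extension_proj (o := fun T => snd \o orient T) _ _ aa1 b1b _ bp).
  + by move=> T' NT'; exact: nice_orient2.
  + by move=> T' z NT'; exact: nice_orient2_le1.
  + move=> x y s t n bQ; have [_ /TS+] := tf x y s t n bQ.
    rewrite (rc_actE NT aa1 b1b bb0 (bounded_on_bump n bQ)) act0 add0r => ->.
    apply: eq_bigr => i _; congr (_ * _).
    by rewrite (rc_actE (NS i) aa1 b1b bb0 (bounded_on_bump n bQ)) act0 add0r.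
Qed.

End act_extension.

End nice_currents.

(** * SBV functions with finitely many jumps *)

Section spline_step.
Context {R : realType}.
Implicit Types x y e p : R.

Definition posq y : R := if 0 < y then y ^+ 2 else 0.

Lemma is_derive_posq y : is_derive y 1 posq (2 * Num.max y 0).
Proof.
have [y0|y0|->] := ltgtP y 0.
- apply: (@near_eq_is_derive _ _ _ (cst 0)).
    near=> z; rewrite /posq ltNge ifF//; apply/negbF/ltW.
    by near: z; exact: lt_nbhsl.
  rewrite mulr0; exact: is_derive_cst.
- apply: (@near_eq_is_derive R R R (fun z : R => z ^+ 2)).
    near=> z; rewrite /posq ifT//.
    by near: z; exact: lt_nbhsr.
  have h := is_deriveM (is_derive_id y (1 : R)) (is_derive_id y (1 : R)).
  by apply: (is_derive_eq h); rewrite /GRing.scale/= mulr1 mulr_natl mulr2n.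
- have cv : h^-1 *: (posq (h *: 1 + 0) - posq 0) @[h --> 0^'] --> (0 : R).
    have f0 : posq 0 = 0 by rewrite /posq ltxx.
    apply: norm_cvg0; apply: (@squeeze_cvgr _ _ _ _ (cst 0) (fun h : R => `|h|)).
    + near=> h; rewrite normr_ge0/= f0 subr0 addr0 /GRing.scale/= mulr1 normrM normfV.
      have h0 : h != 0 by near: h; exact: nbhs_dnbhs_neq.
      rewrite ler_pdivrMl ?normr_gt0// -expr2 real_normK ?num_real// /posq.
      by case: ifPn => _; rewrite ?normr0 ?sqr_ge0// ger0_norm ?sqr_ge0.
    + exact: cvg_cst.
    + apply: cvg_within_filter.
      have H : `|h| @[h --> (0 : R)] --> `|0 : R| by exact: (@norm_continuous R R^o 0).
      by rewrite normr0 in H.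
  rewrite mulr0; apply: DeriveDef; first by apply/cvg_ex; exists 0.
  exact: cvg_lim.
Unshelve. all: by end_near. Qed.

Definition step y : R := 2 * posq y + - 4 * posq (y - 2^-1) + 2 * posq (y - 1).
Definition hat y : R := 4 * Num.max y 0 + - 8 * Num.max (y - 2^-1) 0 + 4 * Num.max (y - 1) 0.

Lemma is_derive_step y : is_derive y 1 step (hat y).
Proof.
have D c : is_derive y 1 (fun z : R => posq (z - c)) (2 * Num.max (y - c) 0).
  have d1 : is_derive y 1 (fun z : R => z - c) 1.
    by apply: is_derive_eq; rewrite subr0.
  have := @is_derive1_comp R posq (fun z : R => z - c) y _ _ (is_derive_posq (y - c)) d1.
  by rewrite mulr1.
have := is_deriveD (is_deriveD (is_deriveZ 2 (is_derive_posq y)) (is_deriveZ (- 4) (D 2^-1)))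
  (is_deriveZ 2 (D 1)).
move=> H; have <- : 2 \*: posq + - 4 \*: (fun z => posq (z - 2^-1)) +
  2 \*: (fun z => posq (z - 1)) = step by [].
apply: (is_derive_eq H); rewrite /hat /GRing.scale/=; ring.
Qed.

Lemma hat_continuous : continuous hat.
Proof.
have C (c k : R) : continuous (fun y : R => k * Num.max (y - c) 0).
  move=> y; apply: cvgM; first exact: cvg_cst.
  apply: (@continuous_max R R (fun y : R => y - c) (cst 0)); last exact: cvg_cst.
  by apply: cvgB; [exact: cvg_id|exact: cvg_cst].
have -> : hat = (fun y => 4 * Num.max (y - 0) 0 + - 8 * Num.max (y - 2^-1) 0 + 4 * Num.max (y - 1) 0).
  by apply/funext => y; rewrite /hat subr0.
by move=> y; apply: cvgD; [apply: cvgD|]; exact: C.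
Qed.

Lemma hat_bnd y : 0 <= hat y <= 2.
Proof.
rewrite /hat; case: (leP y 0) => ?; case: (leP (y - 2^-1) 0) => ?; case: (leP (y - 1) 0) => ?;
  apply/andP; split; lra.
Qed.

Lemma hat_eq0 y : y <= 0 \/ 1 <= y -> hat y = 0.
Proof.
rewrite /hat; case: (leP y 0) => ?; case: (leP (y - 2^-1) 0) => ?; case: (leP (y - 1) 0) => ?;
  case=> ?; lra.
Qed.

Lemma step0 y : y <= 0 -> step y = 0.
Proof.
move=> y0; have F z : z <= 0 -> posq z = 0 by rewrite /posq ltNge => ->.
by rewrite /step !F; [ring|lra|lra|].
Qed.

Lemma step1 y : 1 <= y -> step y = 1.
Proof.
move=> y1; rewrite /step /posq (_ : 0 < y); last lra.
rewrite (_ : 0 < y - 2^-1); last lra.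
have [y1'|] := ltP 0 (y - 1); first by field.
by move=> y1'; have -> : y = 1 by [lra]; field.
Qed.

Lemma step_bnd y : 0 <= step y <= 1.
Proof.
have [y0|y0] := leP y 0; first by rewrite step0// lexx ler01.
have [y1|y1] := leP 1 y; first by rewrite step1// lexx ler01.
rewrite /step /posq y0 (_ : (0 < y - 1) = false); last by apply/negbTE; rewrite -leNgt; lra.
by case: ltP => h; apply/andP; split; nra.
Qed.

Definition ramp e p x : R := step ((x - p) / e).
Definition kern e p x : R := hat ((x - p) / e) / e.

Lemma is_derive_ramp e p x : is_derive x 1 (ramp e p) (kern e p x).
Proof.
have d1 : is_derive x 1 (fun z : R => (z - p) / e) e^-1.
  have -> : (fun z : R => (z - p) / e) = e^-1 \*: ((id : R -> R) - cst p).
    by apply/funext => z /=; rewrite /GRing.scale/= mulrC.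
  by apply: is_derive_eq; rewrite subr0 /GRing.scale/= mulr1.
exact: (@is_derive1_comp R step (fun z : R => (z - p) / e) x _ _
  (is_derive_step ((x - p) / e)) d1).
Qed.

Lemma kern_continuous e p : continuous (kern e p).
Proof.
move=> x; apply: cvgM; last exact: cvg_cst.
apply: (@continuous_comp _ _ _ (fun z : R => (z - p) / e) hat); last exact: hat_continuous.
apply: cvgM; last exact: cvg_cst.
by apply: cvgB; [exact: cvg_id|exact: cvg_cst].
Qed.

Lemma kern_bnd e p x : 0 < e -> 0 <= kern e p x <= 2 / e.
Proof.
move=> e0; have /andP[h0 h2] := hat_bnd ((x - p) / e).
by rewrite /kern divr_ge0 ?(ltW e0)//= ler_pM2r// invr_gt0.
Qed.

Lemma kern_eq0 e p x : 0 < e -> ~ (x \in `]p, (p + e)[) -> kern e p x = 0.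
Proof.
move=> e0 xp; rewrite /kern hat_eq0 ?mul0r//.
have [xp'|px] := leP x p; first by left; rewrite pmulr_lle0 ?invr_gt0// subr_le0.
right; rewrite ler_pdivlMr// mul1r lerBrDl leNgt; apply/negP => xpe.
by apply: xp; rewrite in_itv/= px.
Qed.

Lemma ramp0 e p x : 0 < e -> x <= p -> ramp e p x = 0.
Proof. by move=> e0 xp; rewrite /ramp step0// pmulr_lle0 ?invr_gt0// subr_le0. Qed.

Lemma ramp1 e p x : 0 < e -> p + e <= x -> ramp e p x = 1.
Proof. by move=> e0 xp; rewrite /ramp step1// ler_pdivlMr// mul1r lerBrDl. Qed.

Lemma ramp_bnd e p x : 0 <= ramp e p x <= 1.
Proof. exact: step_bnd. Qed.

Lemma Rintegral_kern e p : 0 < e ->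
  \int[@lebesgue_measure R]_(x in `]p, (p + e)[) kern e p x = 1.
Proof.
move=> e0; rewrite /Rintegral -(@integral_itv_bndoo _ _ _ _ true false); last first.
  apply/measurable_EFinP; apply: measurable_funTS.
  exact: (continuous_measurable_fun (@kern_continuous e p)).
rewrite (@continuous_FTC2 R (kern e p) (ramp e p)) ?ltrDl//.
- by rewrite [ramp e p p]ramp0// ramp1//= oppr0 addr0.
- exact: continuous_subspaceT (@kern_continuous e p).
- have cr : continuous (ramp e p).
    move=> x; apply: differentiable_continuous; apply/derivable1_diffP.
    by have [] := is_derive_ramp e p x.
  split.
  + by move=> x _; have [] := is_derive_ramp e p x.
  + by apply: cvg_at_right_filter; exact: cr.
  + by apply: cvg_at_left_filter; exact: cr.
- by move=> x _; rewrite derive1E; have [_ ->] := is_derive_ramp e p x.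
Qed.

End spline_step.

Section kernel_limit.
Context {R : realType}.
Local Notation leb := (@lebesgue_measure R).

Lemma kern_limit (v : R -> R) (l : R) (p r : nat -> R) :
  (forall n, 0 < r n) ->
  (forall n, leb.-integrable `]p n, p n + r n[ (EFin \o v)) ->
  scaled_dev v l (r n) `]p n, p n + r n[ @[n --> \oo] --> 0%E ->
  \int[leb]_(x in `]p n, (p n + r n)[) (v x * kern (r n) (p n) x) @[n --> \oo] --> l.
Proof.
move=> r0 iv /fine_cvgP[_ dev0].
have mk n : measurable_fun `]p n, (p n + r n)[ (kern (r n) (p n)).
  by apply: measurable_funTS; exact: (continuous_measurable_fun (@kern_continuous R _ _)).
have bk n x : `]p n, (p n + r n)[%classic x -> `|kern (r n) (p n) x| <= 2 / r n.
  by move=> _; have /andP[k0 k2] := kern_bnd (p n) x (r0 n); rewrite ger0_norm.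
have fin n : (leb `]p n, (p n + r n)%R[%classic < +oo)%E.
  by rewrite lebesgue_measure_itv/=; case: ifPn => _; rewrite ltry.
have mI n : measurable `]p n, (p n + r n)[%classic by exact: measurable_itv.
have ik n : leb.-integrable `]p n, p n + r n[ (EFin \o kern (r n) (p n)).
  exact: (bounded_fun_integrable leb (mI n) (fin n) (mk n) (bk n)).
have il n : leb.-integrable `]p n, p n + r n[ (EFin \o cst l).
  exact: (@bounded_fun_integrable _ _ _ leb _ (mI n) (cst l) `|l| (fin n)).
have ivk n : leb.-integrable `]p n, p n + r n[ (EFin \o (fun x => v x * kern (r n) (p n) x)).
  exact: (integrable_mul_bounded leb (mI n) (iv n) (mk n) (bk n)).
have ilk n : leb.-integrable `]p n, p n + r n[ (EFin \o (fun x => l * kern (r n) (p n) x)).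
  exact: (integrable_scale leb (mI n)).
have ivl n : leb.-integrable `]p n, p n + r n[ (EFin \o (fun x => `|v x - l|)).
  exact: (integrable_norm (integrable_sub leb (mI n) (iv n) (il n))).
have E n : `|\int[leb]_(x in `]p n, (p n + r n)[) (v x * kern (r n) (p n) x) - l| <=
    2 * fine (scaled_dev v l (r n) `]p n, p n + r n[).
  have {1}-> : l = \int[leb]_(x in `]p n, (p n + r n)[) (l * kern (r n) (p n) x).
    by rewrite RintegralZl// Rintegral_kern// mulr1.
  rewrite -RintegralB//.
  have ivlk : leb.-integrable `]p n, p n + r n[
      (EFin \o (fun x => v x * kern (r n) (p n) x - l * kern (r n) (p n) x)).
    exact: (integrable_sub leb (mI n)).
  apply: (le_trans (@le_normr_Rintegral _ _ _ leb _ _ (mI n) ivlk)).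
  have -> : fine (scaled_dev v l (r n) `]p n, p n + r n[) =
      (r n)^-1 * \int[leb]_(x in `]p n, (p n + r n)[) `|v x - l|.
    rewrite /scaled_dev fineM//.
    exact: integrable_fin_num.
  rewrite mulrA -RintegralZl//; apply: le_Rintegral => //.
  - exact: (integrable_norm ivlk).
  - exact: (integrable_scale leb (mI n)).
  - move=> x _; rewrite -mulrBl normrM mulrC ler_wpM2r//.
    by have /andP[k0 k2] := kern_bnd (p n) x (r0 n); rewrite ger0_norm.
apply/subr_cvg0; apply: norm_cvg0.
apply: (@squeeze_cvgr _ _ _ _ (cst 0) (fun n => 2 * fine (scaled_dev v l (r n) `]p n, p n + r n[))).
- by apply: nearW => n; rewrite normr_ge0 E.
- exact: cvg_cst.
- by rewrite -(mulr0 2); apply: cvgM; [exact: cvg_cst|exact: dev0].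
Qed.

End kernel_limit.

Section one_sided_limits.
Context {R : realType}.
Local Notation leb := (@lebesgue_measure R).
Implicit Types (u v w : R -> R).

Lemma seq_at_right (r : nat -> R) : (forall n, 0 < r n) ->
  r n @[n --> \oo] --> 0 -> r n @[n --> \oo] --> 0^'+.
Proof.
move=> r0 rc P [e /= e0 He].
have /cvgrPdist_lt/(_ e e0)[N _ HN] := rc.
by exists N => // n /= /HN ren; apply: He.
Qed.

Lemma vanishing_seq (e : R) : 0 < e -> exists r : nat -> R,
  [/\ forall n, 0 < r n, forall n, r n <= e & r n @[n --> \oo] --> (0 : R)].
Proof.
move=> e0; exists (fun n => e / n.+1%:R); split=> [n|n|]; first by rewrite divr_gt0.
  by rewrite ler_pdivrMr// ler_peMr ?ler1n// ltW.
rewrite -(mulr0 e); apply: cvgM; first exact: cvg_cst.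
exact: cvg_harmonic.
Qed.

Lemma scaled_dev_ge0 u l (r : R) D : 0 < r -> (0 <= scaled_dev u l r D)%E.
Proof.
move=> r0; apply: mule_ge0; first by rewrite lee_fin invr_ge0 ltW.
by apply: integral_ge0 => y _; rewrite lee_fin.
Qed.

Lemma le_scaled_dev u l (r : R) (D E : set R) : 0 < r -> D `<=` E ->
  measurable D -> measurable E -> measurable_fun E u ->
  (scaled_dev u l r D <= scaled_dev u l r E)%E.
Proof.
move=> r0 DE mD mE mu; rewrite lee_pmul2l ?lte_fin ?invr_gt0//.
apply: ge0_subset_integral => //; apply/measurable_EFinP.
by apply: measurableT_comp => //; exact: measurable_funB.
Qed.

Lemma rtrace_spec_eq u v x l (d : R) : 0 < d ->
  {in `]x, (x + d)[, u =1 v} -> rtrace_spec u x l -> rtrace_spec v x l.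
Proof.
move=> d0 uv; apply: cvg_trans; apply: near_eq_cvg.
near=> r; rewrite /scaled_dev; congr (_ * _)%E; apply: eq_integral => y.
rewrite inE/= in_itv/= => /andP[xy yr]; rewrite uv// in_itv/= xy/= (lt_le_trans yr)// lerD2l.
by near: r; exact: nbhs_right_le.
Unshelve. all: by end_near. Qed.

Lemma ltrace_spec_eq u v x l (d : R) : 0 < d ->
  {in `](x - d), x[, u =1 v} -> ltrace_spec u x l -> ltrace_spec v x l.
Proof.
move=> d0 uv; apply: cvg_trans; apply: near_eq_cvg.
near=> r; rewrite /scaled_dev; congr (_ * _)%E; apply: eq_integral => y.
rewrite inE/= in_itv/= => /andP[xy yr]; rewrite uv// in_itv/= yr andbT (le_lt_trans _ xy)//.
by rewrite lerD2l lerN2; near: r; exact: nbhs_right_le.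
Unshelve. all: by end_near. Qed.

Lemma approx_limit_spec_eq u v x l (d : R) : 0 < d ->
  {in `](x - d), (x + d)[, u =1 v} -> approx_limit_spec u x l -> approx_limit_spec v x l.
Proof.
move=> d0 uv; apply: cvg_trans; apply: near_eq_cvg.
near=> r; rewrite /scaled_dev; congr (_ * _)%E; apply: eq_integral => y.
have rd : r <= d by near: r; exact: nbhs_right_le.
rewrite inE/= in_itv/= => /andP[xy yr]; rewrite uv// in_itv/=; apply/andP; split; lra.
Unshelve. all: by end_near. Qed.

Lemma rtrace_eq u v x (d : R) : 0 < d -> {in `]x, (x + d)[, u =1 v} ->
  rtrace u x = rtrace v x.
Proof.
move=> d0 uv; rewrite /rtrace; congr xget; apply/seteqP; split => l /=.
  exact: rtrace_spec_eq uv.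
by apply: (rtrace_spec_eq d0) => y /uv.
Qed.

Lemma ltrace_eq u v x (d : R) : 0 < d -> {in `](x - d), x[, u =1 v} ->
  ltrace u x = ltrace v x.
Proof.
move=> d0 uv; rewrite /ltrace; congr xget; apply/seteqP; split => l /=.
  exact: ltrace_spec_eq uv.
by apply: (ltrace_spec_eq d0) => y /uv.
Qed.

Lemma scaled_dev_ae_le u l (r e : R) (D : set R) : 0 < r -> 0 <= e -> measurable D ->
  (leb D <= r%:E)%E -> measurable_fun D u ->
  {ae leb, forall y, D y -> `|u y - l| <= e} -> (scaled_dev u l r D <= e%:E)%E.
Proof.
move=> r0 e0 mD Dr mu ue; rewrite /scaled_dev.
apply: (@le_trans _ _ ((r^-1)%:E * (e%:E * r%:E))%E); last first.
  by rewrite -!EFinM lee_fin mulrCA mulVf ?mulr1// gt_eqF.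
rewrite lee_pmul2l ?lte_fin ?invr_gt0//.
apply: (@le_trans _ _ (\int[leb]_(y in D) e%:E)%E); last first.
  by rewrite integral_cst// lee_pmul.
apply: ae_ge0_le_integral => //.
- by apply/measurable_EFinP; apply: measurableT_comp => //; exact: measurable_funB.
Qed.

Lemma rtrace_spec_ae u w x l (d : R) : 0 < d -> measurable_fun `]x, (x + d)[ u ->
  {ae leb, forall y, `]x, (x + d)[%classic y -> u y = w y} ->
  w y @[y --> x^'+] --> l -> rtrace_spec u x l.
Proof.
move=> d0 mu uw wl; apply/fine_cvgP.
have key (e : R) : 0 < e -> \forall r \near 0^'+, (0 <= scaled_dev u l r `]x, (x + r)%R[ <= e%:E)%E.
  move=> e0; have /cvgrPdist_le/(_ e e0)[s /= s0 Hs] := wl.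
  near=> r; have r0 : 0 < r by near: r; exact: nbhs_right_gt.
  have rd : r <= d by near: r; exact: nbhs_right_le.
  have rs : r <= s by near: r; exact: nbhs_right_le.
  rewrite scaled_dev_ge0//=; apply: scaled_dev_ae_le => //; first exact: ltW.
  - rewrite lebesgue_measure_itv/= lte_fin ltrDl r0 lee_fin; lra.
  - apply: measurable_funS mu => //; apply: subset_itvl; rewrite bnd_simp; lra.
  - apply: ae_imply uw => y uwy /=; rewrite in_itv/= => /andP[xy yr].
    rewrite uwy; last by rewrite /= in_itv/= xy (lt_le_trans yr)// lerD2l.
    rewrite distrC; apply: Hs => //=; rewrite ltr_distlC; apply/andP; split; lra.
split.
  have := key 1 ltr01; apply: filterS => r /andP[d1 d2].
  by rewrite ge0_fin_numE// (le_lt_trans d2)// ltry.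
apply/cvgrPdist_le => e e0; have := key e e0; apply: filterS => r /andP[d1 d2] /=.
rewrite sub0r normrN ger0_norm ?fine_ge0// -lee_fin fineK//.
by rewrite ge0_fin_numE// (le_lt_trans d2)// ltry.
Unshelve. all: by end_near. Qed.

Lemma ltrace_spec_ae u w x l (d : R) : 0 < d -> measurable_fun `](x - d), x[ u ->
  {ae leb, forall y, `](x - d), x[%classic y -> u y = w y} ->
  w y @[y --> x^'-] --> l -> ltrace_spec u x l.
Proof.
move=> d0 mu uw wl; apply/fine_cvgP.
have key (e : R) : 0 < e -> \forall r \near 0^'+, (0 <= scaled_dev u l r `](x - r)%R, x[ <= e%:E)%E.
  move=> e0; have /cvgrPdist_le/(_ e e0)[s /= s0 Hs] := wl.
  near=> r; have r0 : 0 < r by near: r; exact: nbhs_right_gt.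
  have rd : r <= d by near: r; exact: nbhs_right_le.
  have rs : r <= s by near: r; exact: nbhs_right_le.
  rewrite scaled_dev_ge0//=; apply: scaled_dev_ae_le => //; first exact: ltW.
  - rewrite lebesgue_measure_itv/= lte_fin ltrBlDr ltrDl r0 lee_fin; lra.
  - apply: measurable_funS mu => //; apply: subset_itvr; rewrite bnd_simp; lra.
  - apply: ae_imply uw => y uwy /=; rewrite in_itv/= => /andP[xy yr].
    rewrite uwy; last by rewrite /= in_itv/= yr andbT (le_lt_trans _ xy)// lerD2l lerN2.
    rewrite distrC; apply: Hs => //=; rewrite ltr_distlC; apply/andP; split; lra.
split.
  have := key 1 ltr01; apply: filterS => r /andP[d1 d2].
  by rewrite ge0_fin_numE// (le_lt_trans d2)// ltry.
apply/cvgrPdist_le => e e0; have := key e e0; apply: filterS => r /andP[d1 d2] /=.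
rewrite sub0r normrN ger0_norm ?fine_ge0// -lee_fin fineK//.
by rewrite ge0_fin_numE// (le_lt_trans d2)// ltry.
Unshelve. all: by end_near. Qed.

Lemma scaled_dev_unique u (l l' : R) (D : R -> set R) (d : R) : 0 < d ->
  (forall r, 0 < r -> r <= d -> [/\ measurable (D r), leb (D r) = r%:E & measurable_fun (D r) u]) ->
  scaled_dev u l r (D r) @[r --> 0^'+] --> 0%E ->
  scaled_dev u l' r (D r) @[r --> 0^'+] --> 0%E -> l = l'.
Proof.
move=> d0 HD c1 c2.
have c12 : (scaled_dev u l r (D r) + scaled_dev u l' r (D r))%E @[r --> 0^'+] --> (0 + 0)%E.
  by apply: cvgeD.
rewrite adde0 in c12.
suff : (`|l - l'|%:E <= 0)%E by rewrite lee_fin normr_le0 subr_eq0 => /eqP.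
rewrite -(cvg_lim _ c12)//; apply: lime_ge; first by apply/cvg_ex; exists 0%E.
near=> r; have r0 : 0 < r by near: r; exact: nbhs_right_gt.
have rd : r <= d by near: r; exact: nbhs_right_le.
have [mD Dr mu] := HD r r0 rd.
have mul k : measurable_fun (D r) (fun y => `|u y - k|%:E).
  by apply/measurable_EFinP; apply: measurableT_comp => //; exact: measurable_funB.
rewrite /scaled_dev -muleDr//; last first.
  by rewrite ge0_adde_def// inE integral_ge0.
rewrite -ge0_integralD//; last 2 first.
- exact: (mul l).
- exact: (mul l').
have -> : `|l - l'|%:E = ((r^-1)%:E * \int[leb]_(y in D r) `|l - l'|%:E)%E.
  have -> : (\int[leb]_(y in D r) `|l - l'|%:E = `|l - l'|%:E * leb (D r))%E.
    exact: integral_cst.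
  by rewrite Dr -!EFinM mulrCA mulVf ?mulr1// gt_eqF.
rewrite lee_pmul2l ?lte_fin ?invr_gt0//; apply: ge0_le_integral => //.
- exact: (emeasurable_funD (mul l) (mul l')).
- move=> y _; rewrite -EFinD lee_fin [`|u y - l|]distrC.
  by apply: le_trans (ler_normD _ _); rewrite addrA subrK.
Unshelve. all: by end_near. Qed.

Lemma rtrace_spec_unique u x (l l' d : R) : 0 < d -> measurable_fun `]x, (x + d)[ u ->
  rtrace_spec u x l -> rtrace_spec u x l' -> l = l'.
Proof.
move=> d0 mu; apply: (scaled_dev_unique d0) => r r0 rd; split => //.
  by rewrite lebesgue_measure_itv/= lte_fin ltrDl r0 -EFinB addrAC subrr add0r.
by apply: measurable_funS mu => //; apply: subset_itvl; rewrite bnd_simp lerD2l.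
Qed.

Lemma ltrace_spec_unique u x (l l' d : R) : 0 < d -> measurable_fun `](x - d), x[ u ->
  ltrace_spec u x l -> ltrace_spec u x l' -> l = l'.
Proof.
move=> d0 mu; apply: (scaled_dev_unique d0) => r r0 rd; split => //.
  by rewrite lebesgue_measure_itv/= lte_fin ltrBlDr ltrDl r0 -EFinB opprB addrCA subrr addr0.
by apply: measurable_funS mu => //; apply: subset_itvr; rewrite bnd_simp lerD2l lerN2.
Qed.

Lemma rtraceE u x (l d : R) : 0 < d -> measurable_fun `]x, (x + d)[ u ->
  rtrace_spec u x l -> rtrace u x = l.
Proof.
move=> d0 mu ul; rewrite /rtrace; case: xgetP => [y _ ys|/(_ l)//].
exact: (rtrace_spec_unique d0 mu ys ul).
Qed.

Lemma ltraceE u x (l d : R) : 0 < d -> measurable_fun `](x - d), x[ u ->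
  ltrace_spec u x l -> ltrace u x = l.
Proof.
move=> d0 mu ul; rewrite /ltrace; case: xgetP => [y _ ys|/(_ l)//].
exact: (ltrace_spec_unique d0 mu ys ul).
Qed.

Lemma approx_limit_traces u x (l d : R) : 0 < d -> measurable_fun `](x - d), (x + d)[ u ->
  approx_limit_spec u x l <-> ltrace_spec u x l /\ rtrace_spec u x l.
Proof.
move=> d0 mu; split=> [ul|[ull ulr]].
  split.
  - apply: (@squeeze_cvge _ _ _ _ (cst 0%E) _ (fun r => scaled_dev u l r `](x - r), (x + r)[)) => //.
      near=> r; have r0 : 0 < r by near: r; exact: nbhs_right_gt.
      have rd : r <= d by near: r; exact: nbhs_right_le.
      rewrite scaled_dev_ge0//=; apply: le_scaled_dev => //.
        by apply: subset_itvl; rewrite bnd_simp; lra.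
      by apply: measurable_funS mu => //; apply: subset_itv; rewrite bnd_simp; lra.
    exact: cvg_cst.
  - apply: (@squeeze_cvge _ _ _ _ (cst 0%E) _ (fun r => scaled_dev u l r `](x - r), (x + r)[)) => //.
      near=> r; have r0 : 0 < r by near: r; exact: nbhs_right_gt.
      have rd : r <= d by near: r; exact: nbhs_right_le.
      rewrite scaled_dev_ge0//=; apply: le_scaled_dev => //.
        by apply: subset_itvr; rewrite bnd_simp; lra.
      by apply: measurable_funS mu => //; apply: subset_itv; rewrite bnd_simp; lra.
    exact: cvg_cst.
have c12 : (scaled_dev u l r `](x - r)%R, x[ + scaled_dev u l r `]x, (x + r)%R[)%E @[r --> 0^'+] --> 0%E.
  by rewrite -[X in _ --> X]adde0; apply: cvgeD.
apply: cvg_trans c12; apply: near_eq_cvg.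
near=> r; have r0 : 0 < r by near: r; exact: nbhs_right_gt.
have rd : r <= d by near: r; exact: nbhs_right_le.
rewrite /scaled_dev -muleDr//; last by rewrite ge0_adde_def// inE integral_ge0.
congr (_ * _)%E.
have -> : `](x - r), (x + r)[%classic = `](x - r), x[%classic `|` `[x, (x + r)[%classic.
  by rewrite -itv_bndbnd_setU// bnd_simp; lra.
have mud E : E `<=` `](x - d), (x + d)[%classic -> measurable E ->
    measurable_fun E (fun y => `|u y - l|%:E).
  move=> Ed mE; apply/measurable_EFinP; apply: measurableT_comp => //.
  by apply: measurable_funB => //; exact: measurable_funS mu.
rewrite ge0_integral_setU//=.
- congr (_ + _)%E; rewrite -integral_itv_obnd_cbnd//.
  by apply: mud => //; apply: subset_itv; rewrite bnd_simp; lra.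
- apply: mud; last exact: measurableU.
  by move=> y [] /=; rewrite !in_itv/= => /andP[? ?]; apply/andP; split; lra.
- apply/disj_setPS => y [] /=; rewrite !in_itv/= => /andP[? ?] /andP[? ?]; lra.
Unshelve. all: by end_near. Qed.

Lemma ae_ex (P : R -> Prop) (c d : R) : c < d -> {ae leb, forall x, P x} ->
  exists2 x, x \in `]c, d[ & P x.
Proof.
move=> cd [N [mN N0 PN]]; apply: contrapT => nex.
have : (leb `]c, d[%classic <= leb N)%E.
  apply: le_measure; rewrite ?inE// => x /= xcd; apply: PN => Px.
  by apply: nex; exists x.
by rewrite N0 lebesgue_measure_itv/= lte_fin cd -EFinB lee_fin leNgt subr_gt0 cd.
Qed.

Lemma ae_rtrace_spec v (a b : R) : leb.-integrable `]a, b[ (EFin \o v) ->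
  {ae leb, forall x, `]a, b[%classic x -> rtrace_spec v x (v x)}.
Proof.
move=> iv; have H := lebesgue_differentiation (integrable_locally (measurable_itv _) iv).
apply: ae_imply H => x lx /=; rewrite in_itv/= => /andP[ax xb].
have mv : measurable_fun `]a, b[ v by apply/measurable_EFinP; case/integrableP : iv.
have xab : x \in `]a, b[ by rewrite in_itv/= ax xb.
apply: (@squeeze_cvge _ _ _ _ (cst 0%E) _ (fun r => 2%:E * davg (v \_ `]a, b[) x r)%E) => //.
- near=> r; have r0 : 0 < r by near: r; exact: nbhs_right_gt.
  have ra : r <= x - a by near: r; apply: nbhs_right_le; rewrite subr_gt0.
  have rb : r <= b - x by near: r; apply: nbhs_right_le; rewrite subr_gt0.
  rewrite scaled_dev_ge0//= /davg /iavg lebesgue_measure_ball ?(ltW r0)//.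
  have -> : ((r *+ 2)%:E^-1 = (2^-1 * r^-1)%:E)%E.
    by rewrite inver gt_eqF ?mulrn_wgt0//; congr (_%:E); rewrite -(mulr_natl r 2) invfM.
  rewrite muleA /scaled_dev -EFinM mulrA divff// mul1r.
  rewrite lee_pmul2l ?lte_fin ?invr_gt0//.
  have bab : ball x r `<=` `]a, b[%classic.
    by move=> y; rewrite ball_itv/= !in_itv/= => /andP[? ?]; apply/andP; split; lra.
  have -> : (\int[leb]_(y in ball x r) `|((center ((v \_ `]a, b[) x) \o (v \_ `]a, b[)) y)%:E|)%E =
      (\int[leb]_(y in ball x r) `|v y - v x|%:E)%E.
    apply: eq_integral => y /[!inE] /bab yab; rewrite /= !patchE (mem_set yab).
    by rewrite (mem_set (xab : `]a, b[%classic x)).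
  apply: ge0_subset_integral => //; first exact: measurable_ball.
    apply/measurable_EFinP; apply: measurableT_comp => //; apply: measurable_funB => //.
    by apply: measurable_funS mv.
  by move=> y; rewrite ball_itv/= !in_itv/= => /andP[? ?]; apply/andP; split; lra.
- exact: cvg_cst.
- by rewrite -(mule0 2%:E); apply: cvgeZl.
Unshelve. all: by end_near. Qed.

End one_sided_limits.

Section sbv_structure.
Context {R : realType}.
Local Notation leb := (@lebesgue_measure R).
Variables (a b : R) (u f : R -> R).
Hypothesis iu : leb.-integrable `]a, b[ (EFin \o u).
Hypothesis uf : sbv_derivative a b u f.
Hypothesis finS : finite_set (jump_set a b u).
Let S := jump_set a b u.
Let J x := rtrace u x - ltrace u x.

Let mI : measurable (`]a, b[ : set R) := measurable_itv _.

Let intf : leb.-integrable `]a, b[ (EFin \o f).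
Proof. by have [] := uf. Qed.

Let measu : measurable_fun `]a, b[ u.
Proof. by apply/measurable_EFinP; case/integrableP : iu. Qed.

Let measf : measurable_fun `]a, b[ f.
Proof. by apply/measurable_EFinP; case/integrableP : intf. Qed.

Lemma jump_free_nbhs x : a < x < b -> exists d, [/\ 0 < d, a <= x - d, x + d <= b
  & forall y, x - d < y < x + d -> S y -> y = x].
Proof.
move=> /andP[ax xb].
have oS : open (~` (S `\ x)).
  have /accessible_finite_set_closed cl := hausdorff_accessible (@Rhausdorff R).
  by apply: closed_openC; apply: cl; exact: finite_setD.
have Sx : (~` (S `\ x)) x by move=> [_ /=].
have /nbhs_ballP[e /= e0 He] : nbhs x (~` (S `\ x)) by exact: open_nbhs_nbhs.
exists (Num.min e (Num.min (x - a) (b - x))); split.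
- by rewrite !lt_min e0 !subr_gt0 ax.
- have : Num.min e (Num.min (x - a) (b - x)) <= x - a by rewrite !ge_min lexx orbT.
  lra.
- have : Num.min e (Num.min (x - a) (b - x)) <= b - x by rewrite !ge_min lexx !orbT.
  lra.
- move=> y yx Sy; apply: contrapT => ynx; apply: (He y); last by split.
  have me : Num.min e (Num.min (x - a) (b - x)) <= e by rewrite ge_min lexx.
  rewrite /ball/= ltr_distlC; move: yx => /andP[? ?]; apply/andP; split; lra.
Qed.

Lemma sbv_test (phi dphi : R -> R) (c d : R) : a < c -> d < b ->
  (forall x : R, is_derive x 1 phi (dphi x)) -> continuous dphi ->
  (forall x, ~ (c <= x <= d) -> phi x = 0) ->
  \int[leb]_(x in `]a, b[) (u x * dphi x) =
  - (\int[leb]_(x in `]a, b[) (f x * phi x) + \int[@counting R R]_(x in S) (J x * phi x)).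
Proof.
move=> ac db dp cdp sp; have [_ _ H] := uf.
have E : derive1 phi = dphi.
  by apply/funext => x; rewrite derive1E; have [_ ->] := dp x.
rewrite -E; apply: H; split; [by move=> x; have [] := dp x|by rewrite E|].
exists `[c, d]%classic; split; first exact: segment_compact.
- by move=> x /=; rewrite !in_itv/= => /andP[cx xd]; rewrite (lt_le_trans ac)// (le_lt_trans xd).
- by move=> x nx; apply: sp => cxd; apply: nx; rewrite /= in_itv.
Qed.

Lemma Rintegral_kern_mul (v : R -> R) (r p : R) : 0 < r -> a <= p -> p + r <= b ->
  \int[leb]_(x in `]a, b[) (v x * kern r p x) =
  \int[leb]_(x in `]p, (p + r)[) (v x * kern r p x).
Proof.
move=> r0 ap pb.
have -> : (`]p, (p + r)[ = `]a, b[ `&` `]p, (p + r)[)%classic.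
  by apply/esym/setIidr; apply: subset_itv; rewrite bnd_simp.
rewrite Rintegral_mkcondr; apply: eq_Rintegral => x _; rewrite patchE.
by case: ifPn => //; rewrite notin_setE => xp; rewrite kern_eq0 ?mulr0// => /xp.
Qed.

Let fI := f \_ `]a, b[.

Let intfI : leb.-integrable setT (EFin \o fI).
Proof.
by have := (integrable_mkcond (mu := leb) (EFin \o f) mI).1 intf; rewrite restrict_EFin.
Qed.

Definition primitive y := \int[leb]_(t in `]a, y]) fI t.
Local Notation F := primitive.

Let intfS (D : set R) : measurable D -> leb.-integrable D (EFin \o fI).
Proof. by move=> mD; apply: integrableS intfI. Qed.

Lemma primitiveB p q : a <= p -> p <= q -> F q - F p = \int[leb]_(t in `]p, q]) fI t.
Proof.
move=> ap pq; apply: Rintegral_itvB; rewrite ?bnd_simp//.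
exact: intfS.
Qed.

Lemma primitive_continuous x : a < x -> F y @[y --> x] --> F x.
Proof.
move=> ax; apply/cvgrPdist_lt => e e0.
have [d [d0 Hd]] := integral_normr_continuous intfI e0.
near=> y; have ya : a < y by near: y; exact: lt_nbhsr.
have yx : `|x - y| < d by near: y; apply/nbhs_ballP; exists d.
have key p q : a < p -> p <= q -> `|p - q| < d -> `|F q - F p| < e.
  move=> ap pq pqd; rewrite primitiveB ?(ltW ap)//.
  apply: (le_lt_trans (@le_normr_Rintegral _ _ _ leb _ _ (measurable_itv _) (intfS (measurable_itv _)))).
  have pqd' : (leb `]p, q]%classic < d%:E)%E.
    rewrite lebesgue_measure_itv/=; case: ifPn => _; last by rewrite lte_fin.
    by rewrite -EFinB lte_fin (le_lt_trans (ler_norm _))// distrC.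
  exact: (Hd _ (measurable_itv _) pqd').
by have [xy|/ltW yx'] := leP x y; [rewrite distrC key|rewrite key// distrC].
Unshelve. all: by end_near. Qed.

Lemma local_ftc c d p q l l' : a <= c -> d <= b -> (forall y, c < y < d -> ~ S y) ->
  c < p -> p < q -> q < d -> rtrace_spec u p l -> rtrace_spec u q l' ->
  l' - l = F q - F p.
Proof.
move=> ac db Scd cp pq qd ul ul'.
pose e := Num.min (q - p) (d - q) / 2.
have e0 : 0 < e by rewrite divr_gt0// lt_min !subr_gt0 pq.
have e1 : 2 * e <= q - p by rewrite mulrCA divff// mulr1 ge_min lexx.
have e2 : 2 * e <= d - q by rewrite mulrCA divff// mulr1 ge_min lexx orbT.
have [r [r0 re rc]] := vanishing_seq e0.
pose phi n x := ramp (r n) p x - ramp (r n) q x.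
pose dphi n x := kern (r n) p x - kern (r n) q x.
have dp n (x : R) : is_derive x 1 (phi n) (dphi n x).
  exact: (is_deriveB (is_derive_ramp (r n) p x) (is_derive_ramp (r n) q x)).
have phi0 n x : ~ (p <= x <= q + e) -> phi n x = 0.
  move=> px; rewrite /phi; have := re n; have := r0 n => rn0 rne.
  have [xp|px'] := leP x p; first by rewrite !ramp0 ?subrr//; lra.
  have qex : q + e < x by rewrite ltNge; apply/negP => xq; apply: px; rewrite (ltW px').
  by rewrite !ramp1 ?subrr//; lra.
have T n : \int[leb]_(x in `]a, b[) (u x * dphi n x) = - \int[leb]_(x in `]a, b[) (f x * phi n x).
  rewrite (@sbv_test (phi n) (dphi n) p (q + e)) //; [|lra|lra|by move=> x; apply: cvgB; exact: kern_continuous|exact: phi0].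
  rewrite (_ : \int[_]_(x in S) _ = 0) ?addr0//.
  rewrite -[RHS](Rintegral_set0 (@counting R R) (fun=> 0)) /Rintegral; congr fine.
  rewrite integral_set0; apply: integral0_eq => x Sx; rewrite phi0 ?mulr0// => /andP[px xq].
  apply: (Scd x) => //; apply/andP; split; lra.
have sub1 n : `]p, (p + r n)[ `<=` `]a, b[ by apply: subset_itv; rewrite bnd_simp; have := re n; lra.
have sub2 n : `]q, (q + r n)[ `<=` `]a, b[ by apply: subset_itv; rewrite bnd_simp; have := re n; lra.
have mk n s : measurable_fun `]a, b[ (kern (r n) s).
  by apply: measurable_funTS; exact: (continuous_measurable_fun (@kern_continuous R _ _)).
have bk n s x : `]a, b[%classic x -> `|kern (r n) s x| <= 2 / r n.
  by move=> _; have /andP[k0 k2] := kern_bnd s x (r0 n); rewrite ger0_norm.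
have L n : \int[leb]_(x in `]a, b[) (u x * dphi n x) =
    \int[leb]_(x in `]p, (p + r n)[) (u x * kern (r n) p x) -
    \int[leb]_(x in `]q, (q + r n)[) (u x * kern (r n) q x).
  rewrite -!Rintegral_kern_mul//; try (have := re n; lra).
  rewrite -RintegralB//.
  - by apply: eq_Rintegral => x _; rewrite mulrBr.
  - exact: (integrable_mul_bounded leb mI iu (mk n p) (bk n p)).
  - exact: (integrable_mul_bounded leb mI iu (mk n q) (bk n q)).
have cL : \int[leb]_(x in `]a, b[) (u x * dphi n x) @[n --> \oo] --> l - l'.
  under eq_fun do rewrite L.
  have sr := seq_at_right r0 rc.
  apply: cvgB; apply: kern_limit => //.
  - by move=> n; apply: integrableS iu.
  - exact: (cvg_comp _ _ sr ul).
  - by move=> n; apply: integrableS iu.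
  - exact: (cvg_comp _ _ sr ul').
have mphi n : measurable_fun `]a, b[ (phi n).
  apply: measurable_funTS; apply: continuous_measurable_fun => x.
  by apply: differentiable_continuous; apply/derivable1_diffP; have [] := dp n x.
have phi1 n x : `|phi n x| <= 1.
  rewrite /phi; have /andP[? ?] := ramp_bnd (r n) p x; have /andP[? ?] := ramp_bnd (r n) q x.
  by rewrite ler_norml; apply/andP; split; lra.
have [||||| _ cR] := dominated_Rcvg leb mI (f_ := fun n x => f x * phi n x)
    (f := f \_ `]p, q]) (g := fun x => `|f x|).
- by move=> n; exact: (measurable_funM measf (mphi n)).
- by apply/measurable_restrict => //; apply: measurable_funS measf.
- move=> x _; rewrite patchE; have [xpq|xpq] := boolP (x \in `]p, q]%classic).
    move: (xpq); rewrite inE/= in_itv/= => /andP[px xq].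
    have [N _ HN] : \forall n \near \oo, r n < x - p.
      by have /cvgrPdist_lt/(_ (x - p)) := rc; rewrite subr_gt0 => /(_ px); apply: filterS => n;
        rewrite sub0r normrN ger0_norm// ltW.
    apply: cvg_near_cst; exists N => // n /= /HN rx.
    by rewrite /phi ramp1 ?ramp0 ?subr0 ?mulr1//; lra.
  have [xp|px] := leP x p.
    apply: cvg_near_cst; apply: nearW => n; rewrite /phi !ramp0 ?subrr ?mulr0//.
    exact: le_trans xp (ltW pq).
  have qx : q < x.
    by rewrite ltNge; apply/negP => xq; move: xpq; rewrite notin_setE/= in_itv/= px.
  have [N _ HN] : \forall n \near \oo, r n < x - q.
    by have /cvgrPdist_lt/(_ (x - q)) := rc; rewrite subr_gt0 => /(_ qx); apply: filterS => n;
      rewrite sub0r normrN ger0_norm// ltW.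
  apply: cvg_near_cst; exists N => // n /= /HN rx.
  by rewrite /phi !ramp1 ?subrr ?mulr0//; lra.
- exact: (integrable_norm intf).
- by move=> n x _; rewrite normrM ler_piMr.
have : \int[leb]_(x in `]a, b[) (u x * dphi n x) @[n --> \oo] --> - \int[leb]_(x in `]a, b[) ((f \_ `]p, q]) x).
  by under eq_fun do rewrite T; apply: cvgN.
move=> /(cvg_unique _ cL) => /(_ (@Rhausdorff R)) lE.
rewrite primitiveB ?ltW//; last by lra.
rewrite -(opprB l l') lE opprK -Rintegral_mkcondr.
have -> : (`]a, b[ `&` `]p, q] = `]p, q])%classic.
  by apply/setIidr; apply: subset_itv; rewrite bnd_simp; lra.
apply: eq_Rintegral => x; rewrite inE/= in_itv/= => /andP[px xq].
by rewrite /fI patchE mem_set//= in_itv/=; apply/andP; split; lra.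
Qed.

Lemma component_primitive c d : a <= c -> c < d -> d <= b -> (forall y, c < y < d -> ~ S y) ->
  exists K, {ae leb, forall y, `]c, d[%classic y -> u y = K + F y}.
Proof.
move=> ac cd db Scd; have ae := ae_rtrace_spec iu.
have sub : `]c, d[ `<=` `]a, b[ by apply: subset_itv; rewrite bnd_simp.
have [p pcd up] := ae_ex cd ae; have {}up := up (sub _ pcd).
move: pcd; rewrite in_itv/= => /andP[cp pd].
exists (u p - F p); apply: ae_imply ae => q uq qcd; have {}uq := uq (sub _ qcd).
move: qcd; rewrite /= in_itv/= => /andP[cq qd].
have [pq|qp|->] := ltgtP p q; last by rewrite subrK.
  by have := local_ftc ac db Scd cp pq qd up uq; lra.
by have := local_ftc ac db Scd cq qp pd uq up; lra.
Qed.

Lemma component_traces c d : a <= c -> c < d -> d <= b -> (forall y, c < y < d -> ~ S y) ->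
  exists K, [/\ {ae leb, forall y, `]c, d[%classic y -> u y = K + F y},
    forall x, a < x < b -> c <= x < d -> rtrace_spec u x (K + F x) /\ rtrace u x = K + F x
  & forall x, a < x < b -> c < x <= d -> ltrace_spec u x (K + F x) /\ ltrace u x = K + F x].
Proof.
move=> ac cd db Scd; have [K HK] := component_primitive ac cd db Scd.
exists K; split => // x /andP[ax xb] /andP[cx xd].
- have d0 : 0 < d - x by lra.
  have sub : `]x, (x + (d - x))[ `<=` `]c, d[ by apply: subset_itv; rewrite bnd_simp; lra.
  have mu : measurable_fun `]x, (x + (d - x))[ u.
    by apply: measurable_funS measu => //; apply: subset_itv; rewrite bnd_simp; lra.
  have ul : rtrace_spec u x (K + F x).
    apply: (rtrace_spec_ae (w := fun y => K + F y) d0 mu).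
      by apply: ae_imply HK => y uy /sub/uy.
    apply: cvg_at_right_filter; apply: cvgD; first exact: cvg_cst.
    exact: primitive_continuous.
  by split => //; exact: (rtraceE d0 mu).
- have d0 : 0 < x - c by lra.
  have sub : `](x - (x - c)), x[ `<=` `]c, d[ by apply: subset_itv; rewrite bnd_simp; lra.
  have mu : measurable_fun `](x - (x - c)), x[ u.
    by apply: measurable_funS measu => //; apply: subset_itv; rewrite bnd_simp; lra.
  have ul : ltrace_spec u x (K + F x).
    apply: (ltrace_spec_ae (w := fun y => K + F y) d0 mu).
      by apply: ae_imply HK => y uy /sub/uy.
    apply: cvg_at_left_filter; apply: cvgD; first exact: cvg_cst.
    exact: primitive_continuous.
  by split => //; exact: (ltraceE d0 mu).
Qed.

Lemma traces_exist x : a < x < b ->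
  ltrace_spec u x (ltrace u x) /\ rtrace_spec u x (rtrace u x).
Proof.
move=> /[dup] xab /jump_free_nbhs[d [d0 ad db Sd]]; split.
- have xd : x - d < x by lra.
  have [||||K [_ _ /(_ x xab)]] := @component_traces (x - d) x; try lra.
    by move=> y /andP[dy yx] /Sd; lra.
  by rewrite xd lexx => /(_ isT)[ul ->].
- have xd : x < x + d by lra.
  have [||||K [_ /(_ x xab)+ _]] := @component_traces x (x + d); try lra.
    by move=> y /andP[dy yx] /Sd; lra.
  by rewrite xd lexx => /(_ isT)[ul ->].
Qed.

Lemma jump_setP x : a < x < b -> S x <-> ltrace u x <> rtrace u x.
Proof.
move=> /[dup] xab /andP[ax xb]; have [ul ur] := traces_exist xab.
have [d [d0 ad db _]] := jump_free_nbhs xab.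
have sub (s t : R) : x - d <= s -> t <= x + d -> measurable_fun `]s, t[ u.
  by move=> ? ?; apply: measurable_funS measu => //; apply: subset_itv; rewrite bnd_simp; lra.
have mu : measurable_fun `](x - d), (x + d)[ u by apply: sub; lra.
split=> [[_ nl] lr|lr].
  have [_ ulr] := approx_limit_traces (ltrace u x) d0 mu.
  by apply: nl; exists (ltrace u x); apply: ulr; split; [exact: ul|rewrite lr; exact: ur].
split; first by rewrite in_itv/= ax.
move=> [l /(approx_limit_traces _ d0 mu)[ull ulr]]; apply: lr.
rewrite (ltraceE d0 _ ull); last by apply: sub; lra.
by rewrite (rtraceE d0 _ ulr)//; apply: sub; lra.
Qed.

Lemma trace_increment x y : a < x -> x < y -> y < b -> (forall z, x < z < y -> ~ S z) ->
  ltrace u y - rtrace u x = F y - F x.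
Proof.
move=> ax xy yb Sxy.
have [K [_ /(_ x)+ /(_ y)]] := component_traces (ltW ax) xy (ltW yb) Sxy.
rewrite ax yb xy !lexx (lt_trans xy yb) (lt_trans ax xy) => /(_ isT isT)[_ ->] /(_ isT isT)[_ ->].
by rewrite opprD addrACA subrr add0r.
Qed.

End sbv_structure.

Section coincidence.
Context {R : realType}.
Local Notation leb := (@lebesgue_measure R).

Lemma Rintegral_cst_itvoo (x y c : R) : x <= y ->
  \int[leb]_(t in `]x, y[) c = c * (y - x).
Proof.
move=> xy; rewrite Rintegral_cst//; congr (_ * _).
have H : leb `]x, y[%classic = (y - x)%:E; last exact: (congr1 fine H).
rewrite lebesgue_measure_itv/= lte_fin -EFinB; case: ltP => // yx.
by rewrite (_ : y = x) ?subrr//; apply/eqP; rewrite eq_le yx.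
Qed.

Lemma trace_average (v : R -> R) (x l : R) (r : nat -> R) :
  (forall n, 0 < r n) ->
  (forall n, leb.-integrable `]x, (x + r n)[ (EFin \o v)) ->
  scaled_dev v l (r n) `]x, (x + r n)[ @[n --> \oo] --> 0%E ->
  (r n)^-1 * \int[leb]_(y in `]x, (x + r n)[) v y @[n --> \oo] --> l.
Proof.
move=> r0 iv /fine_cvgP[_ dev0].
have mI n : measurable `]x, (x + r n)[%classic by exact: measurable_itv.
have fin n : (leb `]x, (x + r n)%R[%classic < +oo)%E.
  by rewrite lebesgue_measure_itv/=; case: ifPn => _; rewrite ltry.
have il n : leb.-integrable `]x, x + r n[ (EFin \o cst l).
  exact: (@bounded_fun_integrable _ _ _ leb _ (mI n) (cst l) `|l| (fin n)).
have ivl n := integrable_sub leb (mI n) (iv n) (il n).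
have lE n : l = (r n)^-1 * \int[leb]_(y in `]x, (x + r n)[) l.
  rewrite Rintegral_cst_itvoo ?lerDl ?ltW//.
  by rewrite [x + _]addrC addrK mulrC mulfK// gt_eqF.
have E n : `|(r n)^-1 * \int[leb]_(y in `]x, (x + r n)[) v y - l| <=
    fine (scaled_dev v l (r n) `]x, x + r n[).
  rewrite {1}(lE n) -mulrBr -RintegralB// normrM gtr0_norm ?invr_gt0//.
  rewrite /scaled_dev fineM//; last exact: integrable_fin_num (integrable_norm (ivl n)).
  by rewrite ler_pM2l ?invr_gt0//; apply: le_normr_Rintegral.
apply/subr_cvg0; apply: norm_cvg0.
apply: (@squeeze_cvgr _ _ _ _ (cst 0) (fun n => fine (scaled_dev v l (r n) `]x, x + r n[))).
- by apply: nearW => n; rewrite normr_ge0 E.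
- exact: cvg_cst.
- exact: dev0.
Qed.

Lemma countable_right_isolated (Z : set R) :
  countable [set x | Z x /\ exists2 d, 0 < d & forall y, x < y < x + d -> ~ Z y].
Proof.
set I := [set x | _].
have /choice[q qI] : forall x, exists q : rat, I x ->
    x < ratr q /\ forall y, x < y -> Z y -> ratr q < y.
  move=> x; have [[Zx [d d0 dZ]]|nI] := pselect (I x); last by exists 0.
  have xd : x < x + d by rewrite ltrDl.
  have [q] := rat_in_itvoo xd; rewrite in_itv/= => /andP[xq qd].
  exists q => _; split => // y xy Zy; rewrite ltNge; apply/negP => yq.
  by apply: (dZ y) => //; rewrite xy (le_lt_trans yq).
apply/countable_injP; exists (fun x => pickle (q x)) => x y.
rewrite !inE => Ix Iy /(pcan_inj pickleK) qxy.
have [xq xZ] := qI _ Ix; have [yq yZ] := qI _ Iy.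
have [xy|yx|//] := ltgtP x y.
  have := xZ _ xy (proj1 Iy); rewrite qxy => /lt_trans/(_ yq).
  by rewrite ltxx.
have := yZ _ yx (proj1 Ix); rewrite -qxy => /lt_trans/(_ xq).
by rewrite ltxx.
Qed.

Lemma ae_notin_countable (A : set R) : countable A -> {ae leb, forall x, ~ A x}.
Proof.
move=> cA; exists A; split; first exact: countable_measurable.
- exact: countable_lebesgue_measure0.
- by move=> x /contrapT.
Qed.

Lemma Rintegral_sbv_derivative (a b : R) (u f : R -> R) (x y : R) :
  leb.-integrable `]a, b[ (EFin \o u) -> sbv_derivative a b u f ->
  finite_set (jump_set a b u) -> a < x -> x < y -> y < b -> ~ jump_set a b u x ->
  (forall z : R, x < z < y -> ~ jump_set a b u z) ->
  \int[leb]_(t in `]x, y[) f t = ltrace u y - ltrace u x.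
Proof.
move=> iu uf fS ax xy yb nx nz.
have fi : leb.-integrable `]a, b[ (EFin \o f) by have [] := uf.
have xab : a < x < b by rewrite ax (lt_trans xy yb).
have lr : ltrace u x = rtrace u x.
  by apply: contrapT => /(jump_setP iu uf fS xab).
rewrite lr (trace_increment iu uf ax xy yb nz) (primitiveB uf (ltW ax) (ltW xy)).
have fi' : leb.-integrable setT (EFin \o (f \_ `]a, b[)).
  by have := (integrable_mkcond (mu := leb) (EFin \o f) (measurable_itv _)).1 fi; rewrite restrict_EFin.
rewrite -(@Rintegral_itv_bndo_bndc _ (BRight x) y); last by apply: integrableS fi'.
apply: eq_Rintegral => t; rewrite inE/= in_itv/= => /andP[xt ty].
by rewrite patchE mem_set//= in_itv/= (lt_trans ax xt) (lt_trans ty yb).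
Qed.

Lemma no_jump_right (S : set R) (x y d : R) : y <= x + d -> ~ S x ->
  (forall z : R, x - d < z < x + d -> S z -> z = x) ->
  forall z : R, x < z < y -> ~ S z.
Proof.
move=> yd nx free z /andP[xz zy] Sz; apply: nx; rewrite -(free z)//.
by apply/andP; split; lra.
Qed.

Lemma sbv_derivative_coincide (a b : R) (u1 u2 f1 f2 : R -> R) :
  leb.-integrable `]a, b[ (EFin \o u1) -> leb.-integrable `]a, b[ (EFin \o u2) ->
  sbv_derivative a b u1 f1 -> sbv_derivative a b u2 f2 ->
  finite_set (jump_set a b u1) -> finite_set (jump_set a b u2) ->
  {ae leb, forall x, a < x < b -> ~ jump_set a b u1 x -> ~ jump_set a b u2 x ->
     ltrace u1 x = ltrace u2 x -> f1 x = f2 x}.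
Proof.
move=> iu1 iu2 uf1 uf2 fS1 fS2.
have if1 : leb.-integrable `]a, b[ (EFin \o f1) by have [] := uf1.
have if2 : leb.-integrable `]a, b[ (EFin \o f2) by have [] := uf2.
pose v x := f1 x - f2 x.
have iv : leb.-integrable `]a, b[ (EFin \o v).
  exact: (integrable_sub leb (measurable_itv _) if1 if2).
pose Z : set R := [set x | [/\ a < x < b, ~ jump_set a b u1 x, ~ jump_set a b u2 x
  & ltrace u1 x = ltrace u2 x]].
have := ae_and (ae_rtrace_spec iv) (ae_notin_countable (countable_right_isolated Z)).
apply: ae_imply => x [xv xI] xab n1 n2 l12.
have Zx : Z x by [].
have {}xv : rtrace_spec v x (v x) by apply: xv; rewrite /= in_itv.
have acc (d : R) : 0 < d -> exists2 y : R, x < y < x + d & Z y.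
  move=> d0; apply: contrapT => nex; apply: xI; split => //; exists d => // y xyd Zy.
  by apply: nex; exists y.
have [d1 [d10 _ db1 free1]] := jump_free_nbhs fS1 xab.
have [d2 [d20 _ db2 free2]] := jump_free_nbhs fS2 xab.
have [e [e0 e1 e2]] : exists e : R, [/\ 0 < e, e <= d1 & e <= d2].
  by exists (Num.min d1 d2); rewrite lt_min d10 d20 !ge_min !lexx orbT.
have [s [s0 se sc]] := vanishing_seq e0.
have /choice[y Hy] : forall n, exists y : R, x < y < x + s n /\ Z y.
  by move=> n; have [y ? ?] := acc _ (s0 n); exists y.
pose r n := y n - x.
have xr n : x + r n = y n by rewrite /r addrC subrK.
have r0 n : 0 < r n by rewrite subr_gt0; have [/andP[]] := Hy n.
have rs n : r n <= s n by rewrite lerBlDl ltW//; have [/andP[]] := Hy n.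
have rc : r n @[n --> \oo] --> (0 : R).
  apply: (@squeeze_cvgr _ _ _ _ (cst 0) s) => //; last exact: cvg_cst.
  by apply: nearW => n; rewrite rs ltW.
have [ax xb] := andP xab.
have yb n : y n < b.
  by have [/andP[_ h] _] := Hy n; rewrite (lt_le_trans h)// (le_trans _ db1)// lerD2l (le_trans (se n)).
have sub n : `]x, (x + r n)[ `<=` `]a, b[.
  by apply: subset_itv; rewrite bnd_simp ?ltW// xr.
have ivn n : leb.-integrable `]x, (x + r n)[ (EFin \o v) by apply: integrableS iv.
have lim := trace_average r0 ivn (cvg_comp _ _ (seq_at_right r0 rc) xv).
suff int0 n : \int[leb]_(t in `]x, (x + r n)[) v t = 0.
  move: lim; under eq_fun do rewrite int0 mulr0.
  move=> /(cvg_unique (@Rhausdorff R) (cvg_cst 0)) /esym/eqP.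
  by rewrite subr_eq0 => /eqP.
have [/andP[xy yxs] [yab y1 y2 y12]] := Hy n.
have nS (u : R -> R) (d : R) : e <= d -> ~ jump_set a b u x ->
    (forall z : R, x - d < z < x + d -> jump_set a b u z -> z = x) ->
    forall z : R, x < z < y n -> ~ jump_set a b u z.
  by move=> ed; apply: no_jump_right; rewrite (le_trans (ltW yxs))// lerD2l (le_trans (se n)).
rewrite xr RintegralB//; last 2 first.
- by rewrite -xr; apply: integrableS if1.
- by rewrite -xr; apply: integrableS if2.
rewrite (Rintegral_sbv_derivative iu1 uf1 fS1 ax xy (yb n) n1 (nS u1 d1 e1 n1 free1)).
rewrite (Rintegral_sbv_derivative iu2 uf2 fS2 ax xy (yb n) n2 (nS u2 d2 e2 n2 free2)).
by rewrite y12 l12 subrr.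
Qed.

Lemma sbv_derivative_ae_unique (a b : R) (u f1 f2 : R -> R) :
  leb.-integrable `]a, b[ (EFin \o u) ->
  sbv_derivative a b u f1 -> sbv_derivative a b u f2 ->
  finite_set (jump_set a b u) ->
  {ae leb, forall x, a < x < b -> f1 x = f2 x}.
Proof.
move=> iu uf1 uf2 fS.
have := ae_and (sbv_derivative_coincide iu iu uf1 uf2 fS fS)
  (ae_notin_countable (finite_set_countable fS)).
by apply: ae_imply => x [f12 nS] xab; exact: f12.
Qed.

End coincidence.

Section half_interval.
Context {R : realType}.
Local Notation leb := (@lebesgue_measure R).

Lemma continuous_itv_bounded (g : R -> R) (a b : R) : continuous g ->
  exists C, forall x, a <= x <= b -> `|g x| <= C.
Proof.
move=> cg; have [ab|ba] := leP a b; last first.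
  by exists 0 => x /andP[ax xb]; have := le_trans ax xb; rewrite leNgt ba.
have cn : {within `[a, b], continuous (fun x => `|g x|)}.
  apply: continuous_subspaceT => x.
  by apply: (@continuous_comp _ _ _ g (fun y : R => `|y|)); [exact: cg|exact: norm_continuous].
have [c _ cmax] := EVT_max ab cn.
by exists `|g c| => x xab; apply: cmax; rewrite in_itv.
Qed.

Variables (a b : R) (u f : R -> R).
Hypothesis iu : leb.-integrable `]a, b[ (EFin \o u).
Hypothesis uf : sbv_derivative a b u f.
Hypothesis finS : finite_set (jump_set a b u).
Let S := jump_set a b u.
Let J x := rtrace u x - ltrace u x.

Let mI : measurable (`]a, b[ : set R) := measurable_itv _.

Lemma half_interval_test (phi dphi : R -> R) (c0 d0 c : R) : a < c0 -> d0 < b ->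
  (forall x : R, is_derive x 1 phi (dphi x)) -> continuous dphi ->
  (forall x, ~ (c0 <= x <= d0) -> phi x = 0) -> a < c < b ->
  \int[leb]_(x in `]a, c[) (u x * dphi x) = phi c * ltrace u c -
  (\int[leb]_(x in `]a, c[) (f x * phi x) +
   \int[@counting R R]_(x in S `&` `]-oo, c[%classic) (J x * phi x)).
Proof.
move=> ac0 d0b dp cdp sp cab; have [ac cb] := andP cab.
have cphi : continuous phi.
  by move=> x; apply: differentiable_continuous; apply/derivable1_diffP; have [] := dp x.
have [d [dgt0 ad db free]] := jump_free_nbhs finS cab.
have [r [r0 rd rc]] := vanishing_seq dgt0.
pose p n := c - r n.
pose chi n x := 1 - ramp (r n) (p n) x.
pose psi n x := phi x * chi n x.
pose dpsi n x := dphi x * chi n x - phi x * kern (r n) (p n) x.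
have ccx : c - d < c by lra.
have Scd y : c - d < y < c -> ~ S y.
  move=> /andP[dy yc] /free yE; suff : y = c by move=> e; rewrite e ltxx in yc.
  by apply: yE; rewrite dy/=; lra.
have [K [Kae _ Ktr]] := component_traces iu uf ad ccx (ltW cb) Scd.
have lc : ltrace u c = K + primitive a b f c.
  by have [|_ ->//] := Ktr c cab; rewrite ccx lexx.
have chi1 n x : x <= p n -> chi n x = 1 by move=> xp; rewrite /chi ramp0 ?subr0.
have chi0 n x : c <= x -> chi n x = 0 by move=> cx; rewrite /chi ramp1 ?subrr// /p subrK.
have chib n x : `|chi n x| <= 1.
  by rewrite /chi; have /andP[? ?] := ramp_bnd (r n) (p n) x; rewrite ger0_norm; lra.
have dchi n (x : R) : is_derive x 1 (chi n) (- kern (r n) (p n) x).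
  have := is_deriveB (is_derive_cst (1 : R) x (1 : R)) (is_derive_ramp (r n) (p n) x).
  by rewrite sub0r.
have ck n : continuous (kern (r n) (p n)) by exact: kern_continuous.
have cchi n : continuous (chi n).
  by move=> x; apply: differentiable_continuous; apply/derivable1_diffP; have [] := dchi n x.
have dps n (x : R) : is_derive x 1 (psi n) (dpsi n x).
  have := is_deriveM (dp x) (dchi n x) => H; apply: (is_derive_eq H).
  by rewrite /dpsi /GRing.scale/=; ring.
have cdps n : continuous (dpsi n).
  move=> x; apply: cvgB; apply: cvgM; by [exact: cdp|exact: cchi|exact: cphi|exact: ck].
have psi0 n x : ~ (c0 <= x <= d0) -> psi n x = 0 by move=> /sp; rewrite /psi => ->; rewrite mul0r.
have T n := sbv_test uf ac0 d0b (dps n) (cdps n) (psi0 n).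
have [Cp Hp] := continuous_itv_bounded a b cphi.
have [Cd Hd] := continuous_itv_bounded a b cdp.
have mcont (g : R -> R) : continuous g -> measurable_fun `]a, b[ g.
  by move=> cg; apply: measurable_funTS; exact: continuous_measurable_fun.
have inI x : `]a, b[%classic x -> a <= x <= b by rewrite /= in_itv/= => /andP[/ltW-> /ltW->].
have intf : leb.-integrable `]a, b[ (EFin \o f) by have [] := uf.
have iuphi : leb.-integrable `]a, b[ (EFin \o (fun x => u x * phi x)).
  by apply: (integrable_mul_bounded leb mI iu (mcont _ cphi) (C := Cp)) => x /inI/Hp.
have iudphi : leb.-integrable `]a, b[ (EFin \o (fun x => u x * dphi x)).
  by apply: (integrable_mul_bounded leb mI iu (mcont _ cdp) (C := Cd)) => x /inI/Hd.
have ifphi : leb.-integrable `]a, b[ (EFin \o (fun x => f x * phi x)).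
  by apply: (integrable_mul_bounded leb mI intf (mcont _ cphi) (C := Cp)) => x /inI/Hp.
have iuphik n : leb.-integrable `]a, b[ (EFin \o (fun x => u x * phi x * kern (r n) (p n) x)).
  apply: (integrable_mul_bounded leb mI iuphi (mcont _ (ck n)) (C := 2 / r n)) => x _.
  by have /andP[k0 k2] := kern_bnd (p n) x (r0 n); rewrite ger0_norm.
have iuchi n : leb.-integrable `]a, b[ (EFin \o (fun x => u x * dphi x * chi n x)).
  exact: (integrable_mul_bounded leb mI iudphi (mcont _ (cchi n)) (fun x _ => chib n x)).
have ap n : a <= p n by rewrite /p; have := rd n; lra.
have pr n : p n + r n = c by rewrite /p subrK.
have subI : `]a, c[ `<=` `]a, b[ by apply: subset_itv; rewrite bnd_simp// ltW.
have Iab : (`]a, b[ `&` `]a, c[ = `]a, c[)%classic by apply/setIidr.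
have L n : \int[leb]_(x in `]a, b[) (u x * dpsi n x) =
    \int[leb]_(x in `]a, b[) (u x * dphi x * chi n x) -
    \int[leb]_(x in `]p n, (p n + r n)[) (u x * phi x * kern (r n) (p n) x).
  rewrite -(Rintegral_kern_mul (a := a) (b := b) (fun x => u x * phi x))//; last by rewrite pr ltW.
  rewrite -RintegralB//.
  by apply: eq_Rintegral => x _; rewrite /dpsi; ring.
have c1 : \int[leb]_(x in `]p n, (p n + r n)[) (u x * phi x * kern (r n) (p n) x)
    @[n --> \oo] --> ltrace u c * phi c.
  apply: kern_limit => //.
    by move=> n; apply: integrableS iuphi => //; apply: subset_itv; rewrite bnd_simp ?pr// ltW.
  have tr : ltrace_spec (fun x => u x * phi x) c (ltrace u c * phi c).
    apply: (ltrace_spec_ae (d := d) (w := fun x => (K + primitive a b f x) * phi x)) => //.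
    - apply: measurable_funS (_ : measurable_fun `]a, b[ _) => //.
        by apply: subset_itv; rewrite bnd_simp// ltW.
      by apply/measurable_EFinP; case/integrableP : iuphi.
    - by apply: ae_imply Kae => x ux /ux ->.
    - rewrite lc; apply: cvg_at_left_filter; apply: cvgM; last exact: cphi.
      by apply: cvgD; [exact: cvg_cst|exact: primitive_continuous uf _ ac].
  have := cvg_comp _ _ (seq_at_right r0 rc) tr.
  by apply: cvg_trans; under eq_fun do rewrite pr.
have chil x : chi n x @[n --> \oo] --> (\1_(`]-oo, c[%classic) x : R).
  have [xc|cx] := ltP x c.
    have [N _ HN] : \forall n \near \oo, r n < c - x.
      have /cvgrPdist_lt/(_ (c - x)) := rc; rewrite subr_gt0 => /(_ xc); apply: filterS => n.
      by rewrite sub0r normrN ger0_norm// ltW.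
    rewrite indicE mem_set//=; apply: cvg_near_cst; exists N => // n /= /HN rx.
    by rewrite chi1// /p; lra.
  rewrite indicE memNset/=; last by rewrite in_itv/= ltNge cx.
  by apply: cvg_near_cst; apply: nearW => n; rewrite chi0.
have restr (g : R -> R) : \int[leb]_(x in `]a, c[) g x =
    \int[leb]_(x in `]a, b[) (g x * \1_(`]-oo, c[%classic) x).
  rewrite -Iab Rintegral_mkcondr; apply: eq_Rintegral => x; rewrite inE/= in_itv/= => /andP[ax xb].
  rewrite patchE indicE; have [xc|cx] := ltP x c.
    by rewrite !mem_set ?mulr1//= in_itv/= ?ax.
  by rewrite !memNset ?mulr0//= in_itv/= [x < c]ltNge cx ?andbF.
have DC (g : R -> R) : leb.-integrable `]a, b[ (EFin \o g) ->
    \int[leb]_(x in `]a, b[) (g x * chi n x) @[n --> \oo] --> \int[leb]_(x in `]a, c[) g x.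
  move=> gi; rewrite restr.
  have mg : measurable_fun `]a, b[ g by apply/measurable_EFinP; case/integrableP : gi.
  have [|||||//] := dominated_Rcvg leb mI (f_ := fun n x => g x * chi n x)
    (f := fun x => g x * \1_(`]-oo, c[%classic) x) (g := fun x => `|g x|).
  - by move=> n; exact: (measurable_funM mg (mcont _ (cchi n))).
  - by apply: (measurable_funM mg); apply: measurable_indic.
  - by move=> x _; apply: cvgM; [exact: cvg_cst|exact: chil].
  - exact: (integrable_norm gi).
  - by move=> n x _; rewrite normrM ler_piMr.
have JE n : \int[@counting R R]_(x in S) (J x * psi n x) =
    \int[@counting R R]_(x in S `&` `]-oo, c[%classic) (J x * phi x).
  rewrite [RHS]Rintegral_mkcondr; apply: eq_Rintegral => x; rewrite inE => Sx.
  rewrite patchE; have [xc|cx] := ltP x c.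
    rewrite mem_set//= /psi chi1 ?mulr1//.
    rewrite leNgt; apply/negP => px; apply: (Scd x) => //; rewrite xc andbT.
    by move: px; rewrite /p; have := rd n; lra.
  by rewrite memNset/= ?in_itv/= ?ltNge ?cx// /psi chi0 ?mulr0.
have lim1 : \int[leb]_(x in `]a, b[) (u x * dpsi n x) @[n --> \oo] -->
    \int[leb]_(x in `]a, c[) (u x * dphi x) - ltrace u c * phi c.
  by under eq_fun do rewrite L; apply: cvgB; [exact: DC|exact: c1].
have lim2 : \int[leb]_(x in `]a, b[) (u x * dpsi n x) @[n --> \oo] -->
    - (\int[leb]_(x in `]a, c[) (f x * phi x) +
   \int[@counting R R]_(x in S `&` `]-oo, c[%classic) (J x * phi x)).
  under eq_fun do rewrite T JE.
  apply: cvgN; apply: cvgD; last exact: cvg_cst.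
  have := DC _ ifphi; apply: cvg_trans; apply: near_eq_cvg; apply: nearW => n.
  by apply: eq_Rintegral => x _; rewrite /psi mulrA.
have E : \int[leb]_(x in `]a, c[) (u x * dphi x) - ltrace u c * phi c =
    - (\int[leb]_(x in `]a, c[) (f x * phi x) +
       \int[@counting R R]_(x in S `&` `]-oo, c[%classic) (J x * phi x)).
  exact: (cvg_unique (@Rhausdorff R) lim1 lim2).
rewrite [phi c * _]mulrC -E addrC subrK//.
Qed.

End half_interval.

Section counting_finite.
Context {R : realType}.

Lemma measurable_finite_set (F : set R) : finite_set F -> measurable F.
Proof. move=> /(@finite_set_countable R) cF. exact: countable_measurable cF. Qed.

Lemma counting_fin (F : set R) : finite_set F -> @counting R R F \is a fin_num.
Proof. by move=> fF; rewrite /counting asboolT. Qed.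

Lemma finite_counting_integrable (F : set R) (g : R -> R) : finite_set F ->
  (@counting R R).-integrable F (EFin \o g).
Proof.
move=> fF; have [C HC] : exists C, forall x, F x -> `|g x| <= C.
  have [s Fs] := (@finite_seqP R _).1 fF; exists (\sum_(y <- s) `|g y|) => x; rewrite Fs/= => xs.
  by rewrite (big_rem x)//= lerDl sumr_ge0.
apply: (bounded_fun_integrable (@counting R R) (measurable_finite_set fF) (C := C)) => //.
- by have := counting_fin fF; rewrite -ge0_fin_numE.
- move=> _ Y mY; apply: measurable_finite_set; exact: finite_setIl.
Qed.

Lemma Rintegral_counting_seq (s : seq R) (g : R -> R) : uniq s ->
  \int[@counting R R]_(x in [set` s]) g x = \sum_(x <- s) g x.
Proof.
elim: s => [|y s IH] /=; first by rewrite set_nil Rintegral_set0 big_nil.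
move=> /andP[ys us]; rewrite big_cons -IH//.
have -> : [set` y :: s] = [set y] `|` [set` s].
  apply/seteqP; split => x /=; rewrite inE.
    by move=> /orP[/eqP|]; [left|right].
  by move=> [->|->]; rewrite ?eqxx// orbT.
have fy : finite_set [set y] by exact: finite_set1.
have fs : finite_set [set` s] by exact: finite_seq.
rewrite (@Rintegral_setU _ _ _ (@counting R R)); first last.
- by apply/disj_setPS => x [/= -> ]; apply/negP.
- by apply: finite_counting_integrable; rewrite finite_setU.
- exact: measurable_finite_set.
- exact: measurable_finite_set.
congr (_ + _).
transitivity (\int[@counting R R]_(x in [set y]) g y).
  by apply: eq_Rintegral => x; rewrite inE => /= ->.
rewrite Rintegral_cst//.
have E : @counting R R [set y] = 1%E by rewrite /counting asboolT// fset_set1 finmap.cardfs1.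
by rewrite -[RHS]mulr1; congr (_ * _); exact: (congr1 fine E).
Qed.

Lemma Rintegral_counting (s : seq R) (S : set R) (g : R -> R) : uniq s ->
  S `<=` [set` s] -> (forall x, x \in s -> ~ S x -> g x = 0) ->
  \int[@counting R R]_(x in S) g x = \sum_(x <- s) g x.
Proof.
move=> us SF g0.
have -> : S = [set` s] `&` S by rewrite setIidr.
rewrite Rintegral_mkcondr -Rintegral_counting_seq//.
apply: eq_Rintegral => x; rewrite inE/= => Fx; rewrite patchE.
by case: ifPn => //; rewrite notin_setE => /(g0 _ Fx).
Qed.

End counting_finite.

Section gluing.
Context {R : realType}.
Local Notation leb := (@lebesgue_measure R).

Lemma not_jump_traces (a b : R) (u : R -> R) x : a < x < b -> measurable_fun `]a, b[ u ->
  ~ jump_set a b u x -> ltrace u x = rtrace u x.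
Proof.
move=> /andP[ax xb] mu nj.
have [l ul] : exists l, approx_limit_spec u x l.
  by apply: contrapT => nl; apply: nj; split => //; rewrite in_itv/= ax.
have [d [d0 da db]] : exists d : R, [/\ 0 < d, a <= x - d & x + d <= b].
  exists (Num.min (x - a) (b - x)); split.
  - by rewrite lt_min !subr_gt0 ax.
  - have : Num.min (x - a) (b - x) <= x - a by rewrite ge_min lexx.
    lra.
  - have : Num.min (x - a) (b - x) <= b - x by rewrite ge_min lexx orbT.
    lra.
have sub (s t : R) : x - d <= s -> t <= x + d -> measurable_fun `]s, t[ u.
  by move=> ? ?; apply: measurable_funS mu => //; apply: subset_itv; rewrite bnd_simp; lra.
have [] := (approx_limit_traces l d0 (sub _ _ (lexx _) (lexx _))).1 ul.
move=> /(ltraceE d0) -> //; last by apply: sub; lra.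
by move=> /(rtraceE d0) -> //; apply: sub; lra.
Qed.

Lemma jump_set_local (a b : R) (u v : R -> R) x (d : R) : 0 < d ->
  {in `](x - d), (x + d)[, u =1 v} -> jump_set a b u x <-> jump_set a b v x.
Proof.
move=> d0 uv; split => -[xI nl]; split => // -[l ll]; apply: nl; exists l.
  by apply: (approx_limit_spec_eq d0 _ ll) => y /uv.
exact: (approx_limit_spec_eq d0 uv).
Qed.

Definition glue (c : R) (u1 u2 : R -> R) x := if x < c then u1 x else u2 x.

Variables (c : R) (u1 u2 : R -> R).
Local Notation w := (glue c u1 u2).

Lemma glue_lt x : x < c -> w x = u1 x. Proof. by rewrite /glue => ->. Qed.

Lemma glue_ge x : c <= x -> w x = u2 x. Proof. by rewrite /glue leNgt => /negbTE ->. Qed.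

Lemma ltrace_glue_le x : x <= c -> ltrace w x = ltrace u1 x.
Proof.
move=> xc; apply: (ltrace_eq ltr01) => y; rewrite in_itv/= => /andP[_ yx].
by rewrite glue_lt// (lt_le_trans yx).
Qed.

Lemma ltrace_glue_gt x : c < x -> ltrace w x = ltrace u2 x.
Proof.
move=> cx; apply: (@ltrace_eq _ _ _ _ (x - c)); first by rewrite subr_gt0.
by move=> y; rewrite in_itv/= => /andP[xy yx]; rewrite glue_ge//; lra.
Qed.

Lemma rtrace_glue_lt x : x < c -> rtrace w x = rtrace u1 x.
Proof.
move=> cx; apply: (@rtrace_eq _ _ _ _ (c - x)); first by rewrite subr_gt0.
by move=> y; rewrite in_itv/= => /andP[xy yx]; rewrite glue_lt//; lra.
Qed.

Lemma rtrace_glue_ge x : c <= x -> rtrace w x = rtrace u2 x.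
Proof.
move=> xc; apply: (rtrace_eq ltr01) => y; rewrite in_itv/= => /andP[yx _].
by rewrite glue_ge// (le_trans xc)// ltW.
Qed.

Lemma jump_set_glue_lt (a b : R) x : x < c -> jump_set a b w x <-> jump_set a b u1 x.
Proof.
move=> xc; apply: (@jump_set_local _ _ _ _ _ (c - x)); first by rewrite subr_gt0.
by move=> y; rewrite in_itv/= => /andP[xy yx]; rewrite glue_lt//; lra.
Qed.

Lemma jump_set_glue_gt (a b : R) x : c < x -> jump_set a b w x <-> jump_set a b u2 x.
Proof.
move=> xc; apply: (@jump_set_local _ _ _ _ _ (x - c)); first by rewrite subr_gt0.
by move=> y; rewrite in_itv/= => /andP[xy yx]; rewrite glue_ge//; lra.
Qed.

Lemma finite_jump_set_glue (a b : R) : finite_set (jump_set a b u1) ->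
  finite_set (jump_set a b u2) -> finite_set (jump_set a b w).
Proof.
move=> f1 f2; apply: (@sub_finite_set _ _ ((jump_set a b u1 `|` jump_set a b u2) `|` [set c])).
  move=> x; have [xc /jump_set_glue_lt|cx /jump_set_glue_gt|->] := ltgtP x c; last by right.
    by move=> /(_ xc); left; left.
  by move=> /(_ cx); left; right.
by rewrite !finite_setU; split; [split|exact: finite_set1].
Qed.

Lemma integrable_glue (a b : R) : leb.-integrable `]a, b[ (EFin \o u1) ->
  leb.-integrable `]a, b[ (EFin \o u2) -> leb.-integrable `]a, b[ (EFin \o w).
Proof.
move=> i1 i2.
have -> : EFin \o w = EFin \o ((fun x => u1 x * \1_(`]-oo, c[%classic) x) \+
    (fun x => u2 x * \1_(`[c, +oo[%classic) x)).
  apply/funext => x /=; congr EFin; rewrite /glue !indicE.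
  have [xc|cx] := ltP x c.
    by rewrite mem_set ?memNset ?mulr1 ?mulr0 ?addr0//= in_itv/= ?andbT// leNgt xc.
  by rewrite memNset ?mem_set ?mulr1 ?mulr0 ?add0r//= in_itv/= ?andbT ?ltNge ?cx.
apply: (integrable_add leb (measurable_itv _)).
- apply: (integrable_mul_bounded leb (measurable_itv _) i1 (C := 1)) => [|x _].
    exact: measurable_indic.
  by rewrite indicE; case: (_ \in _); rewrite ?normr1 ?normr0.
- apply: (integrable_mul_bounded leb (measurable_itv _) i2 (C := 1)) => [|x _].
    exact: measurable_indic.
  by rewrite indicE; case: (_ \in _); rewrite ?normr1 ?normr0.
Qed.

Lemma Rintegral_split (a b : R) (v : R -> R) : a < c < b ->
  leb.-integrable `]a, b[ (EFin \o v) ->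
  \int[leb]_(x in `]a, b[) v x =
  \int[leb]_(x in `]a, c[) v x + \int[leb]_(x in `[c, b[) v x.
Proof.
move=> /andP[ac cb] iv.
have E : (`]a, b[ = `]a, c[ `|` `[c, b[)%classic.
  apply/seteqP; split => x /=; rewrite !in_itv/=.
    by move=> /andP[ax xb]; have [xc|cx] := ltP x c; [left; rewrite ax|right; rewrite xb].
  by move=> [/andP[ax xc]|/andP[cx xb]]; [rewrite ax (lt_trans xc)|rewrite xb (lt_le_trans ac)].
rewrite E Rintegral_setU//; first by rewrite -E.
apply/disj_setPS => x [/=]; rewrite !in_itv/= => /andP[_ xc] /andP[cx _].
by have := lt_le_trans xc cx; rewrite ltxx.
Qed.

Lemma Rintegral_glue (a b : R) : a < c < b -> leb.-integrable `]a, b[ (EFin \o u1) ->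
  leb.-integrable `]a, b[ (EFin \o u2) ->
  \int[leb]_(x in `]a, b[) w x =
  \int[leb]_(x in `]a, c[) u1 x + \int[leb]_(x in `[c, b[) u2 x.
Proof.
move=> cab i1 i2; rewrite (Rintegral_split cab)//; last exact: integrable_glue.
congr (_ + _); apply: eq_Rintegral => x; rewrite inE/= in_itv/= => /andP[].
  by move=> _ /glue_lt.
by move=> /glue_ge.
Qed.

End gluing.

Lemma glue_mul {R : realType} (c : R) (u1 u2 v : R -> R) :
  (fun x => glue c u1 u2 x * v x) = glue c (fun x => u1 x * v x) (fun x => u2 x * v x).
Proof. by apply/funext => x; rewrite /glue; case: ifP. Qed.

Lemma glue_balance {R : realType} (A A1 A2 A3 B B1 B2 B3 C C1 C2 Cw p l1 l2 : R) :
  A1 = p * l1 - (B1 + C1) -> A2 = p * l2 - (B2 + C2) -> A = - (B + C) ->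
  B = B2 + B3 -> A = A2 + A3 -> Cw = C1 + (C - C2) + (l2 - l1) * p ->
  A1 + A3 = - (B1 + B3 + Cw).
Proof.
move=> -> A2E AE BE AB ->; have -> : A3 = A - A2 by lra.
by rewrite A2E AE BE; ring.
Qed.

Lemma glue_sbv {R : realType} (a b c : R) (u1 u2 f1 f2 : R -> R) :
  let leb := @lebesgue_measure R in a < c < b ->
  leb.-integrable `]a, b[ (EFin \o u1) -> leb.-integrable `]a, b[ (EFin \o u2) ->
  sbv_derivative a b u1 f1 -> sbv_derivative a b u2 f2 ->
  finite_set (jump_set a b u1) -> finite_set (jump_set a b u2) ->
  sbv_derivative a b (glue c u1 u2) (glue c f1 f2).
Proof.
move=> leb cab iu1 iu2 uf1 uf2 fS1 fS2; set w := glue c u1 u2.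
have [if1 _ _] := uf1; have [if2 _ _] := uf2.
have iw := integrable_glue c iu1 iu2.
have fSw := finite_jump_set_glue c fS1 fS2.
split; [exact: integrable_glue|exact: finite_counting_integrable|].
move=> phi [dphi cphi [K [cK Kab phiK]]].
have mI : measurable (`]a, b[ : set R) := measurable_itv _.
have [/andP[ac cb]] := cab.
have [c0 [d0 [ac0 d0b sp]]] : exists c0 d0 : R, [/\ a < c0, d0 < b &
    forall x, ~ (c0 <= x <= d0) -> phi x = 0].
  have [K0|/set0P K0] := eqVneq K set0.
    exists c, c; split => // x _; apply: phiK; by rewrite K0.
  have cid : {within K, continuous (@id R)} by apply: continuous_subspaceT => x; exact: cvg_id.
  have [c0 /set_mem Kc0 c0min] := compact_EVT_min K0 cK cid.
  have [d0 /set_mem Kd0 d0max] := compact_EVT_max K0 cK cid.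
  exists c0, d0; split.
  - by have := Kab _ Kc0; rewrite /= in_itv/= => /andP[].
  - by have := Kab _ Kd0; rewrite /= in_itv/= => /andP[].
  - move=> x nx; apply: phiK => Kx; apply: nx.
    by rewrite [c0 <= x]c0min ?[x <= d0]d0max//; exact/mem_set.
have dp (x : R) : is_derive x 1 phi (derive1 phi x).
  by rewrite derive1E; exact: derivableP.
have cp : continuous phi.
  by move=> x; apply: differentiable_continuous; apply/derivable1_diffP.
have mcont (g : R -> R) : continuous g -> measurable_fun `]a, b[ g.
  by move=> cg; apply: measurable_funTS; exact: continuous_measurable_fun.
have prod (v g : R -> R) : leb.-integrable `]a, b[ (EFin \o v) -> continuous g ->
    leb.-integrable `]a, b[ (EFin \o (fun x => v x * g x)).
  move=> iv cg; have [C HC] := continuous_itv_bounded a b cg.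
  apply: (integrable_mul_bounded leb mI iv (mcont _ cg) (C := C)) => x.
  by rewrite /= in_itv/= => /andP[/ltW ax /ltW xb]; apply: HC; rewrite ax.
pose F := (jump_set a b u1 `|` jump_set a b u2) `|` [set c].
have fF : finite_set F.
  by rewrite !finite_setU; split; [split|exact: finite_set1].
have [s us Fs] : exists2 s : seq R, uniq s & F = [set` s].
  have [s Fs] := (@finite_seqP R _).1 fF; exists (undup s); first exact: undup_uniq.
  by rewrite Fs; apply/seteqP; split => x /=; rewrite mem_undup.
have FI x : F x -> a < x < b by move=> [[[]|[]]|/= ->//]; rewrite in_itv.
have cF : F c by right.
have meas (u : R -> R) : leb.-integrable `]a, b[ (EFin \o u) -> measurable_fun `]a, b[ u.
  by move=> iu; apply/measurable_EFinP; case/integrableP : iu.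
have J0 (u : R -> R) x : leb.-integrable `]a, b[ (EFin \o u) -> F x -> ~ jump_set a b u x ->
    rtrace u x - ltrace u x = 0.
  move=> iu Fx nj; apply/eqP; rewrite subr_eq0 eq_sym; apply/eqP.
  exact: (not_jump_traces (FI _ Fx) (meas _ iu) nj).
have countE (u : R -> R) (A : set R) : leb.-integrable `]a, b[ (EFin \o u) ->
    jump_set a b u `<=` F ->
    \int[@counting R R]_(x in jump_set a b u `&` A) ((rtrace u x - ltrace u x) * phi x) =
    \sum_(x <- s) (rtrace u x - ltrace u x) * phi x * \1_A x.
  move=> iu SF; rewrite Rintegral_mkcondr.
  transitivity (\int[@counting R R]_(x in jump_set a b u) ((rtrace u x - ltrace u x) * phi x * \1_A x)).
    apply: eq_Rintegral => x _; rewrite patchE indicE; case: ifPn => _; by rewrite ?mulr1 ?mulr0.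
  apply: Rintegral_counting => //; first by rewrite -Fs.
  by move=> x xs nj; rewrite J0// ?Fs// !mul0r.
have wF : jump_set a b w `<=` F.
  move=> x; have [xc /jump_set_glue_lt|cx /jump_set_glue_gt|->] := ltgtP x c; last by right.
    by move=> /(_ xc); left; left.
  by move=> /(_ cx); left; right.
have F1 : jump_set a b u1 `<=` F by move=> x; left; left.
have F2 : jump_set a b u2 `<=` F by move=> x; left; right.
have h1 := half_interval_test iu1 uf1 fS1 ac0 d0b dp cphi sp cab.
have h2 := half_interval_test iu2 uf2 fS2 ac0 d0b dp cphi sp cab.
have t2 := sbv_test uf2 ac0 d0b dp cphi sp.
rewrite (countE u1 _ iu1 F1) in h1; rewrite (countE u2 _ iu2 F2) in h2.
rewrite -[jump_set a b u2]setIT (countE u2 _ iu2 F2) in t2.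
rewrite -[jump_set a b w]setIT (countE w _ iw wF).
have := Rintegral_split cab (prod _ _ iu2 cphi); have := Rintegral_split cab (prod _ _ if2 cp).
rewrite !glue_mul (Rintegral_glue cab (prod _ _ iu1 cphi) (prod _ _ iu2 cphi)).
rewrite (Rintegral_glue cab (prod _ _ if1 cp) (prod _ _ if2 cp)) => s1 s2.
suff key : \sum_(x <- s) (rtrace w x - ltrace w x) * phi x * \1_setT x =
    \sum_(x <- s) (rtrace u1 x - ltrace u1 x) * phi x * \1_(`]-oo, c[%classic) x +
    (\sum_(x <- s) (rtrace u2 x - ltrace u2 x) * phi x * \1_setT x -
     \sum_(x <- s) (rtrace u2 x - ltrace u2 x) * phi x * \1_(`]-oo, c[%classic) x) +
    (ltrace u2 c - ltrace u1 c) * phi c by exact: glue_balance h1 h2 t2 s1 s2 key.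
have cFs : c \in s by have := cF; rewrite Fs.
rewrite !(big_rem c cFs).
have E : \sum_(x <- rem c s) (rtrace w x - ltrace w x) * phi x * \1_setT x =
    \sum_(x <- rem c s) (rtrace u1 x - ltrace u1 x) * phi x * \1_(`]-oo, c[%classic) x +
    (\sum_(x <- rem c s) (rtrace u2 x - ltrace u2 x) * phi x * \1_setT x -
     \sum_(x <- rem c s) (rtrace u2 x - ltrace u2 x) * phi x * \1_(`]-oo, c[%classic) x).
  rewrite -sumrB -big_split/=; apply: eq_big_seq => x.
  rewrite mem_rem_uniq// inE => /andP[xnc _].
  rewrite !indicE in_setT; have [xc|cx|xc] := ltgtP x c; last by rewrite xc eqxx in xnc.
    rewrite rtrace_glue_lt// ltrace_glue_le ?(ltW xc)// mem_set/= ?in_itv//=; ring.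
  by rewrite rtrace_glue_ge ?(ltW cx)// ltrace_glue_gt// memNset/= ?in_itv/= ?ltNge ?(ltW cx)//=; ring.
rewrite {}E; move: (\sum_(x <- rem c s) _) (\sum_(x <- rem c s) _) (\sum_(x <- rem c s) _) => X1 X2 X3.
rewrite !indicE in_setT rtrace_glue_ge// ltrace_glue_le// memNset/= ?in_itv/= ?ltxx//; ring.
Qed.

(** * The graph current *)

Section graphs.
Context {R : realType}.
Local Notation leb := (@lebesgue_measure R).
Local Notation plane := (R * R)%type.

Lemma hausdorff1_point (z : plane) : hausdorff1 [set z] = 0%E.
Proof.
have d0 : (diam2 [set z] <= 0%:E)%E.
  apply: diam2_le => // p q -> ->.
  by rewrite (le_trans (dist2_le_add _ _))// !subrr normr0 addr0.
apply/eqP; rewrite eq_le (outer_measure_ge0 (@hausdorff1_outer R)) andbT.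
apply: ge_ereal_sup => _ [d d_gt0 <-].
apply: (@le_trans _ _ (\sum_(n <oo) diam2 (if n is 0%N then [set z] else set0))%E).
  apply: hausdorff1_pre_le => [p ->|[|n]]; first by exists 0%N.
    by rewrite (le_trans d0)// lee_fin ltW.
  by rewrite diam2_set0 lee_fin ltW.
rewrite nneseries_recl//; last by move=> n _; exact: diam2_ge0.
rewrite eseries0 ?adde0// => n n1 _; case: n n1 => // n _.
exact: diam2_set0.
Qed.

Lemma hausdorff1_countable (A : set plane) : countable A -> hausdorff1 A = 0%E.
Proof.
move=> cA; apply/eqP; rewrite eq_le (outer_measure_ge0 (@hausdorff1_outer R)) andbT.
have /countable_injP[f fA] := cA.
pose D k := [set z : plane | A z /\ f z = k].
apply: (@le_trans _ _ (\sum_(k <oo) hausdorff1 (D k))%E).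
  rewrite [X in hausdorff1 X](_ : A = \bigcup_k D k).
    exact: (outer_measure_sigma_subadditive (@hausdorff1_outer R)).
  by apply/seteqP; split => [z Az|z [k _ []]//]; exists (f z).
rewrite eseries0// => k _ _.
have [[z [Az fz]]|nD] := pselect (exists z, D k z).
  rewrite (_ : D k = [set z]) ?hausdorff1_point//.
  apply/seteqP; split=> [y [Ay fy]|y ->//].
  by apply: (fA y z); rewrite ?inE// fy fz.
rewrite (_ : D k = set0) ?(outer_measure0 (@hausdorff1_outer R))//.
by rewrite -subset0 => z Dz; apply: nD; exists z.
Qed.

Definition graph_over (U : R -> R) (A : set R) : set plane := [set z | A z.1 /\ z.2 = U z.1].

Lemma graph_over_setU U A B : graph_over U (A `|` B) = graph_over U A `|` graph_over U B.
Proof.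
by apply/seteqP; split => z /=; [move=> [[? ?|? ?]]; [left|right]|move=> [[? ?]|[? ?]]; split => //; [left|right]].
Qed.

Lemma graph_overS U A B : A `<=` B -> graph_over U A `<=` graph_over U B.
Proof. by move=> AB z [/AB]. Qed.

Lemma hausdorff1_graph_countable U A : countable A -> hausdorff1 (graph_over U A) = 0%E.
Proof.
move=> cA; apply: hausdorff1_countable.
rewrite (_ : graph_over U A = (fun x => (x, U x)) @` A).
  exact: card_le_trans (card_image_le _ _) cA.
by apply/seteqP; split => [[x y] [/= Ax /= ->]|_ [x Ax <-]//]; exists x.
Qed.

Variables (a b : R) (u f : R -> R).
Hypothesis iu : leb.-integrable `]a, b[ (EFin \o u).
Hypothesis uf : sbv_derivative a b u f.
Hypothesis finS : finite_set (jump_set a b u).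
Let S := jump_set a b u.
Let I : set R := `]a, b[.
Let U := ltrace u.
Let Om : set R := I `\` S.

Let intf : leb.-integrable I (EFin \o f). Proof. by have [] := uf. Qed.

Lemma open_jump_free : open Om.
Proof.
apply: openI; first exact: interval_open.
have /accessible_finite_set_closed cl := hausdorff_accessible (@Rhausdorff R).
by apply: closed_openC; apply: cl; exact: finS.
Qed.

Let speed x : R := 1 + `|f x|.

Let int_speed : leb.-integrable setT (EFin \o (speed \_ I)).
Proof.
have ispeed : leb.-integrable I (EFin \o speed).
  apply: (integrable_add leb (measurable_itv _)); last exact: (integrable_norm intf).
  have Ifin : (leb `]a, b[%classic < +oo)%E.
    by rewrite lebesgue_measure_itv/=; case: ifP => _; rewrite ltry.
  apply: (bounded_fun_integrable leb (measurable_itv _) (C := 1)) => [||x _].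
  - exact: Ifin.
  - exact: measurable_cst.
  - by rewrite normr1.
by have := (integrable_mkcond (mu := leb) (EFin \o speed) (measurable_itv _)).1 ispeed;
  rewrite restrict_EFin.
Qed.

Let int_speedS (D : set R) : measurable D -> leb.-integrable D (EFin \o (speed \_ I)).
Proof. by move=> mD; apply: integrableS int_speed. Qed.

Let nu (A : set R) : \bar R := (\int[leb]_(x in A) ((speed \_ I) x)%:E)%E.

Let speed0 x : (0 <= ((speed \_ I) x)%:E)%E.
Proof. by rewrite lee_fin patchE; case: ifP => // _; rewrite addr_ge0. Qed.

Let meas_speed (A : set R) : measurable_fun A (fun x => ((speed \_ I) x)%:E).
Proof. by apply: measurable_funTS; case/integrableP : int_speed. Qed.

Let le_nu (A B : set R) : measurable A -> measurable B -> A `<=` B -> (nu A <= nu B)%E.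
Proof. by move=> mA mB AB; apply: ge0_subset_integral => //; exact: meas_speed. Qed.

Let nuE (A : set R) : measurable A -> nu A = (\int[leb]_(x in A) `|(speed \_ I) x|)%:E.
Proof.
move=> mA; have i := int_speedS mA.
rewrite /Rintegral fineK; last exact: integrable_fin_num (integrable_norm i).
by apply: eq_integral => x _; rewrite ger0_norm// -lee_fin speed0.
Qed.

Lemma graph_step (J : set R) (p q : plane) : open J -> is_interval J -> J `<=` Om ->
  graph_over U J p -> graph_over U J q -> p.1 < q.1 ->
  `]p.1, q.1] `<=` J /\ ((dist2 p q)%:E <= nu `]p.1, q.1])%E.
Proof.
move: p q => [x s] [y t] oJ iJ JO [/= Jx ->] [/= Jy ->] xy.
have Jxy : `[x, y] `<=` J.
  by move=> z /=; rewrite in_itv/= => /andP[xz zy]; apply: (iJ x y) => //; rewrite xz.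
have sJ : `]x, y] `<=` J.
  by move=> z zxy; apply: Jxy; apply: subset_itvr zxy; rewrite bnd_simp.
split=> //.
have /nbhs_ballP[e /= e0 He] : nbhs x J by apply: open_nbhs_nbhs.
have inI z : J z -> a < z < b by move=> /JO[]; rewrite /I/= in_itv.
have JxE z : x - e < z <= y -> J z.
  move=> /andP[xz zy]; have [xz'|zx] := leP x z; first by apply: Jxy; rewrite /= in_itv/= xz'.
  by apply: He; rewrite /ball/= gtr0_norm ?subr_gt0//; lra.
pose c := x - e / 2.
have cx : c < x by rewrite /c; lra.
have ac : a <= c.
  have /inI/andP[/ltW//] : J c by apply: JxE; rewrite /c; apply/andP; split; lra.
have [/andP[ay yb] /andP[ax xb]] := (inI _ Jy, inI _ Jx).
have Sfree z : c < z < y -> ~ S z.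
  move=> /andP[cz zy]; have /JO[] : J z by apply: JxE; apply/andP; split; [rewrite /c in cz; lra|exact: ltW].
  by [].
have [K [_ _ Ktr]] := component_traces iu uf ac (lt_trans cx xy) (ltW yb) Sfree.
have Ux : U x = K + primitive a b f x.
  by have [|_ E] := Ktr x (inI _ Jx); [rewrite cx ltW|exact: E].
have Uy : U y = K + primitive a b f y.
  by have [|_ E] := Ktr y (inI _ Jy); [rewrite (lt_trans cx xy) lexx|exact: E].
apply: (@le_trans _ _ ((y - x)%:E + \int[leb]_(z in `]x, y]) `|(f \_ I) z|%:E)%E).
  have fI : leb.-integrable `]x, y] (EFin \o (f \_ I)).
    have := (integrable_mkcond (mu := leb) (EFin \o f) (measurable_itv _)).1 intf.
    by rewrite restrict_EFin; apply: integrableS.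
  have -> : (\int[leb]_(z in `]x, y]) `|(f \_ I) z|%:E)%E =
      (\int[leb]_(z in `]x, y]) `|(f \_ I) z|)%:E.
    rewrite /Rintegral fineK//; exact: integrable_fin_num (integrable_norm fI).
  rewrite -EFinD lee_fin (le_trans (dist2_le_add _ _))//= distrC gtr0_norm ?subr_gt0//.
  rewrite lerD2l Ux Uy distrC opprD addrACA subrr add0r (primitiveB uf (ltW ax) (ltW xy)).
  exact: (@le_normr_Rintegral _ _ _ leb _ _ (measurable_itv _) fI).
have -> : (y - x)%:E = (\int[leb]_(z in `]x, y]) 1)%E.
  have E : leb `]x, y]%classic = (y - x)%:E by rewrite lebesgue_measure_itv/= lte_fin xy -EFinB.
  by rewrite integral_cst// mul1e; exact: esym E.
have mfI : measurable_fun `]x, y] (fun z => `|(f \_ I) z|%:E).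
  apply: measurable_funTS; apply/measurable_EFinP; apply: measurableT_comp => //.
  apply/(measurable_restrictT _ _).1; first exact: measurable_itv.
  by apply/measurable_EFinP; case/integrableP : intf.
rewrite -ge0_integralD//.
apply: ge0_le_integral => //.
- by move=> z _; rewrite adde_ge0// lee_fin.
- exact: emeasurable_funD.
- exact: meas_speed.
- move=> z /sJ/JO[Iz _]; rewrite !patchE mem_set// -EFinD lee_fin//.
Qed.

Lemma hausdorff1_graph_le (O : set R) : open O -> O `<=` Om ->
  (hausdorff1 (graph_over U O) <= nu O)%E.
Proof.
move=> oO OO.
pose grid : set R := range (fun q : rat => a + ratr q).
have cgrid : countable grid.
  by apply: card_le_trans (card_image_le _ _) _; exact: countableP.
have mO : measurable O by exact: open_measurable.
have mOm : measurable Om by exact: open_measurable open_jump_free.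
have g0 : hausdorff1_outer R (graph_over U (O `&` grid)) = 0%E.
  apply: hausdorff1_graph_countable.
  exact: (sub_countable (subset_card_le (@subIsetr _ O grid)) cgrid).
rewrite -{1}(setDUK (@subIsetl _ O grid)) graph_over_setU.
apply: le_trans (outer_measureU2 (@hausdorff1_outer R) _ _) _.
rewrite g0 add0e.
apply: ge_ereal_sup => _ [d /= d0 <-].
have d20 : 0 < d / 2 by rewrite divr_gt0.
have [e [e0 He]] := integral_normr_continuous int_speed d0.
have [n /= ne] : exists n : nat, n.+1%:R^-1 < e.
  exists (Num.bound e^-1); rewrite invf_plt ?posrE// (lt_le_trans (archi_boundP _)) ?ler_nat//.
  by rewrite invr_ge0 ltW.
pose h : R := n.+1%:R^-1.
have h0 : 0 < h by rewrite invr_gt0.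
pose M := (Num.bound ((b - a) / h)).+1.
pose G : set R := (fun i : nat => a + i%:R * h) @` `I_M.
have Ggrid : G `<=` grid.
  move=> _ [i _ <-]; exists (i%:R / n.+1%:R) => //.
  by rewrite fmorph_div/= !ratr_nat.
have fG : finite_set G by apply: finite_image; exact: finite_II.
pose O' := O `\` G.
have oO' : open O'.
  apply: openI => //; have /accessible_finite_set_closed cl := hausdorff_accessible (@Rhausdorff R).
  by apply: closed_openC; exact: cl.
have O'O : O' `<=` O by exact: subIsetl.
pose J := open_disjoint_itv oO'.
have oJ k : open (J k) by exact: open_disjoint_itv_open.
have iJ k : is_interval (J k) by exact: open_disjoint_itv_is_interval.
have JU : O' = \bigcup_k J k by exact: open_disjoint_itv_bigcup.
have JO' k : J k `<=` O' by rewrite JU => x Jx; exists k.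
have JO k : J k `<=` Om by move=> x /JO'/O'O/OO.
have mJ k : measurable (J k) by exact: open_measurable.
have inI k x : J k x -> a < x < b by move=> /JO[]; rewrite /I/= in_itv.
have short k x y : J k x -> J k y -> x < y -> y - x <= h.
  move=> Jx Jy xy; rewrite leNgt; apply/negP => hxy.
  have /andP[ax _] := inI _ _ Jx; have /andP[_ yb] := inI _ _ Jy.
  pose i := (Num.truncn ((x - a) / h)).+1.
  have xa0 : 0 <= (x - a) / h by apply: divr_ge0; [rewrite subr_ge0 ltW|exact: ltW].
  have /andP[t1 t2] := truncn_itv xa0.
  have i1 : x < a + i%:R * h by rewrite -ltrBlDl -ltr_pdivrMr.
  have i2 : a + i%:R * h <= x + h.
    rewrite /i -natr1 mulrDl mul1r addrA lerD2r -lerBrDl -ler_pdivlMr//.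
  have /(_ (a + i%:R * h)) := iJ k x y Jx Jy.
  rewrite (ltW i1)/= => Ji; have {}Ji : J k (a + i%:R * h) by apply: Ji; lra.
  have /JO'[_] := Ji; apply; exists i => //=.
  rewrite /M ltnS -(ler_nat R) ltW//; apply: le_lt_trans (archi_boundP _).
    rewrite ler_pdivlMr//; have /andP[_] := inI _ _ Ji; lra.
  by apply: divr_ge0; [rewrite subr_ge0 ltW// (lt_trans ax (lt_trans xy yb))|exact: ltW].
have step k (p q : plane) : graph_over U (J k) p -> graph_over U (J k) q -> p.1 < q.1 ->
    ((dist2 p q)%:E <= nu (J k))%E /\ (dist2 p q <= d).
  move=> Jp Jq pq; have [sJ dnu] := graph_step (oJ k) (iJ k) (@JO k) Jp Jq pq.
  split; first by apply: le_trans dnu _; apply: le_nu.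
  have := He `]p.1, q.1]%classic (measurable_itv _).
  have lpq : (leb `]p.1, q.1]%classic < e%:E)%E.
    rewrite lebesgue_measure_itv/= lte_fin pq -EFinB lte_fin.
    exact: le_lt_trans (short k _ _ Jp.1 Jq.1 pq) ne.
  move=> /(_ lpq)/ltW lt_d.
  by rewrite -lee_fin (le_trans dnu)// nuE//= lee_fin.
have dist2C (p q : plane) : dist2 p q = dist2 q p.
  by rewrite /dist2 -[(p.1 - q.1) ^+ 2]sqrrN opprB -[(p.2 - q.2) ^+ 2]sqrrN opprB.
have dist2_0 (p q : plane) k : graph_over U (J k) p -> graph_over U (J k) q -> p.1 = q.1 -> dist2 p q = 0.
  by move=> [_ p2] [_ q2] pq; rewrite /dist2 p2 q2 pq !subrr expr0n/= addr0 sqrtr0.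
have nu0 A : (0 <= nu A)%E by apply: integral_ge0.
have pair k (p q : plane) : graph_over U (J k) p -> graph_over U (J k) q ->
    ((dist2 p q)%:E <= nu (J k))%E /\ (dist2 p q <= d).
  move=> Jp Jq; have [pq|qp|pq] := ltgtP p.1 q.1; first exact: step.
    by rewrite dist2C; exact: step.
  by rewrite (dist2_0 _ _ k)// (ltW d0).
apply: (@le_trans _ _ (\sum_(k <oo) diam2 (graph_over U (J k)))%E).
  apply: hausdorff1_pre_le => [z [[Oz nz] zU]|k].
    have : O' z.1 by split => // /Ggrid gz; apply: nz.
    by rewrite JU => -[k _ Jz]; exists k.
  by apply: diam2_le; [exact: ltW|move=> p q Jp Jq; have [] := pair k p q Jp Jq].
apply: (@le_trans _ _ (nu O')); last by apply: le_nu => //; exact: open_measurable.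
rewrite [in nu _]JU /nu ge0_integral_bigcup//; last 2 first.
- exact: meas_speed.
- exact: open_disjoint_itv_trivIset.
apply: lee_nneseries => [k _ _|k _]; first exact: diam2_ge0.
apply: ge_ereal_sup => _ [[[p q] /= [Jp Jq] <-]|->]; last exact: nu0.
by have [] := pair k p q Jp Jq.
Qed.

Lemma hausdorff1_graph_fin : (hausdorff1 (graph_over U Om) < +oo)%E.
Proof.
apply: le_lt_trans (hausdorff1_graph_le open_jump_free (@subset_refl _ _)) _.
have mOm : measurable Om by exact: open_measurable open_jump_free.
have /integrableP[_] := int_speedS mOm.
by apply: le_lt_trans; apply: ge0_le_integral => //; [exact: meas_speed|
  by apply: measurableT_comp => //; exact: meas_speed|
  move=> x _; rewrite lee_abs].
Qed.

Lemma hausdorff1_graph_null (N : set R) : measurable N -> leb N = 0%E ->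
  hausdorff1 (graph_over U (N `&` Om)) = 0%E.
Proof.
move=> mN N0; apply/eqP; rewrite eq_le (outer_measure_ge0 (@hausdorff1_outer R)) andbT.
apply/lee_addgt0Pr => e e0; rewrite add0e.
have [d [d0 Hd]] := integral_normr_continuous int_speed e0.
have Noo : (leb N < +oo)%E by rewrite N0 ltry.
have [V [oV NV VN]] := lebesgue_regularity_outer mN Noo d0.
have oO : open (V `&` Om) by apply: openI => //; exact: open_jump_free.
have mO : measurable (V `&` Om) by exact: open_measurable.
apply: (@le_trans _ _ (hausdorff1 (graph_over U (V `&` Om)))).
  by apply: (le_outer_measure (@hausdorff1_outer R)); apply: graph_overS; exact: setSI.
apply: (le_trans (hausdorff1_graph_le oO (@subIsetr _ _ _))).
have lO : (leb (V `&` Om) < d%:E)%E.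
  have mV : measurable V by exact: open_measurable.
  have VN0 : leb (V `&` N) = 0%E.
    exact: (@subset_measure0 _ _ _ leb _ N (measurableI _ _ mV mN) mN (@subIsetr _ _ _) N0).
  apply: le_lt_trans VN; rewrite -[leRHS]adde0 -VN0 -(measureDI leb mV mN).
  by apply: le_measure; rewrite ?inE//; exact: subIsetl.
by rewrite nuE// lee_fin ltW//; exact: Hd.
Qed.

Lemma ltrace_continuous x : Om x -> {for x, continuous U}.
Proof.
move=> [xI nSx]; have xab : a < x < b by move: xI; rewrite /I/= in_itv.
have [d [d0 ad db free]] := jump_free_nbhs finS xab.
have Sfree z : x - d < z < x + d -> ~ S z.
  by move=> /free zx Sz; apply: nSx; rewrite -zx.
have xd : x - d < x + d by lra.
have [K [_ _ Ktr]] := component_traces iu uf ad xd db Sfree.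
have KU z : x - d < z < x + d -> U z = K + primitive a b f z.
  move=> /andP[z1 z2]; have [||_ E] := Ktr z; last exact: E.
    by apply/andP; split; lra.
  by rewrite z1 ltW.
have Ux : U x = K + primitive a b f x by apply: KU; apply/andP; split; lra.
change (U z @[z --> x] --> U x); rewrite Ux.
have ax : a < x by have /andP[] := xab.
have c : (fun z => K + primitive a b f z) z @[z --> x] --> K + primitive a b f x.
  by apply: cvgD; [exact: cvg_cst|exact: primitive_continuous uf _ ax].
apply: cvg_trans c; apply: near_eq_cvg; near=> z.
have zx : `|x - z| < d by near: z; apply/nbhs_ballP; exists d.
by rewrite KU//; move: zx; rewrite ltr_norml => /andP[? ?]; apply/andP; split; lra.
Unshelve. all: by end_near. Qed.

Lemma measurable_ltrace : measurable_fun Om U.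
Proof.
apply: open_continuous_measurable_fun; first exact: open_jump_free.
by move=> x; rewrite inE => /ltrace_continuous.
Qed.

End graphs.

Lemma measurable_funV_gt0 {R : realType} d (T : measurableType d) (D : set T) (f : T -> R) :
  (forall x, D x -> 0 < f x) -> measurable_fun D f -> measurable_fun D (fun x => (f x)^-1).
Proof.
move=> f0 mf; change (measurable_fun D ((@GRing.inv R) \o f)).
apply: (measurable_comp (F := `]0%R, +oo[%classic : set R)) => //.
  by move=> _ [x Dx <-]; rewrite /= in_itv/= andbT f0.
apply: open_continuous_measurable_fun; first exact: interval_open.
by move=> x; rewrite inE/= in_itv/= andbT => x0; apply: inv_continuous; rewrite gt_eqF.
Qed.

Section vertical_lines.
Context {R : realType}.
Local Notation leb := (@lebesgue_measure R).
Local Notation plane := (R * R)%type.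

Definition vlines (s : seq R) (V : R -> set R) : set plane :=
  [set z | z.1 \in s /\ V z.1 z.2].

Lemma vlines_cons c s V : vlines (c :: s) V = vline c (V c) `|` vlines s V.
Proof.
apply/seteqP; split => -[x t] /=.
  rewrite /vlines/= inE => -[/orP[/eqP->|xs] Vt]; first by left.
  by right.
rewrite /vlines/= inE => -[[/= -> Vt]|[/= xs Vt]]; first by rewrite eqxx.
by rewrite xs orbT.
Qed.

Lemma vlines_nil V : vlines [::] V = set0.
Proof. by rewrite -subset0 => z []. Qed.

Lemma measurable_vlines s V : (forall c, measurable (V c)) -> measurable (vlines s V).
Proof.
move=> mV; elim: s => [|c s IH]; first by rewrite vlines_nil.
by rewrite vlines_cons; apply: measurableU => //; exact: measurable_vline.
Qed.

Lemma H1_vlines_fin s V : (forall c, measurable (V c)) ->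
  (forall c, leb (V c) < +oo)%E -> (H1 R (vlines s V) < +oo)%E.
Proof.
move=> mV fV; elim: s => [|c s IH]; first by rewrite vlines_nil measure0 ltry.
rewrite vlines_cons; apply: (le_lt_trans (outer_measureU2 (@hausdorff1_outer R) _ _)).
by apply: lte_add_pinfty => //; have := H1_vline c (mV c) => /= ->.
Qed.

Lemma Rintegral_vline c (A : set R) (f : plane -> R) : measurable A ->
  measurable_fun setT f ->
  \int[H1 R]_(z in vline c A) f z = \int[leb]_(t in A) f (c, t).
Proof.
move=> mA mf; congr fine; apply: integral_vline => //.
by apply: measurable_funTS; apply/measurable_EFinP.
Qed.

Lemma Rintegral_vlines s V (f : plane -> R) : uniq s -> (forall c, measurable (V c)) ->
  measurable_fun setT f -> (H1 R).-integrable (vlines s V) (EFin \o f) ->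
  \int[H1 R]_(z in vlines s V) f z = \sum_(c <- s) \int[leb]_(t in V c) f (c, t).
Proof.
move=> + mV mf; elim: s => [_ _|c s IH /= /andP[cs us]].
  by rewrite vlines_nil Rintegral_set0 big_nil.
have m1 : measurable (vline c (V c) : set (H1plane R)) by apply: measurable_H1; exact: measurable_vline.
have m2 : measurable (vlines s V : set (H1plane R)) by apply: measurable_H1; exact: measurable_vlines.
rewrite vlines_cons big_cons => fi; rewrite Rintegral_setU//; last first.
  by apply/disj_setPS => -[x t] [[/= -> _] [/= xs _]]; rewrite xs in cs.
rewrite Rintegral_vline// IH//.
apply: (@integrableS _ _ _ (H1 R) (vline c (V c) `|` vlines s V)) => //.
by exact: measurableU.
Qed.

End vertical_lines.

Section gamma_current.
Context {R : realType}.
Local Notation leb := (@lebesgue_measure R).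
Local Notation plane := (R * R)%type.

Lemma sbv_derivP (a b : R) (u : R -> R) : SBV a b u -> sbv_derivative a b u (sbv_deriv a b u).
Proof. by move=> [_ fu]; exact: xgetPex. Qed.

Definition slope (a b : R) (u : R -> R) : R -> R := sbv_deriv a b u \_ `]a, b[.

Definition nrm (a b : R) (u : R -> R) (x : R) : R := Num.sqrt (1 + slope a b u x ^+ 2).

Definition vseg (u : R -> R) (x : R) : set R := `[lower_trace u x, upper_trace u x].

Definition vert (u : R -> R) (q : plane -> R) (x : R) : R :=
  Num.sg (rtrace u x - ltrace u x) * \int[leb]_(t in vseg u x) q (x, t).

Lemma measurable_vseg u x : measurable (vseg u x). Proof. exact: measurable_itv. Qed.

Lemma vseg_fin u x : (leb (vseg u x) < +oo)%E.
Proof. by rewrite lebesgue_measure_itv/=; case: ifP => _; rewrite ltry. Qed.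

Lemma nrm_ge1 a b u x : 1 <= nrm a b u x.
Proof.
rewrite /nrm -[leLHS]sqrtr1 ler_sqrt ?lerDl ?sqr_ge0//.
by rewrite addr_ge0 ?sqr_ge0.
Qed.

Lemma nrm_gt0 a b u x : 0 < nrm a b u x. Proof. exact: lt_le_trans ltr01 (nrm_ge1 a b u x). Qed.

Lemma slope_le_nrm a b u x : `|slope a b u x| <= nrm a b u x.
Proof. by rewrite /nrm -sqrtr_sqr ler_sqrt ?lerDr// addr_ge0 ?sqr_ge0. Qed.

Variables (a b : R) (u : R -> R).
Hypothesis su : SBV a b u.
Hypothesis finS : finite_set (jump_set a b u).
Let S := jump_set a b u.
Let I : set R := `]a, b[.
Let U := ltrace u.
Local Notation d := (slope a b u).
Local Notation n := (nrm a b u).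

Let iu : leb.-integrable I (EFin \o u). Proof. by case: su. Qed.

Let uf := sbv_derivP su.

Lemma measurable_slope : measurable_fun setT d.
Proof.
apply/(measurable_restrictT _ _).1 => //; apply/measurable_EFinP.
by have [/integrableP[]] := uf.
Qed.

Lemma measurable_nrm : measurable_fun setT n.
Proof.
apply: measurableT_comp; first exact: continuous_measurable_fun (@sqrt_continuous R).
by apply: measurable_funD => //; apply: measurable_funX; exact: measurable_slope.
Qed.

Lemma measurable_graph_over (A : set R) : measurable A -> A `<=` I `\` S ->
  measurable (graph_over U A).
Proof.
move=> mA AO; pose V := U \_ A.
have mOm : measurable (I `\` S) by exact: open_measurable (open_jump_free finS).
have mV : measurable_fun setT V.
  by apply/(measurable_restrictT _ _).1 => //; apply: measurable_funS (measurable_ltrace iu uf finS).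
rewrite (_ : graph_over U A = (fst @^-1` A) `&` ((fun z : plane => z.2 - V z.1) @^-1` [set 0])).
  apply: measurableI; rewrite -[X in measurable X]setTI.
    exact: measurable_fst.
  suff : measurable_fun setT (fun z : plane => z.2 - V z.1) by apply.
  by apply: measurable_funB; [exact: measurable_snd|exact: measurableT_comp mV measurable_fst].
apply/seteqP; split => -[x t] /= [Ax].
  by move=> /= ->; split => //=; rewrite /V patchE mem_set// subrr.
by move/eqP; rewrite subr_eq0 /V patchE mem_set// => /eqP ->.
Qed.

Lemma graph_orientE z : I z.1 -> ~ S z.1 ->
  graph_orient a b u z = ((n z.1)^-1, d z.1 / n z.1).
Proof. by move=> Iz Sz; rewrite /graph_orient asboolF// /nrm /slope patchE mem_set. Qed.

Section decomposition.
Variable F : seq R.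
Hypothesis uF : uniq F.
Hypothesis SF : S `<=` [set` F].
Hypothesis FI : [set` F] `<=` I.
Let IF : set R := I `\` [set` F].
Local Notation N := (graph_over U IF).

Let IFS : IF `<=` I `\` S. Proof. by apply: setDS. Qed.

Let mIF : measurable IF.
Proof.
apply: measurableD; first exact: measurable_itv.
by apply: measurable_finite_set; exact: finite_seq.
Qed.

Lemma measurable_flat_part : measurable N.
Proof. exact: measurable_graph_over mIF IFS. Qed.

Let mV := measurable_vlines F (measurable_vseg u).

Lemma graph_set_decomp : graph_set a b u = N `|` vlines F (vseg u).
Proof.
have mu : measurable_fun I u by apply/measurable_EFinP; case/integrableP : iu.
apply/seteqP; split => -[x t] /=; rewrite /graph_set/=.
  move=> [xI xt]; have [xF|xF] := boolP (x \in F).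
    by right; split => //=; rewrite /vseg/= in_itv.
  left; have IFx : IF x by split => //=; exact/negP.
  split => //=; have [_ nS] := IFS IFx.
  have xab : a < x < b by rewrite in_itv in xI.
  move: xt; rewrite /lower_trace /upper_trace -(not_jump_traces xab mu nS) minxx maxxx.
  by move=> /andP[? ?]; apply/eqP; rewrite eq_le; apply/andP.
move=> [[/= IFx ->]|[/= xF]]; last first.
  by rewrite /vseg/= in_itv/= => xt; split => //; exact: FI.
have [xI nS] := IFS IFx; split => //.
have xab : a < x < b by rewrite /I/= in_itv in xI.
by rewrite /lower_trace /upper_trace -(not_jump_traces xab mu nS) minxx maxxx lexx.
Qed.

Lemma measurable_graph_set : measurable (graph_set a b u).
Proof. by rewrite graph_set_decomp; apply: measurableU => //; exact: measurable_flat_part. Qed.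

Lemma H1_flat_part_fin : (H1 R N < +oo)%E.
Proof.
apply: le_lt_trans (hausdorff1_graph_fin iu uf finS).
by apply: (le_outer_measure (@hausdorff1_outer R)); exact: graph_overS.
Qed.

Lemma H1_graph_set_fin : (H1 R (graph_set a b u) < +oo)%E.
Proof.
rewrite graph_set_decomp; apply: (le_lt_trans (outer_measureU2 (@hausdorff1_outer R) _ _)).
apply: lte_add_pinfty; first exact: H1_flat_part_fin.
exact: (H1_vlines_fin F (measurable_vseg u) (vseg_fin u)).
Qed.

Lemma H1_flat_null (Z : set R) : measurable Z -> leb Z = 0%E ->
  H1 R [set z | N z /\ Z z.1] = 0%E.
Proof.
move=> mZ Z0; apply/eqP; rewrite -measure_le0.
rewrite -(hausdorff1_graph_null iu uf finS mZ Z0).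
apply: (le_outer_measure (@hausdorff1_outer R)) => z [[/IFS Oz zU] Zz].
by split.
Qed.

End decomposition.

Let mS : measurable S. Proof. exact: measurable_finite_set. Qed.

Let o1 (z : plane) : R := if z.1 \in S then 0 else (n z.1)^-1.

Let o2 (z : plane) : R :=
  if z.1 \in S then ((fun x => Num.sg (rtrace u x - ltrace u x)) \_ S) z.1
  else d z.1 / n z.1.

Let mem_S : measurable_fun setT (fun z : plane => z.1 \in S).
Proof.
apply: (measurable_fun_bool true); rewrite setTI.
rewrite (_ : _ @^-1` _ = fst @^-1` S).
  by rewrite -[X in measurable X]setTI; exact: measurable_fst.
by apply/seteqP; split => z /=; [exact: set_mem|exact: mem_set].
Qed.

Let mnV : measurable_fun setT (fun x => (n x)^-1).
Proof. by apply: measurable_funV_gt0 => [x _|]; [exact: nrm_gt0|exact: measurable_nrm]. Qed.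

Let mo1 : measurable_fun setT o1.
Proof.
apply: measurable_fun_ifT; [exact: mem_S|exact: measurable_cst|].
exact: measurableT_comp mnV measurable_fst.
Qed.

Let mo2 : measurable_fun setT o2.
Proof.
apply: measurable_fun_ifT; [exact: mem_S| |].
  apply: measurableT_comp; last exact: measurable_fst.
  apply/(measurable_restrictT _ _).1 => // _ Y mY; apply: measurable_finite_set.
  exact: (finite_setIl _ finS).
apply: (measurableT_comp (f := fun x => d x / n x)); last exact: measurable_fst.
by apply: measurable_funM => //; exact: measurable_slope.
Qed.

Let orientE z : graph_set a b u z -> graph_orient a b u z = (o1 z, o2 z).
Proof.
move=> [Iz _]; have [Sz|nSz] := pselect (S z.1); last first.
  by rewrite graph_orientE// /o1 /o2 memNset.
by rewrite /graph_orient asboolT// /o1 /o2 mem_set// patchE mem_set.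
Qed.

Let jump_seq : exists s : seq R, [/\ uniq s, S `<=` [set` s] & [set` s] `<=` I].
Proof.
have [s Ss] := (@finite_seqP R S).1 finS; exists (undup s).
have E : [set` undup s] = S by rewrite Ss; apply/seteqP; split => x /=; rewrite mem_undup.
by split; [exact: undup_uniq|rewrite E|rewrite E => x []].
Qed.

Let o1_le1 z : `|o1 z| <= 1.
Proof.
rewrite /o1; case: ifP => _; rewrite ?normr0 ?ler01// gtr0_norm ?invr_gt0 ?nrm_gt0//.
by rewrite invf_le1 ?nrm_gt0// nrm_ge1.
Qed.

Let o2_le1 z : `|o2 z| <= 1.
Proof.
rewrite /o2; case: ifP => Sz.
  by rewrite patchE Sz normr_sg; case: (_ == _); rewrite ?ler01.
by rewrite normrM [`|_^-1|]gtr0_norm ?invr_gt0 ?nrm_gt0// ler_pdivrMr ?nrm_gt0// mul1r slope_le_nrm.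
Qed.

Lemma nice_Gamma : nice_current a b (Gamma a b u).
Proof.
have [s [us Ss sI]] := jump_seq.
have mG := measurable_H1 (measurable_graph_set Ss sI).
split => //=.
- by move=> z [].
- apply: (eq_measurable_fun (o1 : H1plane R -> R)); last exact: measurable_funTS_H1 mo1.
  by move=> z; rewrite inE => /orientE/= ->.
- apply: (eq_measurable_fun (o2 : H1plane R -> R)); last exact: measurable_funTS_H1 mo2.
  by move=> z; rewrite inE => /orientE/= ->.
- by move=> z /orientE/= ->; exact: o1_le1.
- by move=> z /orientE/= ->; exact: o2_le1.
- move=> K cK Kab mK; apply: (bounded_fun_integrable (H1 R) _ (C := 1)) => //.
  + exact: measurableI.
  + apply: le_lt_trans (H1_graph_set_fin Ss sI).
    by apply: le_measure; rewrite ?inE//; exact: measurableI.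
  + by move=> z _; rewrite normr1.
Qed.

Section action.
Variables (F : seq R) (uF : uniq F) (SF : S `<=` [set` F]) (FI : [set` F] `<=` I).
Local Notation N := (graph_over U (I `\` [set` F])).
Variables (a1 b1 a2 b2 : R) (aa1 : a < a1) (b1b : b1 < b).
Variable (p : plane -> R).
Hypothesis bp : bounded_on (obox a1 b1 a2 b2) p.

Let act_split (o : plane -> R) : measurable_fun setT o -> (forall z, `|o z| <= 1) ->
  act (Gamma a b u) o p = \int[H1 R]_(z in N) (p z * o z) +
    \sum_(s <- F) \int[leb]_(t in vseg u s) (p (s, t) * o (s, t)).
Proof.
move=> mo ole; have [mp _ _] := bp.
have := act_integrable nice_Gamma (measurable_funTS_H1 mo) (fun z _ => ole z) aa1 b1b bp.
rewrite /act/= (_ : (fun z => p z * o z * 1) = (fun z => p z * o z)); last first.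
  by apply/funext => z; rewrite mulr1.
rewrite (graph_set_decomp SF FI) => fi.
have m1 := measurable_H1 (measurable_flat_part SF).
have m2 := measurable_H1 (measurable_vlines F (measurable_vseg u)).
rewrite Rintegral_setU//; last first.
  by apply/disj_setPS => -[x t] [[/= [_ xF] _] [/= xF' _]].
congr (_ + _); rewrite Rintegral_vlines//; first exact: measurable_vseg.
  exact: measurable_funM.
apply: (@integrableS _ _ _ (H1 R) (N `|` vlines F (vseg u))) => //.
by exact: measurableU.
Qed.

Let vseg_nojump s (g : R -> R) : s \in F -> ~ S s -> \int[leb]_(t in vseg u s) g t = 0.
Proof.
move=> /FI; rewrite /I/= in_itv/= => sab nS.
have mu : measurable_fun I u by apply/measurable_EFinP; case/integrableP : iu.
rewrite /vseg /lower_trace /upper_trace -(not_jump_traces sab mu nS) minxx maxxx.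
by rewrite set_itv1 /Rintegral integral_set1.
Qed.

Lemma act_Gamma_fst : act (Gamma a b u) (fst \o orient (Gamma a b u)) p =
  \int[H1 R]_(z in N) (p z / n z.1).
Proof.
transitivity (act (Gamma a b u) o1 p).
  by apply: eq_Rintegral => z; rewrite inE/= => /orientE ->.
rewrite (act_split mo1 o1_le1) [X in _ + X]big1_seq ?addr0 => [|s /= sF]; last first.
  have [Ss|nS] := pselect (S s); last exact: vseg_nojump.
  under eq_Rintegral do rewrite /o1/= mem_set// mulr0.
  by rewrite Rintegral_cst ?mul0r//; exact: measurable_vseg.
apply: eq_Rintegral => z; rewrite inE => -[[Iz Fz] _].
by rewrite /o1 memNset// => /SF.
Qed.

Lemma act_Gamma_snd : act (Gamma a b u) (snd \o orient (Gamma a b u)) p =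
  \int[H1 R]_(z in N) (p z * d z.1 / n z.1) + \sum_(s <- F) vert u p s.
Proof.
transitivity (act (Gamma a b u) o2 p).
  by apply: eq_Rintegral => z; rewrite inE/= => /orientE ->.
rewrite (act_split mo2 o2_le1); congr (_ + _).
  apply: eq_Rintegral => z; rewrite inE => -[[Iz Fz] _].
  by rewrite /o2 memNset ?mulrA// => /SF.
apply: eq_big_seq => s sF; rewrite /vert.
have [Ss|nS] := pselect (S s); last by rewrite !vseg_nojump// mulr0.
under eq_Rintegral do rewrite /o2/= mem_set// patchE mem_set// mulrC.
rewrite RintegralZl//; first exact: measurable_vseg.
have [mp [C pC] _] := bp.
apply: (bounded_fun_integrable leb (measurable_vseg u s) (vseg_fin u s) (C := C)) => [|t _].
  by apply: measurable_funTS; exact: measurableT_comp mp (pair1_measurable s).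
exact: pC.
Qed.

End action.
End gamma_current.

(** * Recoupling at the jump points *)

(* Mass with equal left and right values stays together; for each value v the
   residual mass then sits on one side only, so that the product coupling of
   the residuals never pairs a residual left value with an equal right one. *)
Lemma coupling {R : realType} (J : finType) (mu l r : J -> R) : (forall i, 0 <= mu i) ->
  exists pi : J -> J -> R, [/\ forall i j, 0 <= pi i j,
    forall i, \sum_j pi i j = mu i,
    forall j, \sum_i pi i j = mu j
  & forall i j i' j', 0 < pi i j -> l i <> r j -> 0 < pi i' j' -> l i' <> r j' ->
      l i <> r j'].
Proof.
move=> mu0.
pose ml v := \sum_(i | l i == v) mu i; pose mr v := \sum_(j | r j == v) mu j.
pose M v := Num.max (ml v) (mr v).
have ml0 v : 0 <= ml v by apply: sumr_ge0.
have mr0 v : 0 <= mr v by apply: sumr_ge0.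
have mlM v : ml v <= M v by rewrite le_max lexx.
have mrM v : mr v <= M v by rewrite le_max lexx orbT.
have M0 v : 0 <= M v by exact: le_trans (mlM v).
have muml i : mu i <= ml (l i) by rewrite /ml (bigD1 i)//= lerDl sumr_ge0.
have mumr j : mu j <= mr (r j) by rewrite /mr (bigD1 j)//= lerDl sumr_ge0.
pose A i := mu i * (1 - mr (l i) / M (l i)); pose B j := mu j * (1 - ml (r j) / M (r j)).
have q1 x v : 0 <= x -> x <= M v -> 0 <= 1 - x / M v.
  move=> x0 xM; rewrite subr_ge0; have [->|Mn0] := eqVneq (M v) 0; first by rewrite invr0 mulr0.
  by rewrite ler_pdivrMr ?mul1r// lt_def Mn0 M0.
have A0 i : 0 <= A i by rewrite mulr_ge0// q1.
have B0 j : 0 <= B j by rewrite mulr_ge0// q1.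
pose D i j := if l i == r j then mu i * mu j / M (l i) else 0.
have D0 i j : 0 <= D i j by rewrite /D; case: ifP => // _; rewrite divr_ge0 ?mulr_ge0.
have DA i : \sum_j D i j = mu i - A i.
  rewrite /A mulrBr mulr1 opprB addrC subrK /D -big_mkcond/= mulrA /mr.
  rewrite mulr_sumr mulr_suml; apply: eq_bigl => j; exact: eq_sym.
have DB j : \sum_i D i j = mu j - B j.
  rewrite /B mulrBr mulr1 opprB addrC subrK /D -big_mkcond/= mulrA /ml.
  rewrite mulr_sumr mulr_suml; apply: eq_bigr => i /eqP ->; by rewrite [mu i * _]mulrC.
pose L := \sum_i A i.
have LB : \sum_j B j = L.
  have : \sum_i \sum_j D i j = \sum_j \sum_i D i j by exact: exchange_big.
  rewrite (eq_bigr _ (fun i _ => DA i)) (eq_bigr _ (fun j _ => DB j)) !sumrB.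
  by move=> /addrI/oppr_inj.
have L0 : 0 <= L by apply: sumr_ge0.
have L_A i : L = 0 -> A i = 0.
  by move=> /eqP; rewrite psumr_eq0// => /allP/(_ i); rewrite mem_index_enum => /(_ isT)/eqP.
have L_B j : L = 0 -> B j = 0.
  by rewrite -LB => /eqP; rewrite psumr_eq0// => /allP/(_ j); rewrite mem_index_enum => /(_ isT)/eqP.
exists (fun i j => D i j + A i * B j / L); split.
- by move=> i j; apply: addr_ge0 => //; apply: divr_ge0 => //; exact: mulr_ge0.
- move=> i; rewrite big_split/= DA -mulr_suml -mulr_sumr LB.
  have [L_0|Ln0] := eqVneq L 0; first by rewrite L_A// mul0r mul0r addr0 subr0.
  by rewrite mulfK// subrK.
- move=> j; rewrite big_split/= DB -mulr_suml -mulr_suml -/L.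
  have [L_0|Ln0] := eqVneq L 0; first by rewrite L_B// mulr0 mul0r addr0 subr0.
  by rewrite mulrC mulrA mulVf// mul1r subrK.
- move=> i j i' j'; rewrite /D => + lr; rewrite (negbTE (introN eqP lr)) add0r => pij.
  move=> + lr'; rewrite (negbTE (introN eqP lr')) add0r => pij' E.
  have Ai : 0 < A i.
    rewrite lt_def A0 andbT; apply/negP => /eqP A_0.
    by move: pij; rewrite A_0 !mul0r ltxx.
  have Bj : 0 < B j'.
    rewrite lt_def B0 andbT; apply/negP => /eqP B_0.
    by move: pij'; rewrite B_0 mulr0 mul0r ltxx.
  have lt1 x v : 0 < 1 - x / M v -> M v != 0 -> x < M v.
    by rewrite subr_gt0 => xM Mn0; rewrite ltr_pdivrMr ?mul1r// lt_def Mn0 M0 in xM.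
  have pos1 (x y : R) : 0 <= x -> 0 < x * y -> 0 < x /\ 0 < y.
    move=> x0 xy; have x_gt0 : 0 < x.
      rewrite lt_def x0 andbT; apply/negP => /eqP x_0.
      by move: xy; rewrite x_0 mul0r ltxx.
    by move: xy; rewrite pmulr_rgt0.
  have [mi ai] := pos1 _ _ (mu0 i) Ai; have [mj bj] := pos1 _ _ (mu0 j') Bj.
  have Mi : M (l i) != 0 by rewrite gt_eqF// (lt_le_trans mi)// (le_trans (muml i)).
  have Mj : M (r j') != 0 by rewrite gt_eqF// (lt_le_trans mj)// (le_trans (mumr j')).
  have := lt1 _ _ ai Mi; have := lt1 _ _ bj Mj.
  by rewrite -E /M !lt_max !ltxx/= orbF => /lt_trans/[apply]; rewrite ltxx.
Qed.

#[local] Opaque ltrace rtrace sbv_deriv integral glue.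

Section families.
Context {R : realType}.
Local Notation leb := (@lebesgue_measure R).
Local Notation plane := (R * R)%type.
Variables (a b : R) (F : seq R).
Hypothesis uF : uniq F.
Hypothesis FI : [set` F] `<=` `]a, b[%classic.
Let I : set R := `]a, b[.
Let IF : set R := I `\` [set` F].

Definition tame (u : R -> R) := SBV a b u /\ jump_set a b u `<=` [set` F].

Lemma tame_finite u : tame u -> finite_set (jump_set a b u).
Proof. by move=> [_ /sub_finite_set]; apply; exact: finite_seq. Qed.

Let mIF : measurable IF.
Proof.
apply: measurableD; first exact: measurable_itv.
by apply: measurable_finite_set; exact: finite_seq.
Qed.

Definition flat_part (u : R -> R) : set plane := graph_over (ltrace u) IF.

Lemma measurable_flat u : tame u -> measurable (flat_part u).
Proof. by move=> tu; have [su SF] := tu; exact: (measurable_flat_part su (tame_finite tu) SF). Qed.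

Lemma H1_flat_fin u : tame u -> (H1 R (flat_part u) < +oo)%E.
Proof. by move=> tu; have [su SF] := tu; exact: (H1_flat_part_fin su (tame_finite tu) SF). Qed.

Lemma nice_tame u : tame u -> nice_current a b (Gamma a b u).
Proof. by move=> tu; have [su _] := tu; exact: nice_Gamma su (tame_finite tu). Qed.

(* kappa, either tan1 or tan2, turns the slope into a component of the unit tangent *)
Definition flat_act (kappa : R -> R) (u : R -> R) (p : plane -> R) : R :=
  \int[H1 R]_(z in flat_part u) (p z * kappa (slope a b u z.1)).

Definition tan1 (d : R) : R := (Num.sqrt (1 + d ^+ 2))^-1.
Definition tan2 (d : R) : R := d / Num.sqrt (1 + d ^+ 2).

Lemma nrm_sqrt_gt0 (d : R) : 0 < Num.sqrt (1 + d ^+ 2).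
Proof. by rewrite sqrtr_gt0 (lt_le_trans ltr01)// lerDl sqr_ge0. Qed.

Lemma measurable_tan1 : measurable_fun setT tan1.
Proof.
apply: measurable_funV_gt0 => [d _|]; first exact: nrm_sqrt_gt0.
apply: measurableT_comp; first exact: continuous_measurable_fun (@sqrt_continuous R).
by apply: measurable_funD => //; exact: measurable_funX.
Qed.

Lemma measurable_tan2 : measurable_fun setT tan2.
Proof. by apply: measurable_funM => //; exact: measurable_tan1. Qed.

Lemma tan1_le1 d : `|tan1 d| <= 1.
Proof.
rewrite gtr0_norm ?invr_gt0 ?nrm_sqrt_gt0// invf_le1 ?nrm_sqrt_gt0//.
by rewrite -[leLHS]sqrtr1 ler_sqrt ?lerDl ?sqr_ge0// addr_ge0 ?sqr_ge0.
Qed.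

Lemma tan2_le1 d : `|tan2 d| <= 1.
Proof.
rewrite normrM [`|_^-1|]gtr0_norm ?invr_gt0 ?nrm_sqrt_gt0// ler_pdivrMr ?nrm_sqrt_gt0// mul1r.
by rewrite -sqrtr_sqr ler_sqrt ?lerDr// addr_ge0 ?sqr_ge0.
Qed.

Definition bounded_form (p : plane -> R) := exists a1 b1 a2 b2 : R,
  [/\ a < a1, b1 < b & bounded_on (obox a1 b1 a2 b2) p].

Lemma act_tame1 u p : tame u -> bounded_form p ->
  act (Gamma a b u) (fst \o orient (Gamma a b u)) p = flat_act tan1 u p.
Proof.
move=> tu [a1 [b1 [a2 [b2 [aa1 b1b bp]]]]]; have [su SF] := tu.
exact: (act_Gamma_fst su (tame_finite tu) uF SF FI aa1 b1b bp).
Qed.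

Lemma act_tame2 u p : tame u -> bounded_form p ->
  act (Gamma a b u) (snd \o orient (Gamma a b u)) p =
  flat_act tan2 u p + \sum_(s <- F) vert u p s.
Proof.
move=> tu [a1 [b1 [a2 [b2 [aa1 b1b bp]]]]]; have [su SF] := tu.
rewrite (act_Gamma_snd su (tame_finite tu) uF SF FI aa1 b1b bp); congr (_ + _).
by apply: eq_Rintegral => z _; rewrite mulrA.
Qed.

Lemma measurable_slope_fst u : tame u -> measurable_fun setT (fun z : plane => slope a b u z.1).
Proof. by move=> tu; have [su _] := tu; exact: measurableT_comp (measurable_slope su) measurable_fst. Qed.

Lemma bounded_formM p (A : set plane) : bounded_form p -> measurable A ->
  bounded_form (fun z => p z * \1_A z).
Proof.
move=> [a1 [b1 [a2 [b2 [aa1 b1b [mp [C pC] p0]]]]]] mA.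
exists a1, b1, a2, b2; split => //; split.
- by apply: measurable_funM => //; exact: measurable_indic.
- exists C => z; rewrite normrM indicE; apply: le_trans (pC z).
  by case: (_ \in _); rewrite ?normr1 ?normr0 ?mulr1 ?mulr0.
- by move=> z /p0 ->; rewrite mul0r.
Qed.

Section flat_act_props.
Variable kappa : R -> R.
Hypothesis mk : measurable_fun setT kappa.
Hypothesis k1 : forall d, `|kappa d| <= 1.

Let mks u : tame u -> measurable_fun setT (fun z : plane => kappa (slope a b u z.1)).
Proof. by move=> tu; exact: measurableT_comp mk (measurable_slope_fst tu). Qed.

Lemma flat_act_integrable u p : tame u -> bounded_form p ->
  (H1 R).-integrable (flat_part u) (EFin \o (fun z => p z * kappa (slope a b u z.1))).
Proof.
move=> tu [a1 [b1 [a2 [b2 [aa1 b1b [mp [C pC] p0]]]]]].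
apply: (bounded_fun_integrable (H1 R) (measurable_H1 (measurable_flat tu)) (C := C)).
- exact: H1_flat_fin.
- by apply: measurable_funTS_H1; apply: measurable_funM => //; exact: mks.
- by move=> z _; rewrite normrM -[leRHS]mulr1 ler_pM.
Qed.

Lemma flat_actD u p q : tame u -> bounded_form p -> bounded_form q ->
  flat_act kappa u (fun z => p z + q z) = flat_act kappa u p + flat_act kappa u q.
Proof.
move=> tu bp bq; rewrite /flat_act -RintegralD//; try exact: flat_act_integrable.
  by apply: eq_Rintegral => z _; rewrite mulrDl.
exact: measurable_H1 (measurable_flat tu).
Qed.

Lemma flat_act_eq u p q : (forall z, flat_part u z -> p z = q z) ->
  flat_act kappa u p = flat_act kappa u q.
Proof. by move=> pq; apply: eq_Rintegral => z; rewrite inE => /pq ->. Qed.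

Lemma flat_act_ext u v (A : set R) p : tame u -> tame v -> measurable A ->
  (forall x, IF x -> A x -> ltrace u x = ltrace v x) ->
  {ae leb, forall x, a < x < b -> A x -> slope a b u x = slope a b v x} ->
  bounded_form p -> (forall z, ~ A z.1 -> p z = 0) ->
  flat_act kappa u p = flat_act kappa v p.
Proof.
move=> tu tv mA tr [Z [mZ Z0 sZ]] [a1 [b1 [a2 [b2 [aa1 b1b [mp _ _]]]]]] pA.
have restr w : tame w -> flat_act kappa w p =
    \int[H1 R]_(z in graph_over (ltrace w) (IF `&` A)) (p z * kappa (slope a b w z.1)).
  move=> tw; have -> : graph_over (ltrace w) (IF `&` A) = flat_part w `&` fst @^-1` A.
    by apply/seteqP; split=> z /= [[? ?] ?]; split.
  rewrite Rintegral_mkcondr; apply: eq_Rintegral => z _; rewrite patchE.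
  by case: ifPn => //; rewrite notin_setE => /pA ->; rewrite mul0r.
rewrite (restr _ tu) (restr _ tv).
have -> : graph_over (ltrace v) (IF `&` A) = graph_over (ltrace u) (IF `&` A).
  by apply/seteqP; split => z [[Iz Az] zE]; split => //; rewrite zE tr.
have mG : measurable (graph_over (ltrace u) (IF `&` A)).
  have [su SF] := tu; apply: (measurable_graph_over su (tame_finite tu)).
    exact: measurableI.
  by move=> x [[Ix Fx] _]; split => // /SF.
rewrite /Rintegral; apply: (f_equal fine); apply: ae_eq_integral.
- exact: measurable_H1.
- by apply/measurable_EFinP; apply: measurable_funTS_H1; apply: measurable_funM => //; exact: mks.
- by apply/measurable_EFinP; apply: measurable_funTS_H1; apply: measurable_funM => //; exact: mks.
- exists [set z | flat_part u z /\ Z z.1]; split.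
  + apply: measurable_H1; apply: measurableI; first exact: measurable_flat.
    by rewrite -[X in measurable X]setTI; exact: measurable_fst.
  + have [su SF] := tu; exact: (H1_flat_null su (tame_finite tu) SF mZ Z0).
  + move=> z /= nz; apply: contrapT => /not_andP nZ; apply: nz => -[[Iz Az] zE].
    case: nZ => [nf|nZ]; first by exfalso; apply: nf; split.
    have /contrapT E : ~ ~ (a < z.1 < b -> A z.1 -> slope a b u z.1 = slope a b v z.1).
      by move=> nE; apply: nZ; exact: sZ.
    have [Iz1 _] := Iz; have zab : a < z.1 < b by move: Iz1; rewrite /I/= in_itv.
    by rewrite (E zab Az).
Qed.

End flat_act_props.

Lemma tame_glue c u v : c \in F -> tame u -> tame v -> tame (glue c u v).
Proof.
move=> cF tu tv; have [su SFu] := tu; have [sv SFv] := tv.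
have cab : a < c < b by have := FI cF; rewrite /= in_itv.
split; last first.
  move=> x; have [xc /jump_set_glue_lt|cx /jump_set_glue_gt|->] := ltgtP x c; last by [].
    by move=> /(_ xc)/SFu.
  by move=> /(_ cx)/SFv.
split; first exact: integrable_glue su.1 sv.1.
exists (glue c (sbv_deriv a b u) (sbv_deriv a b v)).
exact: (glue_sbv cab su.1 sv.1 (sbv_derivP su) (sbv_derivP sv) (tame_finite tu) (tame_finite tv)).
Qed.

Lemma slope_glue_ae (c : R) (u v : R -> R) : a < c < b -> tame u -> tame v ->
  {ae leb, forall x, a < x < b -> slope a b (glue c u v) x = glue c (slope a b u) (slope a b v) x}.
Proof.
move=> cab tu tv; have [su _] := tu; have [sv _] := tv.
have iw := integrable_glue c su.1 sv.1.
have wf := glue_sbv cab su.1 sv.1 (sbv_derivP su) (sbv_derivP sv) (tame_finite tu) (tame_finite tv).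
have sw : SBV a b (glue c u v) by split => //; exists (glue c (sbv_deriv a b u) (sbv_deriv a b v)).
have fw := finite_jump_set_glue c (tame_finite tu) (tame_finite tv).
apply: ae_imply (sbv_derivative_ae_unique iw (sbv_derivP sw) wf fw) => x E xab.
have xI : x \in `]a, b[%classic by apply/mem_set; rewrite /= in_itv.
rewrite /slope patchE xI (E xab); have [xc|cx] := ltP x c.
  by rewrite (glue_lt _ _ xc) (glue_lt _ _ xc) patchE xI.
by rewrite (glue_ge _ _ cx) (glue_ge _ _ cx) patchE xI.
Qed.

Lemma flat_act_glue (kappa : R -> R) (c : R) (u v : R -> R) p :
  measurable_fun setT kappa -> (forall d, `|kappa d| <= 1) ->
  c \in F -> tame u -> tame v -> bounded_form p ->
  flat_act kappa (glue c u v) p =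
  flat_act kappa u (fun z => p z * \1_[set z : plane | z.1 < c] z) +
  flat_act kappa v (fun z => p z * \1_[set z : plane | c < z.1] z).
Proof.
move=> mk k1 cF tu tv bp; have tw := tame_glue cF tu tv.
have cab : a < c < b by have := FI cF; rewrite /= in_itv.
have ml : measurable [set z : plane | z.1 < c].
  rewrite (_ : mkset _ = fst @^-1` `]-oo, c[%classic); last first.
    by apply/seteqP; split=> z /=; rewrite in_itv.
  by rewrite -[X in measurable X]setTI; apply: measurable_fst => //; exact: measurable_itv.
have mr : measurable [set z : plane | c < z.1].
  rewrite (_ : mkset _ = fst @^-1` `]c, +oo[%classic); last first.
    by apply/seteqP; split=> z /=; rewrite in_itv/= andbT.
  by rewrite -[X in measurable X]setTI; apply: measurable_fst => //; exact: measurable_itv.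
have bl := bounded_formM bp ml; have br := bounded_formM bp mr.
have sae := slope_glue_ae cab tu tv.
transitivity (flat_act kappa (glue c u v)
    (fun z => p z * \1_[set z : plane | z.1 < c] z + p z * \1_[set z : plane | c < z.1] z)).
  apply: flat_act_eq => z [[_ /= zF] _]; rewrite !indicE -mulrDr.
  have [zc|cz|zc] := ltgtP z.1 c; last by exfalso; apply: zF; rewrite zc.
    by rewrite mem_set// memNset/= ?ltNge ?(ltW zc)// addr0 mulr1.
  by rewrite memNset/= ?mem_set ?ltNge ?(ltW cz)// add0r mulr1.
rewrite (flat_actD mk k1 tw bl br).
have -> : flat_act kappa (glue c u v) (fun z => p z * \1_[set z : plane | z.1 < c] z) =
    flat_act kappa u (fun z => p z * \1_[set z : plane | z.1 < c] z).
  apply: (@flat_act_ext kappa mk (glue c u v) u (`]-oo, c[%classic : set R) _ tw tu _ _ _ bl); first exact: measurable_itv.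
  + by move=> x _; rewrite /= in_itv/= => /ltW/ltrace_glue_le.
  + by apply: ae_imply sae => x E /E ->; rewrite /= in_itv/= => /glue_lt.
  + by move=> z; rewrite /= in_itv/= => nz; rewrite indicE memNset ?mulr0.
have -> : flat_act kappa (glue c u v) (fun z => p z * \1_[set z : plane | c < z.1] z) =
    flat_act kappa v (fun z => p z * \1_[set z : plane | c < z.1] z); last by [].
apply: (@flat_act_ext kappa mk (glue c u v) v (`]c, +oo[%classic : set R) _ tw tv _ _ _ br); first exact: measurable_itv.
+ by move=> x _; rewrite /= in_itv/= andbT => /ltrace_glue_gt.
+ by apply: ae_imply sae => x E /E ->; rewrite /= in_itv/= andbT => /ltW/glue_ge.
+ by move=> z; rewrite /= in_itv/= andbT => nz; rewrite indicE memNset ?mulr0.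
Qed.

Lemma glue_id (c : R) (u : R -> R) : glue c u u = u.
Proof.
by apply/funext => x; have [xc|cx] := ltP x c; [rewrite (glue_lt _ _ xc)|rewrite (glue_ge _ _ cx)].
Qed.

Lemma flat_act_split (kappa : R -> R) (c : R) (u : R -> R) p :
  measurable_fun setT kappa -> (forall d, `|kappa d| <= 1) ->
  c \in F -> tame u -> bounded_form p ->
  flat_act kappa u p =
  flat_act kappa u (fun z => p z * \1_[set z : plane | z.1 < c] z) +
  flat_act kappa u (fun z => p z * \1_[set z : plane | c < z.1] z).
Proof.
by move=> mk k1 cF tu bp; rewrite -(flat_act_glue mk k1 cF tu tu bp) glue_id.
Qed.

Definition below (q : plane -> R) (x y : R) : R := \int[leb]_(t in `]-oo, y]) q (x, t).

Lemma bounded_form_line q x : bounded_form q -> leb.-integrable setT (EFin \o (fun t => q (x, t))).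
Proof.
move=> [a1 [b1 [a2 [b2 [_ _ [mq [C qC] q0]]]]]].
have -> : EFin \o (fun t => q (x, t)) = (EFin \o (fun t => q (x, t))) \_ `]a2, b2[%classic.
  apply/funext => t; rewrite patchE; case: ifPn => //; rewrite notin_setE => nt.
  by rewrite /= q0// => -[_ /=].
apply: (integrable_mkcond (mu := leb) _ (measurable_itv _)).1.
have fin : (leb `]a2, b2[%classic < +oo)%E.
  by rewrite lebesgue_measure_itv/=; case: ifP => _; rewrite ltry.
apply: (bounded_fun_integrable leb (measurable_itv _) fin (C := C)) => //.
by apply: measurable_funTS; exact: measurableT_comp mq (pair1_measurable x).
Qed.

Lemma belowB q x y1 y2 : bounded_form q -> y1 <= y2 ->
  below q x y2 - below q x y1 = \int[leb]_(t in `[y1, y2]) q (x, t).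
Proof.
move=> bq y12; have iq := bounded_form_line x bq.
rewrite /below Rintegral_itvB ?bnd_simp//; last by apply: integrableS iq.
by apply: Rintegral_itv_obnd_cbnd; apply: integrableS iq.
Qed.

Lemma vertE u q x : bounded_form q ->
  vert u q x = below q x (rtrace u x) - below q x (ltrace u x).
Proof.
move=> bq; rewrite /vert /vseg /lower_trace /upper_trace.
have [lr|rl|->] := ltgtP (ltrace u x) (rtrace u x).
- by rewrite gtr0_sg ?subr_gt0// mul1r belowB// ltW.
- by rewrite ltr0_sg ?subr_lt0// mulN1r -belowB ?ltW// opprB.
- by rewrite !subrr sgr0 mul0r.
Qed.

Section carried.
#[local] Opaque flat_act vert act.
Variable T : rcurrent R.

Definition carried (J : finType) (mu : J -> R) (w : J -> R -> R) := forall p, bounded_form p ->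
  act T (fst \o orient T) p = \sum_j mu j * flat_act tan1 (w j) p /\
  act T (snd \o orient T) p =
    \sum_j mu j * (flat_act tan2 (w j) p + \sum_(s <- F) vert (w j) p s).

(* No vertical segments cancel at s: no height is both the start of one jump
   and the end of another. *)
Definition uncancelled (J : finType) (mu : J -> R) (w : J -> R -> R) (s : R) :=
  forall i j, 0 < mu i -> 0 < mu j -> ltrace (w i) s <> rtrace (w i) s ->
    ltrace (w j) s <> rtrace (w j) s -> ltrace (w i) s <> rtrace (w j) s.

Lemma recouple (J : finType) (mu : J -> R) (w : J -> R -> R) (c : R) : c \in F ->
  (forall j, 0 <= mu j) -> (forall j, tame (w j)) -> carried mu w ->
  exists nu : J * J -> R, let w' ij := glue c (w ij.1) (w ij.2) in
    [/\ forall ij, 0 <= nu ij, carried nu w', uncancelled nu w' c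
      & forall s, s != c -> uncancelled mu w s -> uncancelled nu w' s].
Proof.
move=> cF mu0 tw Tw.
have [pi [pi0 pil pir pic]] := coupling (fun j => ltrace (w j) c) (fun j => rtrace (w j) c) mu0.
exists (fun ij => pi ij.1 ij.2) => w'.
have pile i j : pi i j <= mu i by rewrite -pil (bigD1 j)//= lerDl sumr_ge0.
have pire i j : pi i j <= mu j by rewrite -pir (bigD1 i)//= lerDl sumr_ge0.
have marg1 (f : J -> R) : \sum_ij pi ij.1 ij.2 * f ij.1 = \sum_j mu j * f j.
  rewrite -(pair_bigA _ (fun i j => pi i j * f i))/=; apply: eq_bigr => i _.
  by rewrite -mulr_suml pil.
have marg2 (f : J -> R) : \sum_ij pi ij.1 ij.2 * f ij.2 = \sum_j mu j * f j.
  rewrite -(pair_bigA _ (fun i j => pi i j * f j))/= exchange_big/=; apply: eq_bigr => j _.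
  by rewrite -mulr_suml pir.
have lin (kappa : R -> R) p : measurable_fun setT kappa -> (forall d, `|kappa d| <= 1) ->
    bounded_form p ->
    \sum_ij pi ij.1 ij.2 * flat_act kappa (w' ij) p = \sum_j mu j * flat_act kappa (w j) p.
  move=> mk k1 bp.
  under eq_bigr do rewrite (flat_act_glue mk k1 cF (tw _) (tw _) bp) mulrDr.
  under [RHS]eq_bigr do rewrite (flat_act_split mk k1 cF (tw _) bp) mulrDr.
  rewrite !big_split/=; congr (_ + _).
    exact: (marg1 (fun i => flat_act kappa (w i) (fun z => p z * \1_[set z : plane | z.1 < c] z))).
  exact: (marg2 (fun i => flat_act kappa (w i) (fun z => p z * \1_[set z : plane | c < z.1] z))).
have linv p s : bounded_form p ->
    \sum_ij pi ij.1 ij.2 * vert (w' ij) p s = \sum_j mu j * vert (w j) p s.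
  move=> bp; under eq_bigr do rewrite (vertE _ _ bp).
  under [RHS]eq_bigr do rewrite (vertE _ _ bp) mulrBr.
  rewrite sumrB; have [sc|cs|->] := ltgtP s c.
  - under eq_bigr do rewrite rtrace_glue_lt// ltrace_glue_le ?ltW// mulrBr.
    rewrite sumrB; congr (_ - _).
      exact: (marg1 (fun i => below p s (rtrace (w i) s))).
    exact: (marg1 (fun i => below p s (ltrace (w i) s))).
  - under eq_bigr do rewrite rtrace_glue_ge ?ltW// ltrace_glue_gt// mulrBr.
    rewrite sumrB; congr (_ - _).
      exact: (marg2 (fun i => below p s (rtrace (w i) s))).
    exact: (marg2 (fun i => below p s (ltrace (w i) s))).
  - under eq_bigr do rewrite rtrace_glue_ge// ltrace_glue_le// mulrBr.
    rewrite sumrB; congr (_ - _).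
      exact: (marg2 (fun i => below p c (rtrace (w i) c))).
    exact: (marg1 (fun i => below p c (ltrace (w i) c))).
split; first by move=> ij; exact: pi0.
- move=> p bp; have [-> ->] := Tw p bp; split.
    by rewrite (lin _ _ measurable_tan1 tan1_le1 bp).
  under eq_bigr do rewrite mulrDr; under [RHS]eq_bigr do rewrite mulrDr.
  rewrite big_split [RHS]big_split/= (lin _ _ measurable_tan2 tan2_le1 bp).
  under [X in _ + X]eq_bigr do rewrite mulr_sumr.
  under [X in _ = _ + X]eq_bigr do rewrite mulr_sumr.
  rewrite [X in _ + X]exchange_big [X in _ = _ + X]exchange_big/=.
  by under [X in _ = _ + X]eq_bigr do rewrite (linv _ _ bp).
- have L ij : ltrace (w' ij) c = ltrace (w ij.1) c by apply: ltrace_glue_le; exact: lexx.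
  have Rr ij : rtrace (w' ij) c = rtrace (w ij.2) c by apply: rtrace_glue_ge; exact: lexx.
  move=> ij ij' p1 p2; rewrite !L !Rr => n1 n2.
  exact: (pic _ _ _ _ p1 n1 p2 n2).
- move=> s sc us ij ij' p1 p2.
  have [lt|gt|e] := ltgtP s c; last by rewrite e eqxx in sc.
    have L k : ltrace (w' k) s = ltrace (w k.1) s by apply: ltrace_glue_le; exact: ltW lt.
    have Rr k : rtrace (w' k) s = rtrace (w k.1) s by apply: rtrace_glue_lt; exact: lt.
    rewrite !L !Rr; apply: us; [exact: lt_le_trans p1 (pile _ _)|exact: lt_le_trans p2 (pile _ _)].
  have L k : ltrace (w' k) s = ltrace (w k.2) s by apply: ltrace_glue_gt; exact: gt.
  have Rr k : rtrace (w' k) s = rtrace (w k.2) s by apply: rtrace_glue_ge; exact: ltW gt.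
  rewrite !L !Rr; apply: us; [exact: lt_le_trans p1 (pire _ _)|exact: lt_le_trans p2 (pire _ _)].
Qed.

Lemma recouple_all (J : finType) (mu : J -> R) (w : J -> R -> R) (D : seq R) :
  (forall s, s \in D -> s \in F) ->
  (forall j, 0 <= mu j) -> (forall j, tame (w j)) -> carried mu w ->
  exists (K : finType) (nu : K -> R) (v : K -> R -> R),
    [/\ forall k, 0 <= nu k, forall k, tame (v k), carried nu v
      & forall s, s \in D -> uncancelled nu v s].
Proof.
move=> + mu0 tw Tw; elim: D => [_|c D IH DF]; first by exists J, mu, w.
have [|K [nu [v [nu0 tv Tv uv]]]] := IH.
  by move=> s sD; apply: DF; rewrite inE sD orbT.
have cF : c \in F by apply: DF; rewrite inE eqxx.
have [nu' [nu'0 Tv' uc uD]] := recouple cF nu0 tv Tv.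
exists (K * K)%type, nu', (fun ij => glue c (v ij.1) (v ij.2)).
split; [exact: nu'0|by move=> ij; exact: (tame_glue cF)|exact: Tv'|].
move=> s; rewrite inE; have [-> //|sc /= sD] := eqVneq s c.
exact: uD sc (uv s sD).
Qed.

End carried.

End families.

(** * The energy formula *)

(* Phi = alpha P / (P + Q), where P, Q vanish to second order exactly on L, Rr. *)
Lemma separating_potential {R : realType} (alpha : R) (L Rr : seq R) : 0 <= alpha ->
  (forall l r, l \in L -> r \in Rr -> l <> r) ->
  exists Phi psi : R -> R, [/\ forall x : R, is_derive x 1 Phi (psi x), continuous psi,
    forall x, 0 <= Phi x <= alpha, forall l, l \in L -> Phi l = 0
  & forall r, r \in Rr -> Phi r = alpha].
Proof.
move=> alpha0 LR.
pose P : {poly R} := \prod_(l <- L) ('X - l%:P) ^+ 2.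
pose Q : {poly R} := \prod_(r <- Rr) ('X - r%:P) ^+ 2.
have prodE (s : seq R) x : (\prod_(l <- s) ('X - l%:P) ^+ 2 : {poly R}).[x] = \prod_(l <- s) (x - l) ^+ 2.
  by rewrite horner_prod; apply: eq_bigr => l _; rewrite horner_exp !hornerE.
have P0 x : 0 <= P.[x] by rewrite prodE; apply: prodr_ge0 => l _; exact: sqr_ge0.
have Q0 x : 0 <= Q.[x] by rewrite prodE; apply: prodr_ge0 => l _; exact: sqr_ge0.
have root0 (s : seq R) x : \prod_(l <- s) (x - l) ^+ 2 = 0 <-> x \in s.
  split=> [/eqP|xs]; last by rewrite (big_rem x)//= subrr expr0n mul0r.
  rewrite prodf_seq_eq0 => /hasP[l ls]; rewrite /= sqrf_eq0 subr_eq0 => /eqP ->.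
  by [].
have PQ x : 0 < P.[x] + Q.[x].
  rewrite lt_def addr_ge0// andbT paddr_eq0//; apply/negP => /andP[/eqP Px /eqP Qx].
  have xL : x \in L by apply/root0; rewrite -prodE.
  have xR : x \in Rr by apply/root0; rewrite -prodE.
  exact: LR xL xR erefl.
have nz x : (P + Q).[x] != 0 by rewrite hornerD gt_eqF.
have cont (p : {poly R}) : continuous (horner p) by move=> x; exact: continuous_horner.
have dh (p : {poly R}) (x : R) : is_derive x 1 (horner p) p^`().[x].
  exact: is_derive_poly.
exists (fun x => alpha * (P.[x] / (P + Q).[x])).
exists (fun x => alpha * ((P^`() * Q - P * Q^`()).[x] / (P + Q).[x] ^+ 2)); split.
- move=> x.
  have dV := is_deriveV (nz x) (dh (P + Q) x).
  have dM := is_deriveM (dh P x) dV.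
  have dA := is_deriveM (is_derive_cst alpha x (1 : R)) dM.
  apply: (is_derive_eq dA).
  rewrite /GRing.scale/= derivD !hornerD hornerN !hornerM.
  have := nz x; rewrite hornerD; move: P.[x] Q.[x] P^`().[x] Q^`().[x] => p q p' q' n0.
  by field.
- move=> x; apply: cvgM; first exact: cvg_cst.
  apply: cvgM; first exact: cont.
  apply: cvgV; first by rewrite expf_neq0.
  by apply: cvgM; exact: cont.
- move=> x; rewrite hornerD mulr_ge0 ?divr_ge0 ?addr_ge0//= ler_piMr//.
  by rewrite ler_pdivrMr// mul1r lerDl.
- by move=> l lL; rewrite prodE (root0 L l).2// !mul0r mulr0.
- move=> r rR; have Q_0 : Q.[r] = 0 by rewrite prodE; exact/root0.
  by rewrite hornerD Q_0 addr0 divff ?mulr1// gt_eqF//; have := PQ r; rewrite Q_0 addr0.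
Qed.

#[local] Opaque flat_act.

Section cells.
Context {R : realType}.
Local Notation plane := (R * R)%type.
Variables (a b : R).

Lemma oboxP (x y s t : R) (z : plane) : obox x y s t z <-> x < z.1 < y /\ s < z.2 < t.
Proof. by rewrite /obox/= !in_itv. Qed.

Definition cell (n : nat) : set plane :=
  obox (a + n.+1%:R^-1) (b - n.+1%:R^-1) (- n%:R) n%:R.

Lemma cell_nested m n : (m <= n)%N -> cell m `<=` cell n.
Proof.
move=> mn z /oboxP[+ +]; have i : n.+1%:R^-1 <= m.+1%:R^-1 :> R.
  by rewrite lef_pV2 ?posrE// ler_nat.
have j : m%:R <= n%:R :> R by rewrite ler_nat.
move=> z1 z2; apply/oboxP; move: i j z1 z2.
move: (n.+1%:R^-1) (m.+1%:R^-1) (n%:R) (m%:R) => x y s t yx ts /andP[? ?] /andP[? ?].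
by split; apply/andP; split; lra.
Qed.

Lemma cell_near (z : plane) : strip a b z -> \forall n \near \oo, cell n z.
Proof.
move=> [/= + _]; rewrite in_itv/= => /andP[az zb].
pose e := Num.min (z.1 - a) (b - z.1).
have e0 : 0 < e by rewrite lt_min !subr_gt0 az.
have e1 : e <= z.1 - a by rewrite ge_min lexx.
have e2 : e <= b - z.1 by rewrite ge_min lexx orbT.
near=> n.
have ne : n.+1%:R^-1 < e by near: n; exact: near_infty_natSinv_lt (PosNum e0).
have nz : `|z.2| < n%:R by near: n; exact: nbhs_infty_gtr.
move: nz; rewrite ltr_norml => nz; apply/oboxP; split; last exact: nz.
by move: (n.+1%:R^-1) ne => x ne; apply/andP; split; lra.
Unshelve. all: by end_near. Qed.

Lemma bounded_form_cell n (p : plane -> R) : bounded_on (cell n) p -> bounded_form a b p.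
Proof.
move=> bp; exists (a + n.+1%:R^-1), (b - n.+1%:R^-1), (- n%:R), n%:R; split => //.
  by rewrite ltrDl invr_gt0.
by rewrite ltrBlDr ltrDl invr_gt0.
Qed.

Lemma measurable_strip : measurable (strip a b).
Proof. by apply: measurableX => //; exact: measurable_itv. Qed.

End cells.

Section functional.
Context {R : realType}.
Local Notation leb := (@lebesgue_measure R).
Local Notation plane := (R * R)%type.
Variables (a b : R) (F : seq R).
Hypothesis uF : uniq F.
Hypothesis FI : [set` F] `<=` `]a, b[%classic.
Variables (alpha beta : R).
Hypothesis alpha0 : 0 < alpha.
Hypothesis beta0 : 0 <= beta.
Variables (g h : R -> R).
Hypothesis mh : measurable_fun setT h.
Hypothesis gh : {ae leb, forall x, a < x < b -> g x = h x}.
Local Notation tame := (tame a b F).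
Local Notation flat_part := (flat_part a b F).
Local Notation flat_act := (flat_act a b F).
Local Notation slope := (slope a b).
Local Notation Kset := (Kset a b alpha beta g).

Definition density (u : R -> R) (z : plane) : R :=
  tan1 (slope u z.1) * (slope u z.1 ^+ 2 + beta * (z.2 - h z.1) ^+ 2).

Definition jump_cost (u : R -> R) : R :=
  \sum_(s <- F) if ltrace u s == rtrace u s then 0 else alpha.

Definition energy (u : R -> R) : \bar R :=
  (\int[H1 R]_(z in flat_part u) (density u z)%:E + (jump_cost u)%:E)%E.

Lemma tan1_gt0 (d : R) : 0 < tan1 d.
Proof. by rewrite invr_gt0 nrm_sqrt_gt0. Qed.

Lemma density_ge0 u z : 0 <= density u z.
Proof.
by rewrite mulr_ge0 ?(ltW (tan1_gt0 _))// addr_ge0 ?sqr_ge0// mulr_ge0 ?sqr_ge0.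
Qed.

Lemma measurable_density u : tame u -> measurable_fun setT (density u).
Proof.
move=> tu; have ms := measurable_slope_fst tu.
apply: measurable_funM; first exact: measurableT_comp (@measurable_tan1 R) ms.
apply: measurable_funD; first exact: measurable_funX.
apply: measurable_funM => //; apply: measurable_funX; apply: measurable_funB.
  exact: measurable_snd.
exact: measurableT_comp mh measurable_fst.
Qed.

Lemma flat_ae u (Z : set R) (P : plane -> Prop) : tame u -> measurable Z -> leb Z = 0%E ->
  (forall z, flat_part u z -> ~ Z z.1 -> P z) ->
  {ae (H1 R), forall z : H1plane R, flat_part u z -> P z}.
Proof.
move=> tu mZ Z0 ZP; exists [set z | flat_part u z /\ Z z.1]; split.
- apply: measurable_H1; apply: measurableI; first exact: measurable_flat.
  by rewrite -[X in measurable X]setTI; exact: measurable_fst.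
- have [su SF] := tu; exact: (H1_flat_null su (tame_finite tu) SF mZ Z0).
- move=> z /= nP; apply: contrapT => nz; apply: nP => fz; apply: ZP => // Zz.
  by apply: nz.
Qed.

Let kint u p q := fun z : plane => p z * tan2 (slope u z.1) - q z * tan1 (slope u z.1).

Let kint_integrable u p q : tame u -> bounded_form a b p -> bounded_form a b q ->
  (H1 R).-integrable (flat_part u) (EFin \o kint u p q).
Proof.
move=> tu bp bq; have mF := measurable_H1 (measurable_flat tu).
apply: (integrable_sub (H1 R) mF).
  exact: (flat_act_integrable (@measurable_tan2 R) (@tan2_le1 R) tu bp).
exact: (flat_act_integrable (@measurable_tan1 R) (@tan1_le1 R) tu bq).
Qed.

Let flat_actB u p q : tame u -> bounded_form a b p -> bounded_form a b q ->
  (flat_act (@tan2 R) u p - flat_act (@tan1 R) u q)%:E =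
  (\int[H1 R]_(z in flat_part u) (kint u p q z)%:E)%E.
Proof.
move=> tu bp bq; have mF := measurable_H1 (measurable_flat tu).
rewrite -RintegralB//.
- by rewrite /Rintegral fineK//; exact: integrable_fin_num (kint_integrable tu bp bq).
- exact: (flat_act_integrable (@measurable_tan2 R) (@tan2_le1 R) tu bp).
- exact: (flat_act_integrable (@measurable_tan1 R) (@tan1_le1 R) tu bq).
Qed.

Lemma flat_le u p q (Z : set R) (e : plane -> R) : tame u -> bounded_form a b p ->
  bounded_form a b q -> measurable Z -> leb Z = 0%E ->
  measurable_fun setT e -> (forall z, 0 <= e z) ->
  (forall z, flat_part u z -> ~ Z z.1 -> kint u p q z <= e z) ->
  ((flat_act (@tan2 R) u p - flat_act (@tan1 R) u q)%:E <=
   \int[H1 R]_(z in flat_part u) (e z)%:E)%E.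
Proof.
move=> tu bp bq mZ Z0 me e0 ke; have mF := measurable_H1 (measurable_flat tu).
have ik := kint_integrable tu bp bq.
rewrite (flat_actB tu bp bq) integralE.
apply: (@le_trans _ _ (\int[H1 R]_(z in flat_part u) ((EFin \o kint u p q)^\+ z))%E).
  rewrite leeBlDr; last exact: integral_fune_fin_num (integrable_funeneg mF ik).
  by rewrite leeDl//; apply: integral_ge0.
apply: ae_ge0_le_integral.
- exact: mF.
- by move=> z _; exact: funepos_ge0.
- by apply: measurable_funepos; case/integrableP : ik.
- by move=> z _; rewrite lee_fin.
- by apply/measurable_EFinP; exact: measurable_funTS_H1.
- apply: (flat_ae tu mZ Z0) => z fz nZ; rewrite funeposE ge_max !lee_fin e0 andbT.
  exact: ke.
Qed.

Lemma flat_ge u p q (Z : set R) (e : plane -> R) : tame u -> bounded_form a b p ->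
  bounded_form a b q -> measurable Z -> leb Z = 0%E ->
  measurable_fun setT e -> (forall z, 0 <= e z) ->
  (forall z, flat_part u z -> ~ Z z.1 -> e z <= kint u p q z) ->
  (\int[H1 R]_(z in flat_part u) (e z)%:E <=
   (flat_act (@tan2 R) u p - flat_act (@tan1 R) u q)%:E)%E.
Proof.
move=> tu bp bq mZ Z0 me e0 ke; have mF := measurable_H1 (measurable_flat tu).
have ik := kint_integrable tu bp bq.
rewrite (flat_actB tu bp bq) [leRHS]integralE.
have -> : (\int[H1 R]_(z in flat_part u) ((EFin \o kint u p q)^\- z) = 0)%E.
  apply/eqP; rewrite eq_le integral_ge0// andbT -(@integral0 _ _ _ (H1 R) (flat_part u)).
  apply: ae_ge0_le_integral.
  - exact: mF.
  - by move=> z _; exact: funeneg_ge0.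
  - by apply: measurable_funeneg; case/integrableP : ik.
  - by [].
  - exact: measurable_cst.
  - apply: (flat_ae tu mZ Z0) => z fz nZ; rewrite funenegE ge_max lexx andbT /=.
    by rewrite lee_fin oppr_le0 (le_trans (e0 z))// ke.
rewrite sube0; apply: ae_ge0_le_integral.
- exact: mF.
- by move=> z _; rewrite lee_fin.
- by apply/measurable_EFinP; exact: measurable_funTS_H1.
- by move=> z _; exact: funepos_ge0.
- by apply: measurable_funepos; case/integrableP : ik.
- apply: (flat_ae tu mZ Z0) => z fz nZ; rewrite funeposE le_max /= lee_fin.
  by rewrite ke.
Qed.

Section competitor_bound.
Variables (T : rcurrent R) (nT : nice_current a b T).
Variables (J : finType) (mu : J -> R) (w : J -> R -> R).
Hypothesis mu0 : forall j, 0 <= mu j.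
Hypothesis tw : forall j, tame (w j).
Hypothesis Tw : carried a b F T mu w.
Variable phi : plane -> plane.
Hypothesis Kphi : Kset phi.

Let f1 : plane -> R := (fst \o phi) \_ (strip a b).
Let f2 : plane -> R := (snd \o phi) \_ (strip a b).

Let mf1 : measurable_fun setT f1.
Proof.
have [mphi _ _] := Kphi.
apply/(measurable_restrictT _ _).1; first exact: measurable_strip.
exact: measurableT_comp measurable_fst mphi.
Qed.

Let mf2 : measurable_fun setT f2.
Proof.
have [mphi _ _] := Kphi.
apply/(measurable_restrictT _ _).1; first exact: measurable_strip.
exact: measurableT_comp measurable_snd mphi.
Qed.

Let A n : set plane := cell a b n `&` [set z | `|f1 z| <= n%:R /\ `|f2 z| <= n%:R].

Let mA n : measurable (A n).
Proof.
apply: measurableI; first exact: measurable_obox.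
have E : [set z | `|f1 z| <= n%:R /\ `|f2 z| <= n%:R] =
   ((fun z => `|f1 z|) @^-1` `]-oo, n%:R]) `&` ((fun z => `|f2 z|) @^-1` `]-oo, n%:R]).
  by apply/seteqP; split => z /=; rewrite !in_itv.
rewrite E; apply: measurableI; rewrite -[X in measurable X]setTI.
  by apply: (measurableT_comp (@normr_measurable R setT) mf1) => //; exact: measurable_itv.
by apply: (measurableT_comp (@normr_measurable R setT) mf2) => //; exact: measurable_itv.
Qed.

Let A_nested m n : (m <= n)%N -> A m `<=` A n.
Proof.
move=> mn z [zc [z1 z2]]; split; first exact: cell_nested zc.
by split; [apply: le_trans z1 _|apply: le_trans z2 _]; rewrite ler_nat.
Qed.

Let A_near z : strip a b z -> \forall n \near \oo, A n z.
Proof.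
move=> zs; near=> n; split; first by near: n; exact: cell_near.
by split; apply: ltW; near: n; exact: nbhs_infty_gtr.
Unshelve. all: by end_near. Qed.

Let p n z := f1 z * \1_(A n) z.
Let q n z := f2 z * \1_(A n) z.

Let bform (f : plane -> R) n : measurable_fun setT f ->
  (forall z, A n z -> `|f z| <= n%:R) -> bounded_form a b (fun z => f z * \1_(A n) z).
Proof.
move=> mf fn; apply: (@bounded_form_cell _ _ _ n); split.
- by apply: measurable_funM => //; exact: measurable_indic.
- exists n%:R => z; rewrite indicE; have [Az|Az] := pselect (A n z).
    by rewrite mem_set// mulr1 fn.
  by rewrite memNset// mulr0 normr0.
- by move=> z nc; rewrite indicE memNset ?mulr0// => -[].
Qed.

Let bp n : bounded_form a b (p n). Proof. by apply: bform => // z [_ []]. Qed.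
Let bq n : bounded_form a b (q n). Proof. by apply: bform => // z [_ []]. Qed.

Let phi_f z : strip a b z -> phi z = (f1 z, f2 z).
Proof. by move=> zs; rewrite /f1 /f2 !patchE mem_set//=; case: (phi z). Qed.

Let flat_bound j n :
  ((flat_act (@tan2 R) (w j) (p n) - flat_act (@tan1 R) (w j) (q n))%:E <=
   \int[H1 R]_(z in flat_part (w j)) (density (w j) z)%:E)%E.
Proof.
have [Z [mZ Z0 gZ]] := gh; have [_ Kc _] := Kphi.
apply: (flat_le (tw j) (bp n) (bq n) mZ Z0 (measurable_density (tw j)) (density_ge0 (w j))).
move=> z fz nZ; have [[Iz _] _] := fz.
have zs : strip a b z by split.
have zab : a < z.1 < b by move: Iz; rewrite /= in_itv.
have E : g z.1 = h z.1.
  have /contrapT H : ~ ~ (a < z.1 < b -> g z.1 = h z.1) by move=> H; apply: nZ; exact: gZ.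
  exact: H.
rewrite /kint /p /q indicE; have [Az|Az] := pselect (A n z); last first.
  by rewrite memNset// !mulr0 !mul0r subr0; exact: density_ge0.
rewrite mem_set// !mulr1 /density.
have := Kc z.1 z.2; rewrite Iz -surjective_pairing (phi_f zs)/= E => /(_ isT).
set d := slope (w j) z.1; move: (f1 z) (f2 z) (z.2 - h z.1) => x y t xy.
have -> : x * tan2 d - y * tan1 d = tan1 d * (x * d - y) by rewrite /tan2 /tan1; ring.
rewrite ler_pM2l ?tan1_gt0//.
have := sqr_ge0 (d - x / 2); nra.
Qed.

Let V j s : R := Num.sg (rtrace (w j) s - ltrace (w j) s) *
  \int[leb]_(t in vseg (w j) s) (phi (s, t)).1.

Let vert_cvg j s : s \in F -> vert (w j) (p n) s @[n --> \oo] --> V j s.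
Proof.
move=> sF; have sI := FI sF; have [_ _ Kc] := Kphi.
have [ip _] := Kc s (lower_trace (w j) s) (upper_trace (w j) s) sI.
apply: cvgM; first exact: cvg_cst.
have sst t : strip a b (s, t) by split.
have mline (f : plane -> R) : measurable_fun setT f ->
    measurable_fun (vseg (w j) s) (fun t => f (s, t)).
  by move=> mf; apply: measurable_funTS; exact: measurableT_comp mf (pair1_measurable s).
have [|||||_ //] := dominated_Rcvg leb (measurable_vseg (w j) s)
  (f_ := fun n t => p n (s, t)) (f := fun t => (phi (s, t)).1) (g := fun t => `|(phi (s, t)).1|).
- by move=> n; apply: mline; have [? [? [? [? [_ _ []]]]]] := bp n.
- by apply/measurable_EFinP; case/integrableP : ip.
- move=> t _; apply: cvg_near_cst; apply: filterS (A_near (sst t)) => n An.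
  by rewrite /p indicE mem_set// mulr1 phi_f.
- exact: (integrable_norm ip).
- move=> n t _; rewrite /p normrM phi_f//= ler_piMr// indicE.
  by case: (_ \in _); rewrite ?normr1 ?normr0.
Qed.

Let V_le j s : s \in F -> V j s <= if ltrace (w j) s == rtrace (w j) s then 0 else alpha.
Proof.
move=> sF; have sI := FI sF; have [_ _ Kc] := Kphi.
have [_ +] := Kc s (lower_trace (w j) s) (upper_trace (w j) s) sI.
rewrite /V; case: eqP => [->|lr] H; first by rewrite subrr sgr0 mul0r.
apply: le_trans H; apply: le_trans (ler_norm _) _.
by rewrite normrM normr_sg subr_eq0 eq_sym (introF eqP lr) mul1r.
Qed.

Let Fz (z : plane) : R :=
  mult T z * ((phi z).1 * (normal T z).1 + (phi z).2 * (normal T z).2).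

Let Fn n (z : plane) : R := Fz z * \1_(A n) z.

Let FnE n z : carrier T z -> Fn n z =
  p n z * (orient T z).2 * mult T z - q n z * (orient T z).1 * mult T z.
Proof.
move=> Tz; rewrite /Fn /Fz (phi_f (nice_strip nT Tz)) /normal /p /q /=.
by move: (f1 z) (f2 z) => x y; ring.
Qed.

Let act_int1 n : (H1 R).-integrable (carrier T)
  (EFin \o (fun z => q n z * (fst \o orient T) z * mult T z)).
Proof.
have [a1 [b1 [a2 [b2 [aa1 b1b B]]]]] := bq n.
exact: (act_integrable nT (nice_orient1 nT) (nice_orient1_le1 nT) aa1 b1b B).
Qed.

Let act_int2 n : (H1 R).-integrable (carrier T)
  (EFin \o (fun z => p n z * (snd \o orient T) z * mult T z)).
Proof.
have [a1 [b1 [a2 [b2 [aa1 b1b B]]]]] := bp n.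
exact: (act_integrable nT (nice_orient2 nT) (nice_orient2_le1 nT) aa1 b1b B).
Qed.

Let Fn_integrable n : (H1 R).-integrable (carrier T) (EFin \o Fn n).
Proof.
have := integrable_sub (H1 R) (nice_measurable nT) (act_int2 n) (act_int1 n).
apply: eq_integrable; first exact: nice_measurable nT.
by move=> z; rewrite inE => Tz; rewrite /= FnE.
Qed.

Let X : \bar R := (\sum_j (mu j)%:E * \int[H1 R]_(z in flat_part (w j)) (density (w j) z)%:E)%E.

Let Vn n : R := \sum_j mu j * \sum_(s <- F) vert (w j) (p n) s.

Let Fn_le n : (\int[H1 R]_(z in carrier T) (Fn n z)%:E <= X + (Vn n)%:E)%E.
Proof.
have -> : (\int[H1 R]_(z in carrier T) (Fn n z)%:E)%E =
    (act T (snd \o orient T) (p n) - act T (fst \o orient T) (q n))%:E.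
  rewrite /act -RintegralB//; last exact: nice_measurable nT.
  rewrite /Rintegral fineK.
    by apply: eq_integral => z; rewrite inE => Tz; rewrite /= FnE.
  have := integrable_fin_num (nice_measurable nT) (Fn_integrable n).
  congr (_ \is a fin_num); apply: eq_integral => z; rewrite inE => Tz.
  by rewrite /= FnE.
have [_ ->] := Tw (bp n); have [-> _] := Tw (bq n).
have -> : \sum_j mu j * (flat_act (@tan2 R) (w j) (p n) + \sum_(s <- F) vert (w j) (p n) s) -
    \sum_j mu j * flat_act (@tan1 R) (w j) (q n) =
    \sum_j mu j * (flat_act (@tan2 R) (w j) (p n) - flat_act (@tan1 R) (w j) (q n)) + Vn n.
  by rewrite -sumrB -big_split/=; apply: eq_bigr => j _; ring.
rewrite EFinD; apply: leeD => //; rewrite -sumEFin; apply: lee_sum => j _.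
by rewrite EFinM; apply: lee_wpmul2l; [rewrite lee_fin|exact: flat_bound].
Qed.

Lemma competitor_le :
  (\int[H1 R]_(z in carrier T) (Fz z)%:E <= \sum_j (mu j)%:E * energy (w j))%E.
Proof.
have mD := nice_measurable nT; set D : set (H1plane R) := carrier T in mD *.
pose FE (z : H1plane R) : \bar R := (Fz z)%:E.
have mFz : measurable_fun D (Fz : H1plane R -> R).
  pose k (z : H1plane R) : R := mult T z * (f1 z * (snd \o orient T) z - f2 z * (fst \o orient T) z).
  apply: (eq_measurable_fun k).
    move=> z; rewrite inE => Tz; rewrite /k /Fz (phi_f (nice_strip nT Tz)) /normal /=.
    by rewrite mulrN.
  apply: measurable_funM; first exact: nice_mult nT.
  apply: measurable_funB; apply: measurable_funM.
  - exact: measurable_funTS_H1 mf1.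
  - exact: nice_orient2 nT.
  - exact: measurable_funTS_H1 mf2.
  - exact: nice_orient1 nT.
have mFE : measurable_fun D FE by apply/measurable_EFinP.
pose Nn : \bar R := (\int[H1 R]_(z in D) FE^\- z)%E.
have N0 : (0 <= Nn)%E by apply: integral_ge0 => z _; exact: funeneg_ge0.
rewrite integralE -/FE -/Nn.
have [->|Noo] := eqVneq Nn +oo%E; first by rewrite addeNy leNye.
have Nfin : Nn \is a fin_num by rewrite ge0_fin_numE// ltey.
rewrite leeBlDr//.
pose cost : R := \sum_j mu j * \sum_(s <- F) V j s.
have cV : Vn n @[n --> \oo] --> cost.
  apply: cvg_sum_R => j; apply: cvgM; first exact: cvg_cst.
  rewrite (_ : (fun n => \sum_(s <- F) vert (w j) (p n) s) =
      (fun n => \sum_(i < size F) vert (w j) (p n) (tnth (in_tuple F) i))); last first.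
    by apply/funext => n; rewrite big_tnth.
  rewrite big_tnth; apply: cvg_sum_R => i; apply: vert_cvg; exact: mem_tnth.
pose Gn n := ((EFin \o Fn n)^\+)%E.
have mFn n : measurable_fun D (EFin \o Fn n) by case/integrableP : (Fn_integrable n).
have mG n : measurable_fun D (Gn n) by exact: measurable_funepos.
have G0 n z : D z -> (0 <= Gn n z)%E by move=> _; exact: funepos_ge0.
have Gmono z : D z -> {homo Gn^~ z : n m / (n <= m)%N >-> (n <= m)%E}.
  move=> Dz n m nm; rewrite /Gn !funeposE /= /Fn !indicE.
  case: (boolP (z \in A n)) => [/set_mem/(A_nested nm)/mem_set Am|_].
    by rewrite Am.
  by rewrite mulr0 maxxx le_max lexx orbT.
have lG z : D z -> limn (Gn^~ z) = (FE^\+ z)%E.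
  move=> Dz; apply/cvg_lim => //; apply: cvg_near_cst.
  apply: filterS (A_near (nice_strip nT Dz)) => n An.
  by rewrite /Gn !funeposE /= /Fn indicE mem_set// mulr1.
have Gcvg := @cvg_monotone_convergence _ _ _ (H1 R) D mD Gn mG G0 Gmono.
have Gle n : (\int[H1 R]_(z in D) Gn n z <= X + (Vn n)%:E + Nn)%E.
  have iF := Fn_integrable n.
  have nfin := integrable_fin_num mD (integrable_funeneg mD iF).
  have -> : (\int[H1 R]_(z in D) Gn n z = \int[H1 R]_(z in D) (EFin \o Fn n) z +
      \int[H1 R]_(z in D) ((EFin \o Fn n)^\- z))%E by rewrite [X in (_ = X + _)%E]integralE subeK.
  apply: leeD; first exact: Fn_le.
  apply: ge0_le_integral => //.
  - exact: measurable_funeneg.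
  - exact: measurable_funeneg.
  - move=> z _; rewrite !funenegE /= /Fn indicE; case: (z \in A n); first by rewrite mulr1.
    by rewrite mulr0 oppr0 maxxx le_max lexx orbT.
have -> : (\int[H1 R]_(z in D) FE^\+ z)%E = (\int[H1 R]_(z in D) limn (Gn^~ z))%E.
  by apply: eq_integral => z; rewrite inE => /lG ->.
rewrite -(cvg_lim _ Gcvg)//.
have VB : (X + cost%:E <= \sum_j (mu j)%:E * energy (w j))%E.
  rewrite /X -sumEFin -big_split/=; apply: lee_sum => j _.
  have X0 : (0 <= \int[H1 R]_(z in flat_part (w j)) (density (w j) z)%:E)%E.
    by apply: integral_ge0 => z _; rewrite lee_fin density_ge0.
  have c0 : (0 <= (jump_cost (w j))%:E)%E.
    by rewrite lee_fin; apply: sumr_ge0 => s _; case: ifP => // _; exact: ltW.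
  rewrite /energy [leRHS](ge0_muleDr _ X0 c0).
  apply: leeD => //; rewrite -EFinM lee_fin ler_wpM2l//.
  by rewrite /jump_cost big_seq [leRHS]big_seq; apply: ler_sum => s; exact: V_le.
apply: (@le_trans _ _ (X + cost%:E + Nn)%E); last by rewrite leeD.
apply/lee_addgt0Pr => e e0; apply: lime_le; first by apply/cvg_ex; eexists; exact: Gcvg.
near=> n; apply: (le_trans (Gle n)).
rewrite -[leRHS]addeA [(Nn + e%:E)%E]addeC [leRHS]addeA; apply: leeD2r.
rewrite -[leRHS]addeA -EFinD; apply: leeD2l; rewrite lee_fin ltW//.
near: n; move/cvgrPdist_lt : cV => /(_ e e0); apply: filterS => n.
by rewrite ltr_norml => /andP[]; lra.
Unshelve. all: by end_near. Qed.

End competitor_bound.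

Section optimal_form.
Variables (T : rcurrent R) (nT : nice_current a b T).
Variables (J : finType) (mu : J -> R) (w : J -> R -> R).
Hypothesis mu0 : forall j, 0 <= mu j.
Hypothesis tw : forall j, tame (w j).
Hypothesis Tw : carried a b F T mu w.
Variable M : R.
Hypothesis hM : forall x, `|h x| <= M.

Variables (Phi psi : R -> R -> R).
Hypothesis dPhi : forall s (x : R), is_derive x 1 (Phi s) (psi s x).
Hypothesis cpsi : forall s, continuous (psi s).
Hypothesis Phi_bnd : forall s x, 0 <= Phi s x <= alpha.
Hypothesis Phi_jump : forall s j, s \in F -> 0 < mu j ->
  ltrace (w j) s <> rtrace (w j) s -> Phi s (rtrace (w j) s) - Phi s (ltrace (w j) s) = alpha.

Variable Z : set R.
Hypothesis mZ : measurable Z.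
Hypothesis Z0 : leb Z = 0%E.
Hypothesis gZ : forall x, a < x < b -> ~ Z x -> g x = h x.
Hypothesis dZ : forall x i j, a < x < b -> x \notin F -> ~ Z x ->
  ltrace (w i) x = ltrace (w j) x -> slope (w i) x = slope (w j) x.

Let IF : set R := `]a, b[%classic `\` [set` F].
Let U j : R -> R := ltrace (w j) \_ IF.

Let mF : measurable [set` F]. Proof. by apply: measurable_finite_set; exact: finite_seq. Qed.

Let mU j : measurable_fun setT (U j).
Proof.
have tj := tw j; have [su SF] := tj.
have mIF : measurable IF by apply: measurableD => //; exact: measurable_itv.
apply/(measurable_restrictT _ _).1; first exact: mIF.
apply: measurable_funS (measurable_ltrace su.1 (sbv_derivP su) (tame_finite tj)).
  by apply: open_measurable; apply: open_jump_free; exact: tame_finite tj.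
by move=> x [Ix Fx]; split => // /SF.
Qed.

Let mslope j : measurable_fun setT (fun z : plane => slope (w j) z.1) := measurable_slope_fst (tw j).

Let hit n j : set plane := [set z | z.2 - U j z.1 = 0 /\ `|slope (w j) z.1| <= n%:R].

Let mhit n j : measurable (hit n j).
Proof.
have E : hit n j = ((fun z : plane => z.2 - U j z.1) @^-1` [set 0]) `&`
    ((fun z : plane => `|slope (w j) z.1|) @^-1` `]-oo, n%:R]).
  by apply/seteqP; split => z /=; rewrite in_itv.
rewrite E; apply: measurableI; rewrite -[X in measurable X]setTI.
  suff : measurable_fun setT (fun z : plane => z.2 - U j z.1) by apply.
  by apply: measurable_funB; [exact: measurable_snd|exact: measurableT_comp (mU j) measurable_fst].
by apply: (measurableT_comp (@normr_measurable R setT) (mslope j)) => //; exact: measurable_itv.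
Qed.

Let sel n (l : seq J) (z : plane) : R :=
  foldr (fun j r => if z \in hit n j then 2 * slope (w j) z.1 else r) 0 l.

Let measurable_mem (A : set plane) : measurable A -> measurable_fun setT (fun z => z \in A).
Proof.
move=> mA; apply: (measurable_fun_bool true); rewrite setTI.
rewrite (_ : _ @^-1` _ = A)//.
by apply/seteqP; split => z /=; [exact: set_mem|exact: mem_set].
Qed.

Let msel n l : measurable_fun setT (sel n l).
Proof.
elim: l => [|j l IH] /=; first exact: measurable_cst.
apply: measurable_fun_ifT; [exact: measurable_mem (mhit n j)| |exact: IH].
by apply: measurable_funM => //; exact: mslope.
Qed.

Let sel_bnd n l z : `|sel n l z| <= 2 * n%:R.
Proof.
elim: l => [|j l IH] /=; first by rewrite normr0 mulr_ge0.
by case: ifPn => // /set_mem[_ sn]; rewrite normrM ger0_norm// ler_pM2l.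
Qed.

Let sel_neq0 n l z : sel n l z <> 0 -> exists j, z.2 = U j z.1.
Proof.
elim: l => [//|j l IH] /=; case: ifPn => // /set_mem[/eqP zU _] _.
by exists j; apply/eqP; rewrite -subr_eq0.
Qed.

Let sel_flat n j z : flat_part (w j) z -> ~ Z z.1 ->
  sel n (enum J) z = if `|slope (w j) z.1| <= n%:R then 2 * slope (w j) z.1 else 0.
Proof.
move=> [Iz zU] nZ; have [Iz1 /= /negP zF] := Iz.
have zab : a < z.1 < b by move: Iz1; rewrite /= in_itv.
have UE i : U i z.1 = ltrace (w i) z.1 by rewrite /U patchE mem_set.
have hitE i : z \in hit n i -> slope (w i) z.1 = slope (w j) z.1 /\ `|slope (w j) z.1| <= n%:R.
  move=> /set_mem[/eqP]; rewrite subr_eq0 UE zU => /eqP ji.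
  by rewrite (dZ zab zF nZ ji).
have [dn|dn] := boolP (_ <= _); last first.
  elim: (enum J) => [//|i l IH] /=; case: ifPn => // /hitE[_].
  by move=> H; rewrite H in dn.
have jhit : z \in hit n j by apply/mem_set; split; rewrite ?UE ?zU ?subrr.
have : j \in enum J by rewrite mem_enum.
elim: (enum J) => [//|i l IH]; rewrite inE /= => jl.
case: ifPn => [/hitE[-> //]|nh]; apply: IH.
by move: jl => /orP[/eqP ij|//]; rewrite -ij jhit in nh.
Qed.

Let edge (z : plane) : R := \sum_(s <- F) \1_[set s] z.1 * psi s z.2.

Let edgeE z : z.1 \in F -> edge z = psi z.1 z.2.
Proof.
move=> zF; rewrite /edge (bigD1_seq z.1)//= indicE mem_set// mul1r.
rewrite big1_seq ?addr0// => s /andP[sz _].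
by rewrite indicE memNset ?mul0r// => /= zs; rewrite zs eqxx in sz.
Qed.

Let edge0 z : z.1 \notin F -> edge z = 0.
Proof.
move=> zF; rewrite /edge big1_seq// => s /andP[_ sF].
by rewrite indicE memNset ?mul0r// => /= zs; rewrite zs sF in zF.
Qed.

Let medge : measurable_fun setT edge.
Proof.
apply: measurable_sum => s; apply: measurable_funM.
  apply: (measurableT_comp (f := \1_[set s] : R -> R)); last exact: measurable_fst.
  by apply: measurable_indic; apply: measurable_finite_set; exact: finite_set1.
apply: measurableT_comp; last exact: measurable_snd.
by apply: continuous_measurable_fun; exact: cpsi.
Qed.

Let edge_bnd n : exists C : R, forall z, cell a b n z -> `|edge z| <= C.
Proof.
have /choice[C HC] : forall s, exists C : R, forall x, - n%:R <= x <= n%:R -> `|psi s x| <= C.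
  by move=> s; exact: continuous_itv_bounded.
exists (\sum_(s <- F) C s) => z /oboxP[_ /andP[/ltW z1 /ltW z2]].
apply: le_trans (ler_norm_sum _ _ _) _; apply: ler_sum => s _.
rewrite normrM indicE; apply: le_trans (HC s z.2 _); last by rewrite z1.
by case: (_ \in _); rewrite ?normr1 ?normr0 ?mul1r ?mul0r.
Qed.

Let good : set plane := [set z | z.1 \notin F /\ ~ Z z.1].

Let mgood : measurable good.
Proof.
have E : good = fst @^-1` (~` [set` F] `&` ~` Z).
  by apply/seteqP; split=> z [/negP].
rewrite E -[X in measurable X]setTI; apply: measurable_fst => //.
by apply: measurableI; exact: measurableC.
Qed.

(* Up to truncation: twice the slope on the graphs, the derivative of the
   potential Phi on the vertical lines over F; [k2] then makes the constraint
   on phi^t an equality. *)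
Let k1 n (z : plane) : R := (edge z + \1_good z * sel n (enum J) z) * \1_(cell a b n) z.

Let kappa n (z : plane) : R := \1_good z * (beta * (z.2 - h z.1) ^+ 2) * \1_(cell a b n) z.

Let k2 n (z : plane) : R := k1 n z ^+ 2 / 4 - kappa n z.

Let mcell n : measurable (cell a b n). Proof. exact: measurable_obox. Qed.

Let mk1 n : measurable_fun setT (k1 n).
Proof.
apply: measurable_funM; last exact: measurable_indic.
apply: measurable_funD; first exact: medge.
apply: measurable_funM; last exact: msel.
by apply: measurable_indic; exact: mgood.
Qed.

Let mkappa n : measurable_fun setT (kappa n).
Proof.
apply: measurable_funM; last exact: measurable_indic.
apply: measurable_funM; first exact: measurable_indic.
apply: measurable_funM => //; apply: measurable_funX; apply: measurable_funB.
  exact: measurable_snd.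
exact: measurableT_comp mh measurable_fst.
Qed.

Let mk2 n : measurable_fun setT (k2 n).
Proof.
apply: measurable_funB; last exact: mkappa.
apply: measurable_funM; last exact: measurable_cst.
by apply: measurable_funX; exact: mk1.
Qed.

Let ncell0 n z : ~ cell a b n z -> k1 n z = 0 /\ kappa n z = 0.
Proof.
move=> nc; have c0 : \1_(cell a b n) z = 0 :> R by rewrite indicE memNset.
by rewrite /k1 /kappa c0 !mulr0.
Qed.

Let ind_le1 (A : set plane) z : `|(\1_A z : R)| <= 1.
Proof. by rewrite indicE; case: (_ \in _); rewrite ?normr1 ?normr0. Qed.

Let ind_ge0 (A : set plane) z : 0 <= (\1_A z : R).
Proof. by rewrite indicE; case: (_ \in _). Qed.

Let bound_k1 n : bounded_on (cell a b n) (k1 n).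
Proof.
split; [exact: mk1| |by move=> z /ncell0[]].
have [C HC] := edge_bnd n; exists (`|C| + 2 * n%:R) => z.
have [cz|nc] := pselect (cell a b n z); last first.
  by have [-> _] := ncell0 nc; rewrite normr0 addr_ge0// mulr_ge0.
rewrite /k1 [X in _ * X]indicE mem_set// mulr1.
apply: le_trans (ler_normD _ _) _; apply: lerD; first exact: le_trans (HC z cz) (ler_norm C).
rewrite normrM -[leRHS]mul1r; apply: ler_pM => //; exact: sel_bnd.
Qed.

Let bound_k2 n : bounded_on (cell a b n) (k2 n).
Proof.
have [_ [C HC] _] := bound_k1 n.
split; [exact: mk2| |by move=> z /ncell0[k_ kap]; rewrite /k2 k_ kap expr0n mul0r subr0].
exists (C ^+ 2 / 4 + beta * (n%:R + M) ^+ 2) => z.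
have C0 : 0 <= C := le_trans (normr_ge0 _) (HC z).
have M0 : 0 <= M := le_trans (normr_ge0 _) (hM 0).
have sq : k1 n z ^+ 2 <= C ^+ 2.
  by rewrite -(real_normK (num_real (k1 n z))) ler_pXn2r ?nnegrE.
have kap0 : 0 <= kappa n z.
  by rewrite /kappa mulr_ge0 ?ind_ge0// mulr_ge0 ?ind_ge0// mulr_ge0 ?sqr_ge0.
have kapC : kappa n z <= beta * (n%:R + M) ^+ 2.
  have [cz|nc] := pselect (cell a b n z); last first.
    by have [_ ->] := ncell0 nc; rewrite mulr_ge0 ?sqr_ge0.
  rewrite /kappa [X in _ * X]indicE mem_set// mulr1.
  apply: (@le_trans _ _ (beta * (z.2 - h z.1) ^+ 2)).
    apply: ler_piMl; first exact: mulr_ge0 beta0 (sqr_ge0 _).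
    exact: le_trans (ler_norm _) (ind_le1 _ _).
  rewrite ler_wpM2l// -(real_normK (num_real (z.2 - h z.1))) ler_pXn2r ?nnegrE ?addr_ge0//.
  apply: le_trans (ler_normB _ _) _; apply: lerD => //.
  by have /oboxP[_ /andP[z1 z2]] := cz; rewrite ler_norml; apply/andP; split; exact: ltW.
have := sqr_ge0 (k1 n z); rewrite ler_norml /k2 => sq0; apply/andP; split; lra.
Qed.

Lemma psi_integral s x y : x <= y ->
  \int[leb]_(t in `[x, y]) psi s t = Phi s y - Phi s x.
Proof.
rewrite le_eqVlt => /predU1P[->|xy]; first by rewrite set_itv1 Rintegral_set1 subrr.
have cPhi : continuous (Phi s).
  by move=> t; apply: differentiable_continuous; apply/derivable1_diffP; have [] := dPhi s t.
rewrite /Rintegral (@continuous_FTC2 _ _ (Phi s) _ _ xy)//.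
- by apply: continuous_subspaceT; exact: cpsi.
- split.
  + by move=> t _; have [] := dPhi s t.
  + by apply: cvg_at_right_filter; exact: cPhi.
  + by apply: cvg_at_left_filter; exact: cPhi.
- by move=> t _; rewrite derive1E; have [_ ->] := dPhi s t.
Qed.

Let line_integrable n x t1 t2 : leb.-integrable `[t1, t2] (fun t => (k1 n (x, t))%:E).
Proof.
have [_ [C HC] _] := bound_k1 n.
have fin : (leb `[t1, t2]%classic < +oo)%E.
  by rewrite lebesgue_measure_itv/=; case: ifP => _; rewrite ltry.
apply: (bounded_fun_integrable leb (measurable_itv _) fin (C := C)) => //.
by apply: measurable_funTS; exact: measurableT_comp (mk1 n) (pair1_measurable x).
Qed.

Let line_bound n x t1 t2 : `|\int[leb]_(t in `[t1, t2]) k1 n (x, t)| <= alpha.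
Proof.
have mseg : measurable (`[t1, t2]%classic : set R) by exact: measurable_itv.
have ml : measurable_fun `[t1, t2] (fun t => k1 n (x, t)).
  by apply: measurable_funTS; exact: measurableT_comp (mk1 n) (pair1_measurable x).
have zero : {ae leb, forall t, k1 n (x, t) = 0} -> \int[leb]_(t in `[t1, t2]) k1 n (x, t) = 0.
  move=> k0; rewrite /Rintegral (ae_eq_integral (cst 0%E)) ?integral0//.
  - by apply/measurable_EFinP.
  - by apply: ae_imply k0 => t ->.
have [xF|xF] := boolP (x \in F); last first.
  rewrite zero ?normr0 ?ltW//.
  have fin : countable [set` [seq U j x | j <- enum J]].
    by apply: finite_set_countable; exact: finite_seq.
  apply: ae_imply (ae_notin_countable fin) => t nt; apply: contrapT => k_neq0.
  apply: nt; have : sel n (enum J) (x, t) <> 0.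
    by move=> s0; apply: k_neq0; rewrite /k1 edge0// s0 mulr0 addr0 mul0r.
  by move=> /sel_neq0[j /= ->]; apply: map_f; rewrite mem_enum.
have ng t : \1_good (x, t) = 0 :> R by rewrite indicE memNset// => -[/=]; rewrite xF.
have [xI|xI] := boolP (a + n.+1%:R^-1 < x < b - n.+1%:R^-1); last first.
  rewrite zero ?normr0 ?ltW//; apply: aeW => t.
  by have [] := @ncell0 n (x, t) => // /oboxP[/= xI' _]; rewrite xI' in xI.
have E : \int[leb]_(t in `[t1, t2]) k1 n (x, t) =
    \int[leb]_(t in `[t1, t2] `&` `[- n%:R, n%:R]) psi x t.
  rewrite Rintegral_mkcondr /Rintegral; congr fine; apply: ae_eq_integral => //.
  - by apply/measurable_EFinP.
  - apply/measurable_EFinP; apply: measurable_funTS.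
    apply/(measurable_restrictT _ _).1; first exact: measurable_itv.
    by apply: measurable_funTS; apply: continuous_measurable_fun; exact: cpsi.
  have fin : countable [set (- n%:R) ; (n%:R : R)].
    by apply: finite_set_countable; rewrite finite_setU; split; exact: finite_set1.
  apply: ae_imply (ae_notin_countable fin) => t nt _; congr EFin; rewrite patchE.
  rewrite /k1 ng mul0r addr0 edgeE//=.
  have tn : (cell a b n (x, t)) <-> (t \in `[- n%:R, n%:R]%R).
    rewrite in_itv/=; split=> [/oboxP[_ /andP[/ltW /= -> /ltW /= ->]]//|/andP[]].
    rewrite le_eqVlt => /predU1P[tn|tn1]; first by exfalso; apply: nt; left.
    rewrite le_eqVlt => /predU1P[tn|tn2]; first by exfalso; apply: nt; right.
    by apply/oboxP; split; rewrite //= tn1.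
  have [tI|tI] := boolP (t \in `[- n%:R, n%:R]%R).
    by rewrite indicE !mem_set ?mulr1//; exact/tn.
  by rewrite indicE !memNset ?mulr0//; [exact/negP|move=> /tn; exact/negP].
rewrite {}E.
have -> : (`[t1, t2] `&` `[- n%:R, n%:R] = `[Num.max t1 (- n%:R), Num.min t2 n%:R])%classic.
  by apply/seteqP; split=> t /=; rewrite !in_itv/= ge_max le_min;
    [move=> [/andP[-> ->] /andP[-> ->]]|move=> /andP[/andP[-> ->] /andP[-> ->]]].
have [xy|yx] := leP (Num.max t1 (- n%:R)) (Num.min t2 n%:R); last first.
  rewrite set_itv_ge ?Rintegral_set0 ?normr0 ?ltW// bnd_simp -ltNge.
  exact: yx.
rewrite psi_integral//.
have /andP[p1 p2] := Phi_bnd x (Num.max t1 (- n%:R)).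
have /andP[p3 p4] := Phi_bnd x (Num.min t2 n%:R).
by rewrite ler_norml; apply/andP; split; lra.
Qed.

Let Kk n : Kset (fun z => (k1 n z, k2 n z)).
Proof.
split.
- apply: measurable_funTS; apply/measurable_fun_pairP; split; [exact: mk1|exact: mk2].
- move=> x t; rewrite in_itv/= => xab; rewrite /k2 lerD2l lerN2 /kappa.
  have nn : 0 <= beta * (t - g x) ^+ 2 by rewrite mulr_ge0 ?sqr_ge0.
  rewrite [\1_good _]indicE; case: (boolP ((x, t) \in good)) => [/set_mem[_ /= nZ]|_]; last by rewrite !mul0r.
  by rewrite mul1r -(gZ xab nZ) ler_piMr// (le_trans (ler_norm _)).
- by move=> x t1 t2 _; split; [exact: line_integrable|exact: line_bound].
Qed.

Let vert_k1 n j s : s \in F -> 0 < mu j -> (forall t, vseg (w j) s t -> cell a b n (s, t)) ->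
  vert (w j) (k1 n) s = if ltrace (w j) s == rtrace (w j) s then 0 else alpha.
Proof.
move=> sF muj cellj; rewrite /vert; case: eqP => [->|lr]; first by rewrite subrr sgr0 mul0r.
have -> : \int[leb]_(t in vseg (w j) s) k1 n (s, t) = \int[leb]_(t in vseg (w j) s) psi s t.
  apply: eq_Rintegral => t; rewrite inE => /cellj ct.
  have gd0 : \1_good (s, t) = 0 :> R by rewrite indicE memNset// => -[/=]; rewrite sF.
  have cc : \1_(cell a b n) (s, t) = 1 :> R by rewrite indicE mem_set.
  by rewrite /k1 (@edgeE (s, t) sF) gd0 cc mul0r addr0 mulr1.
have := Phi_jump sF muj lr; rewrite /vseg /lower_trace /upper_trace.
move: (ltrace (w j) s) (rtrace (w j) s) lr => l r lr PJ.
have [lt|gt|//] := ltgtP l r.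
  by rewrite gtr0_sg ?subr_gt0// mul1r psi_integral ?(ltW lt).
by rewrite ltr0_sg ?subr_lt0// mulN1r psi_integral ?(ltW gt)// opprB.
Qed.

Let cut n j (z : plane) : R :=
  density (w j) z * \1_(cell a b n `&` [set z : plane | `|slope (w j) z.1| <= n%:R]) z.

Let mcut_set n j : measurable (cell a b n `&` [set z : plane | `|slope (w j) z.1| <= n%:R]).
Proof.
apply: measurableI; first exact: mcell.
have E : [set z : plane | `|slope (w j) z.1| <= n%:R] =
    (fun z : plane => `|slope (w j) z.1|) @^-1` `]-oo, n%:R].
  by apply/seteqP; split => z /=; rewrite in_itv.
rewrite E -[X in measurable X]setTI.
by apply: (measurableT_comp (@normr_measurable R setT) (mslope j)) => //; exact: measurable_itv.
Qed.

Let mcut n j : measurable_fun setT (cut n j).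
Proof.
apply: measurable_funM; first exact: measurable_density.
by apply: measurable_indic; exact: mcut_set.
Qed.

Let cut_ge0 n j z : 0 <= cut n j z.
Proof. by rewrite mulr_ge0 ?density_ge0// ind_ge0. Qed.

Let flat_k n j : (\int[H1 R]_(z in flat_part (w j)) (cut n j z)%:E <=
  (flat_act (@tan2 R) (w j) (k1 n) - flat_act (@tan1 R) (w j) (k2 n))%:E)%E.
Proof.
apply: (flat_ge (tw j) (bounded_form_cell (bound_k1 n)) (bounded_form_cell (bound_k2 n)) mZ Z0
  (mcut n j) (cut_ge0 n j)) => z fz nZ.
have [[Iz1 /= /negP zF] _] := fz.
have zab : a < z.1 < b by move: Iz1; rewrite /= in_itv.
have [cz|nc] := pselect (cell a b n z); last first.
  have [k1_0 kap0] := ncell0 nc.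
  rewrite /kint /k2 k1_0 kap0 /cut indicE memNset => [|[]//].
  by rewrite mulr0 expr0n mul0r subr0 !mul0r subrr.
have gd : \1_good z = 1 :> R by rewrite indicE mem_set.
have cc : \1_(cell a b n) z = 1 :> R by rewrite indicE mem_set.
rewrite /kint /k2 /kappa /k1 gd cc edge0// !mulr1 mul1r add0r (sel_flat n fz nZ).
rewrite /cut /density indicE; set d := slope (w j) z.1; set t := z.2 - h z.1.
have [dn|dn] := boolP (`|d| <= n%:R).
  rewrite mem_set// mulr1 le_eqVlt; apply/orP; left; apply/eqP.
  by rewrite /tan2 /tan1; field; rewrite gt_eqF ?nrm_sqrt_gt0.
rewrite memNset => [|[_ /= dn']]; last by rewrite dn' in dn.
rewrite mulr0 mul0r expr0n mul0r !sub0r mulNr opprK.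
by rewrite mul1r; apply: mulr_ge0 (ltW (tan1_gt0 _)); exact: mulr_ge0 beta0 (sqr_ge0 _).
Qed.

Let value n (z : plane) : R :=
  mult T z * ((k1 n z, k2 n z).1 * (normal T z).1 + (k1 n z, k2 n z).2 * (normal T z).2).

Let valueE n : (\int[H1 R]_(z in carrier T) (value n z)%:E)%E =
  (\sum_j mu j * (flat_act (@tan2 R) (w j) (k1 n) - flat_act (@tan1 R) (w j) (k2 n)) +
   \sum_j mu j * \sum_(s <- F) vert (w j) (k1 n) s)%:E.
Proof.
have mD := nice_measurable nT.
have B1 := bounded_form_cell (bound_k1 n); have B2 := bounded_form_cell (bound_k2 n).
have i2 : (H1 R).-integrable (carrier T) (EFin \o (fun z => k2 n z * (fst \o orient T) z * mult T z)).
  have [a1 [b1 [a2 [b2 [aa1 b1b B]]]]] := B2.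
  exact: (act_integrable nT (nice_orient1 nT) (nice_orient1_le1 nT) aa1 b1b B).
have i1 : (H1 R).-integrable (carrier T) (EFin \o (fun z => k1 n z * (snd \o orient T) z * mult T z)).
  have [a1 [b1 [a2 [b2 [aa1 b1b B]]]]] := B1.
  exact: (act_integrable nT (nice_orient2 nT) (nice_orient2_le1 nT) aa1 b1b B).
transitivity (act T (snd \o orient T) (k1 n) - act T (fst \o orient T) (k2 n))%:E.
  rewrite /act -(RintegralB mD i1 i2) /Rintegral fineK.
    apply: eq_integral => z _; congr EFin; rewrite /value /normal /=.
    by move: (k1 n z) (k2 n z) => x y; ring.
  exact: (integrable_fin_num mD (integrable_sub (H1 R) mD i1 i2)).
have [_ ->] := Tw B1; have [-> _] := Tw B2; congr EFin.
by rewrite -sumrB -big_split/=; apply: eq_bigr => j _; ring.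
Qed.

Let cut_cvg j : (\int[H1 R]_(z in flat_part (w j)) (cut n j z)%:E)%E @[n --> \oo] -->
  (\int[H1 R]_(z in flat_part (w j)) (density (w j) z)%:E)%E.
Proof.
have mD := measurable_H1 (measurable_flat (tw j)).
have mg n : measurable_fun (flat_part (w j) : set (H1plane R)) (fun z => (cut n j z)%:E).
  by apply/measurable_EFinP; exact: measurable_funTS_H1 (mcut n j).
have g0 n z : flat_part (w j) z -> (0 <= (cut n j z)%:E)%E by move=> _; rewrite lee_fin.
have gmono z : flat_part (w j) z ->
    {homo (fun n => (cut n j z)%:E) : n m / (n <= m)%N >-> (n <= m)%E}.
  move=> _ n m nm; rewrite lee_fin /cut ler_wpM2l ?density_ge0// !indicE.
  case: (boolP (z \in _)) => [/set_mem[cz dz]|_]; last by case: (_ \in _).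
  rewrite mem_set//; split; first exact: cell_nested nm _ cz.
  by apply: le_trans dz _; rewrite ler_nat.
have := @cvg_monotone_convergence _ _ _ (H1 R) _ mD _ mg g0 gmono.
rewrite (_ : (\int[H1 R]_(x in flat_part (w j)) limn (fun n => (cut n j x)%:E))%E =
  (\int[H1 R]_(z in flat_part (w j)) (density (w j) z)%:E)%E) //.
apply: eq_integral => z; rewrite inE => -[[Iz _] _].
apply/cvg_lim => //; apply: cvg_near_cst.
have zs : strip a b z by split.
have nz : \forall n \near \oo, `|slope (w j) z.1| < n%:R by exact: nbhs_infty_gtr.
near=> n; congr EFin; rewrite /cut indicE mem_set ?mulr1//; split; first by near: n; exact: cell_near.
by apply: ltW; near: n.
Unshelve. all: by end_near. Qed.

Lemma competitor_ge :
  (\sum_j (mu j)%:E * energy (w j) <= G a b alpha beta g T)%E.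
Proof.
pose cost : R := \sum_j mu j * jump_cost (w j).
have -> : (\sum_j (mu j)%:E * energy (w j))%E =
    (\sum_j (mu j)%:E * \int[H1 R]_(z in flat_part (w j)) (density (w j) z)%:E + cost%:E)%E.
  rewrite /cost -sumEFin -big_split/=; apply: eq_bigr => j _.
  have X0 : (0 <= \int[H1 R]_(z in flat_part (w j)) (density (w j) z)%:E)%E.
    by apply: integral_ge0 => z _; rewrite lee_fin density_ge0.
  have c0 : (0 <= (jump_cost (w j))%:E)%E.
    by rewrite lee_fin; apply: sumr_ge0 => s _; case: ifP => // _; exact: ltW.
  by rewrite /energy (ge0_muleDr _ X0 c0) EFinM.
have lim : (\sum_j (mu j)%:E * \int[H1 R]_(z in flat_part (w j)) (cut n j z)%:E + cost%:E)%E
    @[n --> \oo] -->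
    (\sum_j (mu j)%:E * \int[H1 R]_(z in flat_part (w j)) (density (w j) z)%:E + cost%:E)%E.
  apply: cvgeD; [by rewrite fin_num_adde_defl| |exact: cvg_cst].
  apply: cvg_nnesum => j _; last by apply: cvgeZl => //; exact: cut_cvg.
  by apply: nearW => n; rewrite mule_ge0 ?lee_fin//; apply: integral_ge0 => z _; rewrite lee_fin.
rewrite -(cvg_lim _ lim)//; apply: lime_le; first by apply/cvg_ex; eexists; exact: lim.
have big : \forall n \near \oo, forall (i : 'I_(size F)) (j : J),
    let s := tnth (in_tuple F) i in
    cell a b n (s, lower_trace (w j) s) /\ cell a b n (s, upper_trace (w j) s).
  apply: filter_forall => i; apply: filter_forall => j /=.
  have sF : tnth (in_tuple F) i \in F by exact: mem_tnth.
  have st t : strip a b (tnth (in_tuple F) i, t) by split => //=; exact: FI.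
  by apply: filterI; exact: cell_near.
near=> n; have cells : forall s j t, s \in F -> vseg (w j) s t -> cell a b n (s, t).
  move=> s j t sF; have bign : forall (i : 'I_(size F)) (j : J),
      let s := tnth (in_tuple F) i in
      cell a b n (s, lower_trace (w j) s) /\ cell a b n (s, upper_trace (w j) s) by near: n.
  have [i si] := tnthP (in_tuple F) s sF.
  have /= := bign i j; rewrite -si => -[/oboxP[/= sx /andP[l1 _]] /oboxP[_ /= /andP[_ u2]]].
  rewrite /vseg/= in_itv/= => /andP[t1 t2]; apply/oboxP; split => //=.
  by rewrite (lt_le_trans l1 t1) (le_lt_trans t2 u2).
apply: (@le_trans _ _ (\int[H1 R]_(z in carrier T) (value n z)%:E)%E); last first.
  by apply: ereal_sup_ubound; exists (fun z => (k1 n z, k2 n z)); first exact: Kk.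
rewrite valueE EFinD; apply: leeD.
  rewrite -sumEFin; apply: lee_sum => j _; rewrite EFinM; apply: lee_wpmul2l; first by rewrite lee_fin.
  exact: flat_k.
rewrite lee_fin; apply: ler_sum => j _; have := mu0 j; rewrite le_eqVlt => /predU1P[<-|muj].
  by rewrite !mul0r.
rewrite ler_wpM2l// /jump_cost big_seq [leRHS]big_seq; apply: ler_sum => s sF.
by rewrite (vert_k1 sF muj)// => t; exact: cells.
Unshelve. all: by end_near. Qed.

End optimal_form.
End functional.

Section minimal_decomposition.
Context {R : realType}.
Local Notation leb := (@lebesgue_measure R).
Local Notation plane := (R * R)%type.

Lemma open_measurable_plane (O : set plane) : open O -> measurable O.
Proof.
move=> oO; pose B (q : rat * rat * (rat * rat)) : set plane :=
  obox (ratr q.1.1) (ratr q.1.2) (ratr q.2.1) (ratr q.2.2).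
have -> : O = \bigcup_q (if pselect (B q `<=` O) then B q else set0).
  apply/seteqP; split=> [z Oz|z [q _]]; last by case: pselect => // BO /BO.
  have [[U V] /= [zU zV] UV] : nbhs z O by exact: open_nbhs_nbhs.
  have /nbhs_ballP[e1 /= e10 He1] := zU; have /nbhs_ballP[e2 /= e20 He2] := zV.
  have near_rat (x e : R) : 0 < e -> exists p q : rat, ratr p < x < ratr q /\
      forall y : R, ratr p < y < ratr q -> `|x - y| < e.
    move=> e0; have [p] : exists p, ratr p \in `]x - e, x[ by apply: rat_in_itvoo; lra.
    have [q] : exists q, ratr q \in `]x, x + e[ by apply: rat_in_itvoo; lra.
    rewrite !in_itv/= => /andP[xq qe] /andP[ep px]; exists p, q.
    split; first by rewrite px.
    by move=> y /andP[py yq]; rewrite ltr_norml; apply/andP; split; lra.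
  have [p1 [q1 [b1 H1]]] := near_rat z.1 e1 e10.
  have [p2 [q2 [b2 H2]]] := near_rat z.2 e2 e20.
  exists (p1, q1, (p2, q2)) => //.
  case: pselect => [?|nB]; first by apply/oboxP.
  exfalso; apply: nB => y /oboxP[y1 y2]; apply: UV; split.
    by apply: He1; exact: H1.
  by apply: He2; exact: H2.
apply: countable_bigcupT_measurable => // q.
by case: ifP => _; [exact: measurable_obox|exact: measurable0].
Qed.

Lemma continuous_measurable_plane (f : plane -> R) : continuous f -> measurable_fun setT f.
Proof.
move=> cf; apply: (measurability _ (RGenOpens.measurableE R)) => //.
move=> _ [_ [x [y ->] <-]]; rewrite setTI; apply: open_measurable_plane.
by apply: open_comp; [move=> z _; exact: cf|exact: interval_open].
Qed.

Lemma test_form_box (a b : R) omega : test_form a b omega -> exists a1 b1 a2 b2 : R,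
  [/\ a < a1, b1 < b, bounded_on (obox a1 b1 a2 b2) omega.1
    & bounded_on (obox a1 b1 a2 b2) omega.2].
Proof.
move=> [s1 s2 [K [cK Kab K0]]].
have cont (f : plane -> R) : smooth f -> continuous f.
  by move=> sf z; apply: differentiable_continuous; exact: sf [::] z.
have c1 := cont _ s1; have c2 := cont _ s2.
have [Ke|/set0P Kne] := eqVneq K set0.
  have z0 z : omega.1 z = 0 /\ omega.2 z = 0 by apply: K0; rewrite Ke.
  exists (a + 1), (b - 1), 0, 0; split; [lra|lra| |]; split.
  - exact: continuous_measurable_plane.
  - by exists 0 => z; have [-> _] := z0 z; rewrite normr0.
  - by move=> z _; have [-> _] := z0 z.
  - exact: continuous_measurable_plane.
  - by exists 0 => z; have [_ ->] := z0 z; rewrite normr0.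
  - by move=> z _; have [_ ->] := z0 z.
have wc (f : plane -> R) : continuous f -> {within K, continuous f}.
  by move=> cf; apply: continuous_subspaceT.
have cfst : {within K, continuous (fst : plane -> R)} by apply: wc => z; exact: cvg_fst.
have csnd : {within K, continuous (snd : plane -> R)} by apply: wc => z; exact: cvg_snd.
have [z1 /set_mem Kz1 m1] := compact_EVT_min Kne cK cfst.
have [z2 /set_mem Kz2 m2] := compact_EVT_max Kne cK cfst.
have [z3 /set_mem Kz3 m3] := compact_EVT_min Kne cK csnd.
have [z4 /set_mem Kz4 m4] := compact_EVT_max Kne cK csnd.
have [Iz1 _] := Kab _ Kz1; have [Iz2 _] := Kab _ Kz2.
have az1 : a < z1.1 by move: Iz1; rewrite /= in_itv/= => /andP[].
have zb2 : z2.1 < b by move: Iz2; rewrite /= in_itv/= => /andP[].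
have bnd (f : plane -> R) : continuous f -> (forall z, ~ K z -> f z = 0) ->
    bounded_on (obox ((a + z1.1) / 2) ((z2.1 + b) / 2) (z3.2 - 1) (z4.2 + 1)) f.
  move=> cf f0; split; first exact: continuous_measurable_plane.
    have cn : {within K, continuous (fun z => `|f z|)}.
      by apply: wc => z; apply: (@continuous_comp _ _ _ f (fun y : R => `|y|)); [exact: cf|exact: norm_continuous].
    have [z5 _ m5] := compact_EVT_max Kne cK cn.
    exists `|f z5| => z; have [Kz|Kz] := pselect (K z); first by apply: m5; exact/mem_set.
    by rewrite f0// normr0.
  move=> z nz; apply: f0 => Kz; apply: nz.
  have y1 := m1 z (mem_set Kz); have y2 := m2 z (mem_set Kz).
  have y3 := m3 z (mem_set Kz); have y4 := m4 z (mem_set Kz).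
  by apply/oboxP; split; apply/andP; split; lra.
exists ((a + z1.1) / 2), ((z2.1 + b) / 2), (z3.2 - 1), (z4.2 + 1); split.
- lra.
- lra.
- by apply: bnd => // z /K0[].
- by apply: bnd => // z /K0[].
Qed.

Lemma slopeE (a b : R) (u : R -> R) x : a < x < b -> slope a b u x = sbv_deriv a b u x.
Proof. by move=> xab; rewrite /slope patchE mem_set//= in_itv. Qed.

Lemma in_Loo_bounded (a b : R) (g : R -> R) : in_Loo a b g ->
  exists (h : R -> R) (M : R), [/\ measurable_fun setT h, forall x, `|h x| <= M
    & {ae leb, forall x, a < x < b -> g x = h x}].
Proof.
move=> [h0 /andP[/set_mem mh0 /set_mem fh0] gh0].
set h1 := (h0 \_ `]a, b[) in mh0 fh0.
have [M hM] : exists M : R, {ae leb, forall x, `|h1 x| <= M}.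
  move: fh0; rewrite /= /finite_norm unlock.
  case: ifPn => [_ fh0|]; last first.
    by rewrite lt0e measure_ge0 andbT negbK => /eqP T0 _; exists 0; exact: measure0_ae.
  by have := @ess_supr_bounded _ _ _ leb (fun x => `|h1 x|) fh0.
pose A : set R := [set x | `|h1 x| <= M].
have mA : measurable A.
  have -> : A = (fun x => `|h1 x|) @^-1` `]-oo, M].
    by apply/seteqP; split => x /=; rewrite in_itv.
  rewrite -[X in measurable X]setTI.
  by apply: (measurableT_comp (@normr_measurable R setT) mh0) => //; exact: measurable_itv.
exists (fun x => h1 x * \1_A x), `|M|; split.
- by apply: measurable_funM; [exact: mh0|exact: measurable_indic].
- move=> x; rewrite indicE; case: (boolP (x \in A)) => [/set_mem xA|_].
    by rewrite mulr1 (le_trans xA)// ler_norm.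
  by rewrite mulr0 normr0.
- apply: ae_imply (ae_and hM gh0) => x [hx gx] xab.
  have xI : `]a, b[%classic x by rewrite /= in_itv.
  by rewrite (gx xI) indicE mem_set// mulr1 /h1 patchE mem_set.
Qed.

Section formula.
Variables (a b : R) (F : seq R).
Hypothesis uF : uniq F.
Hypothesis FI : [set` F] `<=` `]a, b[%classic.
Variables (alpha beta : R).
Hypothesis alpha0 : 0 < alpha.
Hypothesis beta0 : 0 <= beta.
Variables (g h : R -> R) (M : R).
Hypothesis mh : measurable_fun setT h.
Hypothesis hM : forall x, `|h x| <= M.
Hypothesis gh : {ae leb, forall x, a < x < b -> g x = h x}.

Lemma G_energy (T : rcurrent R) (J : finType) (mu : J -> R) (w : J -> R -> R) :
  nice_current a b T -> (forall j, 0 <= mu j) -> (forall j, tame a b F (w j)) ->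
  carried a b F T mu w -> (forall s, s \in F -> uncancelled mu w s) ->
  G a b alpha beta g T = (\sum_j (mu j)%:E * energy a b F alpha beta h (w j))%E.
Proof.
move=> nT mu0 tw Tw unc; apply/eqP; rewrite eq_le; apply/andP; split.
  apply: ge_ereal_sup => _ [phi Kphi <-].
  exact: (competitor_le FI alpha0 beta0 mh gh nT mu0 tw Tw Kphi).
have potential s : exists PP : (R -> R) * (R -> R), [/\ forall x : R, is_derive x 1 PP.1 (PP.2 x),
    continuous PP.2, forall x, 0 <= PP.1 x <= alpha
  & forall j, s \in F -> 0 < mu j -> ltrace (w j) s <> rtrace (w j) s ->
      PP.1 (rtrace (w j) s) - PP.1 (ltrace (w j) s) = alpha].
  have [sF|sF] := boolP (s \in F); last first.
    have [|Phi [psi [d c p _ _]]] := @separating_potential R alpha [::] [::] (ltW alpha0).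
      by [].
    by exists (Phi, psi); split => // j; rewrite (negbTE sF).
  pose jumps := [seq j <- enum J | (0 < mu j) && (ltrace (w j) s != rtrace (w j) s)].
  have jumpsP j : j \in jumps = (0 < mu j) && (ltrace (w j) s != rtrace (w j) s).
    by rewrite mem_filter mem_enum andbT.
  have [|Phi [psi [d c p p0 p1]]] := @separating_potential R alpha
      [seq ltrace (w j) s | j <- jumps] [seq rtrace (w j) s | j <- jumps] (ltW alpha0).
    move=> l r /mapP[i]; rewrite jumpsP => /andP[mi /eqP ni] -> /mapP[j].
    by rewrite jumpsP => /andP[mj /eqP nj] ->; exact: (unc s sF).
  exists (Phi, psi); split => // j _ mj /eqP nj /=.
  have jj : j \in jumps by rewrite jumpsP mj nj.
  have -> : Phi (ltrace (w j) s) = 0 by apply: p0; apply/mapP; exists j.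
  have -> : Phi (rtrace (w j) s) = alpha by apply: p1; apply/mapP; exists j.
  by rewrite subr0.
have [PP HPP] := choice potential.
have coin : {ae leb, forall x, forall i j, a < x < b -> x \notin F ->
    ltrace (w i) x = ltrace (w j) x -> slope a b (w i) x = slope a b (w j) x}.
  apply: filter_forall => i; apply: filter_forall => j.
  have [si SFi] := tw i; have [sj SFj] := tw j.
  have := sbv_derivative_coincide si.1 sj.1 (sbv_derivP si) (sbv_derivP sj)
    (tame_finite (tw i)) (tame_finite (tw j)).
  apply: ae_imply => x E xab xF lij.
  have ni : ~ jump_set a b (w i) x by move=> /SFi; exact/negP.
  have nj : ~ jump_set a b (w j) x by move=> /SFj; exact/negP.
  rewrite (slopeE _ xab) (slopeE _ xab); exact: (E xab ni nj lij).
have [Z [mZ Z0 HZ]] := ae_and gh coin.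
have nZ x : ~ Z x -> (a < x < b -> g x = h x) /\ forall i j, a < x < b -> x \notin F ->
    ltrace (w i) x = ltrace (w j) x -> slope a b (w i) x = slope a b (w j) x.
  by move=> nZx; apply: contrapT => nP; apply: nZx; exact: HZ.
apply: (competitor_ge uF FI alpha0 beta0 mh nT mu0 tw Tw hM
  (Phi := fun s => (PP s).1) (psi := fun s => (PP s).2) _ _ _ _ mZ Z0).
- by move=> s x; have [] := HPP s.
- by move=> s; have [] := HPP s.
- by move=> s x; have [] := HPP s.
- by move=> s j sF mj nj; have [_ _ _ H] := HPP s; exact: H.
- by move=> x xab /nZ[+ _]; apply.
- by move=> x i j xab xF /nZ[_ H] lij; exact: H.
Qed.

Lemma G_Gamma (u : R -> R) : tame a b F u ->
  G a b alpha beta g (Gamma a b u) = energy a b F alpha beta h u.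
Proof.
move=> tu.
have Tw : carried a b F (Gamma a b u) (fun _ : unit => 1) (fun=> u).
  move=> p bp; rewrite !big_const !card_unit /= !addr0 !mul1r.
  by split; [exact: (act_tame1 uF FI tu bp)|exact: (act_tame2 uF FI tu bp)].
rewrite (G_energy (nice_tame tu) (fun=> ler01) (fun=> tu) Tw) => [|s _ i j _ _ _ //].
by rewrite big_const card_unit /= mul1e adde0.
Qed.

End formula.

Lemma graph_sum_carried (a b : R) (F : seq R) (T : rcurrent R) (k : nat) (c : 'I_k -> R)
    (u : 'I_k -> R -> R) : uniq F -> [set` F] `<=` `]a, b[%classic ->
  nice_current a b T -> (forall i, tame a b F (u i)) -> is_graph_sum a b T c u ->
  carried a b F T c u.
Proof.
move=> uF FI nT tu Tu p bp; have [a1 [b1 [a2 [b2 [aa1 b1b B]]]]] := bp.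
have [-> ->] := act_extension nT (fun i => nice_tame (tu i)) Tu aa1 b1b B.
split; apply: eq_bigr => i _.
  by rewrite (act_tame1 uF FI (tu i) bp).
by rewrite (act_tame2 uF FI (tu i) bp).
Qed.

Lemma carried_graph_sum (a b : R) (F : seq R) (T : rcurrent R) (k : nat) (c : 'I_k -> R)
    (u : 'I_k -> R -> R) : uniq F -> [set` F] `<=` `]a, b[%classic ->
  nice_current a b T -> (forall i, tame a b F (u i)) -> carried a b F T c u ->
  is_graph_sum a b T c u.
Proof.
move=> uF FI nT tu Tu [p q] /test_form_box[a1 [b1 [a2 [b2 [aa1 b1b /= bp bq]]]]].
have Bp : bounded_form a b p by exists a1, b1, a2, b2.
have Bq : bounded_form a b q by exists a1, b1, a2, b2.
rewrite (rc_actE nT aa1 b1b bp bq); have [-> _] := Tu p Bp; have [_ ->] := Tu q Bq.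
rewrite -big_split/=; apply: eq_bigr => i _.
rewrite (rc_actE (nice_tame (tu i)) aa1 b1b bp bq).
by rewrite (act_tame1 uF FI (tu i) Bp) (act_tame2 uF FI (tu i) Bq) [RHS]mulrDr.
Qed.

End minimal_decomposition.

Theorem theorem3p19 (R : realType) (a b : R) (hab : a < b)
    (alpha beta : R) (halpha : 0 < alpha) (hbeta : 0 <= beta)
    (g : R -> R) (hg : in_Loo a b g)
    (T : rcurrent R) (hT : rectifiable_current a b T)
    (k : nat) (lambda : 'I_k -> R) (u : 'I_k -> R -> R)
    (hlambda : forall i, 0 < lambda i) (hu : forall i, SBV a b (u i))
    (hTC : is_graph_sum a b T lambda u)
    (hST : finite_set (\bigcup_(i in [set: 'I_k]) jump_set a b (u i))) :
  exists (k' : nat) (mu : 'I_k' -> R) (w : 'I_k' -> R -> R),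
    [/\ forall i, 0 <= mu i,
        forall i, SBV a b (w i),
        is_graph_sum a b T mu w
      & G a b alpha beta g T =
        (\sum_(i < k') (mu i)%:E * G a b alpha beta g (Gamma a b (w i)))%E].
Proof.
have nT := rectifiable_nice hT.
have [h [M [mh hM gh]]] := in_Loo_bounded hg.
have [F uF SF] : exists2 F : seq R, uniq F &
    \bigcup_(i in [set: 'I_k]) jump_set a b (u i) = [set` F].
  have [s Ss] := (@finite_seqP R _).1 hST; exists (undup s); first exact: undup_uniq.
  by rewrite Ss; apply/seteqP; split => x /=; rewrite mem_undup.
have FI : [set` F] `<=` `]a, b[%classic by rewrite -SF => x [i _ []].
have tu i : tame a b F (u i) by split; [exact: hu|rewrite -SF => x Sx; exists i].
have Tu := graph_sum_carried uF FI nT tu hTC.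
have [K [nu [v [nu0 tv Tv uv]]]] :=
  recouple_all FI (D := F) (fun s sF => sF) (fun i => ltW (hlambda i)) tu Tu.
pose mu (i : 'I_#|K|) := nu (enum_val i); pose w (i : 'I_#|K|) := v (enum_val i).
have tw i : tame a b F (w i) by exact: tv.
have reE (V : nmodType) (f : K -> V) : \sum_j f j = \sum_(i < #|K|) f (enum_val i).
  by rewrite (reindex _ (onW_bij _ (@enum_val_bij K))).
have Tw : carried a b F T mu w.
  move=> p bp; have [-> ->] := Tv p bp; split; exact: reE.
exists #|K|, mu, w; split.
- by move=> i; exact: nu0.
- by move=> i; have [] := tw i.
- exact: carried_graph_sum uF FI nT tw Tw.
- rewrite (G_energy uF FI halpha hbeta mh hM gh nT (fun i => nu0 (enum_val i)) tw Tw).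
    by apply: eq_bigr => i _; rewrite (G_Gamma uF FI halpha hbeta mh hM gh (tw i)).
  by move=> s sF i j; exact: uv.
Qed.
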